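(* Let $A\in\mathbb{C}^{m\times n}$ and $b\in\mathbb{C}^m$, let $\varepsilon,\eta\in(0,1)$, $k\ge1$ an integer and $\kappa>0$. Suppose that $A$ has rank at most $k$, $\|A\|\le 1$, $\|A^+\|\le\kappa$, and that the orthogonal projection of $b$ onto the column space of $A$ has norm $\Omega(\|b\|)$. Suppose we have $\tilde O(1)$-time query access to the entries of $b$ and $\tilde O(1)$-time length-square access to $A$. Then Algorithm 1 (described in the context) can be executed in time $$\tilde O\!\left(\frac{\kappa^{16}k^6\|A\|_F^6}{\varepsilon^6}\right),$$ outputting an implicit description of $\tilde x$ suitable for query access to its entries and for sampling from its length-square distribution.
   Context: $\|\cdot\|$ is the Euclidean / operator norm, $\|\cdot\|_F$ the Frobenius norm, $A^\dagger$ the conjugate transpose, $A^+$ the pseudoinverse, $A_{i.}$ the $i$-th row, $A_{.j}$ the $j$-th column. Arithmetic operations on numbers are assigned unit cost. $\tilde O(T)$ hides factors polylogarithmic in $T$, in the dimensions $m,n$, and in the failure probability parameter $\eta$. Length-square distribution of a nonzero $v\in\mathbb{C}^n$: the distribution on $[n]$ giving $i$ probability $|v_i|^2/\|v\|^2$. Length-square access to a vector $v$: one can draw a sample from its length-square distribution, query any entry $v_i$, and query $\|v\|$. Length-square access to a matrix $A\in\mathbb{C}^{m\times n}$: length-square access to every row $A_{i.}$ and to the vector $a\in\mathbb{R}^m$ of row norms $a_i=\|A_{i.}\|$. Algorithm 1. Input: $b$, $A$ with $\|A\|\le1$, $\operatorname{rank}(A)=k$, $\|A^+\|\le\kappa$,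 accuracy $\varepsilon$, failure probability $\eta$. 1. Set $r=2^{10}\ln(8n/\eta)\kappa^4k^2\|A\|_F^2/\varepsilon^2$ and $c=2^6\cdot3^4\ln(8r/\eta)\kappa^8k^2\|A\|_F^2/\varepsilon^2$. 2. Sample $r$ row indices $i_1,\dots,i_r$ i.i.d. with $\Pr[i]=\|A_{i.}\|^2/\|A\|_F^2$; let $R\in\mathbb{C}^{r\times n}$ have $s$-th row $\frac{\|A\|_F}{\sqrt r}\frac{A_{i_s.}}{\|A_{i_s.}\|}$. 3. Sample $c$ column indices $j_1,\dots,j_c$ i.i.d., each by choosing $s\in[r]$ uniformly and then $j$ with probability $|A_{i_sj}|^2/\|A_{i_s.}\|^2$; let $C\in\mathbb{C}^{r\times c}$ have $t$-th column $\frac{\|A\|_F}{\sqrt c}\frac{R_{.j_t}}{\|R_{.j_t}\|}$. 4. Compute the left singular vectors $w^{(1)},\dots,w^{(k)}$ of $C$ and singular values $\tilde\sigma_1,\dots,\tilde\sigma_k$. 5. Implicitly define $\tilde v^{(\ell)}:=R^\dagger w^{(\ell)}/\tilde\sigma_\ell$. 6. For each $\ell$ compute $\tilde\lambda_\ell$ with $|\tilde\lambda_\ell-\langle\tilde v^{(\ell)},A^\dagger b\rangle|=O(\varepsilon\tilde\sigma_\ell^2\|b\|/\sqrt k)$. 7. Output $i_1,\dots,i_r$ and $w:=\sum_{\ell=1}^k\frac{\tilde\lambda_\ell}{\tilde\sigma_\ell^3}w^{(\ell)}$; the approximate solution is $\tilde x:=R^\dagger w$.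
   Formalization: Exact singular vectors and values (step 4) are not computable by finitely many arithmetic operations, so a correct SVD of a p×q matrix is taken as a basic operation of cost p·q·min(p,q); r and c are rounded up to integers. *)

(* Defs.v *)
From HB Require Import structures.
From mathcomp Require Import all_boot all_order all_algebra.
From mathcomp Require Import complex.
From mathcomp Require Import boolp classical_sets reals topology normedtype.
From mathcomp Require Import sequences exp.

Set Implicit Arguments.
Unset Strict Implicit.
Unset Printing Implicit Defensive.

Import Order.TTheory GRing.Theory Num.Theory.
Import numFieldNormedType.Exports.

Local Open Scope ring_scope.
Local Open Scope classical_set_scope.
Local Open Scope sesquilinear_scope.

Notation normc := ComplexField.Normc.normc.

(* On a row or column vector this is the Euclidean norm. *)
Definition fnorm (R : realType) m n (A : 'M[R[i]]_(m, n)) : R :=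
  Num.sqrt (\sum_(i < m) \sum_(j < n) normc (A i j) ^+ 2).

Definition opnorm (R : realType) m n (A : 'M[R[i]]_(m, n)) : R :=
  sup [set fnorm (A *m v) | v in [set v : 'cV[R[i]]_n | fnorm v <= 1]].

(* The Moore-Penrose conditions, which determine X. *)
Definition is_pseudoinverse (R : realType) m n
    (A : 'M[R[i]]_(m, n)) (X : 'M[R[i]]_(n, m)) : Prop :=
  [/\ A *m X *m A = A, X *m A *m X = X,
      (A *m X) ^t* = A *m X & (X *m A) ^t* = X *m A].

(* [proj_ortho] projects row vectors onto a row space, whence the transposes. *)
Definition colspace_proj (R : realType) m n
    (A : 'M[R[i]]_(m, n)) (b : 'cV[R[i]]_m) : 'cV[R[i]]_m :=
  (b^T *m proj_ortho A^T)^T.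

Definition is_thin_svd (R : realType) p q (M : 'M[R[i]]_(p, q))
    (U : 'M[R[i]]_(p, minn p q)) (sg : 'rV[R]_(minn p q)) : Prop :=
  exists V : 'M[R[i]]_(q, minn p q),
    [/\ U ^t* *m U = 1%:M, V ^t* *m V = 1%:M,
        M = U *m diag_mx (map_mx (real_complex R) sg) *m V ^t*,
        (forall l, 0 <= sg 0 l) &
        (forall l l' : 'I_(minn p q), (l <= l')%N -> sg 0 l' <= sg 0 l)].

(******************************************************************************)
(* The machine: a randomized RAM over integers and exact complex numbers.     *)
(*                                                                            *)
(* Memory consists of nat-indexed arrays of naturals and of complex numbers.  *)
(* A program is one fixed command for all inputs and its only literals are    *)
(* natural numbers; it reaches A and b through the query and sampling         *)
(* commands only.  Every operation costs 1, except those commands, which cost *)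
(* [etau], and the singular value decomposition of a p x q matrix, of cost    *)
(* p * q * min(p, q) (it is not a finite composition of arithmetic            *)
(* operations).                                                               *)
(******************************************************************************)

Inductive nexp :=
  | NLit of nat
  | NGet of nat & nexp                 (* NGet a e is the cell e of array a *)
  | NAdd of nexp & nexp
  | NSub of nexp & nexp
  | NMul of nexp & nexp.

Inductive cexp :=
  | CNat of nexp
  | CGet of nat & nexp
  | CI
  | CAdd of cexp & cexp
  | COpp of cexp
  | CMul of cexp & cexp
  | CInv of cexp
  | CConj of cexp
  | CSqrt of cexp                      (* CSqrt and CLn act on the real part *)
  | CLn of cexp.

Inductive bexp :=
  | BNLt of nexp & nexp
  | BCLt of cexp & cexp                (* compares real parts *)
  | BNot of bexp
  | BAnd of bexp & bexp.

(* The first two arguments of a command that stores a result are the array    *)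
(* and the cell in which it is stored.                                        *)
Inductive cmd :=
  | Skip
  | NSet of nat & nexp & nexp
  | CSet of nat & nexp & cexp
  | Seq of cmd & cmd
  | If of bexp & cmd & cmd
  | While of bexp & cmd
  | Flip of nat & nexp & cexp          (* 1 with probability e, else 0 *)
  | Unif of nat & nexp & nexp          (* uniform in {0, ..., e - 1} *)
  | QueryB of nat & nexp & nexp        (* b_i *)
  | QueryA of nat & nexp & nexp & nexp (* A_ij *)
  | QueryRowNorm of nat & nexp & nexp  (* a_i = |A_i.|, the norm of a row *)
  | QueryNorm of nat & nexp            (* |a| = |A|_F *)
  | SampleRow of nat & nexp            (* i with probability a_i^2 / |a|^2 *)
  | SampleCol of nat & nexp & nexp     (* j w.p. |A_ij|^2 / |A_i.|^2 *)
  (* Svd p q a u s: thin SVD of the matrix stored row by row in array a;      *)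
  (* the left singular vectors go to the columns of u, the values to s.       *)
  | Svd of nexp & nexp & nat & nat & nat.

Record state (R : realType) := State {
  nmem : nat -> nat -> nat;
  cmem : nat -> nat -> R[i] }.

Definition svd_routine (R : realType) := forall p q : nat,
  'M[R[i]]_(p, q) -> 'M[R[i]]_(p, minn p q) * 'rV[R]_(minn p q).

Definition svd_correct (R : realType) (svd : svd_routine R) : Prop :=
  forall p q (M : 'M[R[i]]_(p, q)), is_thin_svd M (svd p q M).1 (svd p q M).2.

Record env (R : realType) := Env {
  em : nat;
  en : nat;
  eA : 'M[R[i]]_(em, en);
  eb : 'cV[R[i]]_em;
  esvd : svd_routine R;
  etau : nat }.

Definition nset (R : realType) (s : state R) (a x v : nat) : state R :=
  State (fun a' x' => if (a' == a) && (x' == x) then v else nmem s a' x')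
        (cmem s).

Definition cset (R : realType) (s : state R) (a x : nat) (v : R[i]) : state R :=
  State (nmem s)
        (fun a' x' => if (a' == a) && (x' == x) then v else cmem s a' x').

Fixpoint neval (R : realType) (s : state R) (e : nexp) : nat :=
  match e with
  | NLit v => v
  | NGet a e1 => nmem s a (neval s e1)
  | NAdd e1 e2 => (neval s e1 + neval s e2)%N
  | NSub e1 e2 => (neval s e1 - neval s e2)%N
  | NMul e1 e2 => (neval s e1 * neval s e2)%N
  end.

Fixpoint ceval (R : realType) (s : state R) (e : cexp) : R[i] :=
  match e with
  | CNat e1 => (neval s e1)%:R
  | CGet a e1 => cmem s a (neval s e1)
  | CI => Complex 0 1
  | CAdd e1 e2 => ceval s e1 + ceval s e2
  | COpp e1 => - ceval s e1
  | CMul e1 e2 => ceval s e1 * ceval s e2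
  | CInv e1 => (ceval s e1)^-1
  | CConj e1 => conjc (ceval s e1)
  | CSqrt e1 => real_complex R (Num.sqrt (complex.Re (ceval s e1)))
  | CLn e1 => real_complex R (ln (complex.Re (ceval s e1)))
  end.

Fixpoint beval (R : realType) (s : state R) (e : bexp) : bool :=
  match e with
  | BNLt e1 e2 => (neval s e1 < neval s e2)%N
  | BCLt e1 e2 => complex.Re (ceval s e1) < complex.Re (ceval s e2)
  | BNot e1 => ~~ beval s e1
  | BAnd e1 e2 => beval s e1 && beval s e2
  end.

Fixpoint ncost (e : nexp) : nat :=
  match e with
  | NLit _ => 1
  | NGet _ e1 => (ncost e1).+1
  | NAdd e1 e2 | NSub e1 e2 | NMul e1 e2 => (ncost e1 + ncost e2).+1
  end%N.

Fixpoint ccost (e : cexp) : nat :=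
  match e with
  | CNat e1 | CGet _ e1 => (ncost e1).+1
  | CI => 1
  | CAdd e1 e2 | CMul e1 e2 => (ccost e1 + ccost e2).+1
  | COpp e1 | CInv e1 | CConj e1 | CSqrt e1 | CLn e1 => (ccost e1).+1
  end%N.

Fixpoint bcost (e : bexp) : nat :=
  match e with
  | BNLt e1 e2 => (ncost e1 + ncost e2).+1
  | BCLt e1 e2 => (ccost e1 + ccost e2).+1
  | BNot e1 => (bcost e1).+1
  | BAnd e1 e2 => (bcost e1 + bcost e2).+1
  end%N.

(* Cost of one execution step of a command; [If], [While] and [Seq] are       *)
(* charged for the test and the control transfer only, since the commands     *)
(* that they schedule are charged when they are executed.                     *)
Definition cost (R : realType) (E : env R) (s : state R) (c : cmd) : nat :=
  match c with
  | Skip | Seq _ _ => 1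
  | NSet _ x e => (ncost x + ncost e).+1
  | CSet _ x e => (ncost x + ccost e).+1
  | If e _ _ | While e _ => (bcost e).+1
  | Flip _ x e => (ncost x + ccost e).+1
  | Unif _ x e => (ncost x + ncost e).+1
  | QueryB _ x e | QueryRowNorm _ x e | SampleCol _ x e =>
      (ncost x + ncost e + etau E).+1
  | QueryA _ x e1 e2 => (ncost x + ncost e1 + ncost e2 + etau E).+1
  | QueryNorm _ x | SampleRow _ x => (ncost x + etau E).+1
  | Svd p q _ _ _ =>
      let p' := neval s p in let q' := neval s q in
      (ncost p + ncost q + p' * q' * minn p' q').+1
  end%N.

(* A finitely supported distribution is a list of weighted outcomes; it is    *)
(* empty when the command is undefined (query or sample out of range).        *)
Definition dist (R : realType) (T : Type) := seq (R * T).

Definition dirac1 (R : realType) (T : Type) (x : T) : dist R T := [:: (1, x)].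

Definition cset_opt (R : realType) (s : state R) (a x : nat)
    (v : option R[i]) : dist R (state R) :=
  if v is Some z then dirac1 R (cset s a x z) else [::].

Definition svd_store (R : realType) (svd : svd_routine R) (s : state R)
    (p q a u v : nat) : state R :=
  let M := \matrix_(x < p, y < q) cmem s a (x * q + y)%N in
  let l := minn p q in
  let s1 := State (nmem s) (fun a' x' =>
    if a' == u then
      match insub (x' %/ l)%N : option 'I_p,
            insub (x' %% l)%N : option 'I_l with
      | Some x, Some y => (svd p q M).1 x y
      | _, _ => cmem s a' x'
      end
    else cmem s a' x') in
  State (nmem s) (fun a' x' =>
    if a' == v then
      if (insub x' : option 'I_l) is Some y
      then real_complex R ((svd p q M).2 0 y) else cmem s1 a' x'
    else cmem s1 a' x').

Definition atomic_step (R : realType) (E : env R) (s : state R) (c : cmd)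
    : dist R (state R) :=
  match c with
  | NSet a x e => dirac1 R (nset s a (neval s x) (neval s e))
  | CSet a x e => dirac1 R (cset s a (neval s x) (ceval s e))
  | Flip a x e =>
      let p := Num.max 0 (Num.min 1 (complex.Re (ceval s e))) in
      [:: (p, nset s a (neval s x) 1); (1 - p, nset s a (neval s x) 0)]
  | Unif a x e =>
      [seq ((neval s e)%:R^-1, nset s a (neval s x) v)
         | v <- iota 0 (neval s e)]
  | QueryB a x e =>
      cset_opt s a (neval s x)
        (omap (fun i => eb E i 0) (insub (neval s e)))
  | QueryA a x e1 e2 =>
      cset_opt s a (neval s x)
        (obind (fun i => omap (eA E i) (insub (neval s e2)))
               (insub (neval s e1)))
  | QueryRowNorm a x e =>
      cset_opt s a (neval s x)
        (omap (fun i => real_complex R (fnorm (row i (eA E))))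
              (insub (neval s e)))
  | QueryNorm a x =>
      dirac1 R (cset s a (neval s x) (real_complex R (fnorm (eA E))))
  | SampleRow a x =>
      [seq (fnorm (row i (eA E)) ^+ 2 / fnorm (eA E) ^+ 2,
            nset s a (neval s x) i) | i <- enum 'I_(em E)]
  | SampleCol a x e =>
      if (insub (neval s e) : option 'I_(em E)) is Some i then
        [seq (normc (eA E i j) ^+ 2 / fnorm (row i (eA E)) ^+ 2,
              nset s a (neval s x) j) | j <- enum 'I_(en E)]
      else [::]
  | Svd p q a u v =>
      dirac1 R (svd_store (esvd E) s (neval s p) (neval s q) a u v)
  | Skip | Seq _ _ | If _ _ _ | While _ _ => dirac1 R s
  end.

(* The commands scheduled by [c]. *)
Definition unfold_cmd (R : realType) (s : state R) (c : cmd) : seq cmd :=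
  match c with
  | Seq c1 c2 => [:: c1; c2]
  | If e c1 c2 => [:: if beval s e then c1 else c2]
  | While e c1 => if beval s e then [:: c1; c] else [::]
  | _ => [::]
  end.

(* Expectation of [f] (pending commands, elapsed time, state) after at most N *)
(* steps; the run has halted when no command is pending.                      *)
Fixpoint expect (R : realType) (E : env R) (N : nat) (K : seq cmd) (t : nat)
    (s : state R) (f : seq cmd -> nat -> state R -> R) : R :=
  match N, K with
  | N'.+1, c :: K' =>
      \sum_(o <- atomic_step E s c)
        o.1 * expect E N' (unfold_cmd s c ++ K') (t + cost E s c) o.2 f
  | _, _ => f K t s
  end.

(* Probability that the run halts, at a time t and in a state s with          *)
(* [ev t s]; the sequence is nondecreasing and bounded by 1, so it converges. *)
Definition prob (R : realType) (E : env R) (P : cmd) (s : state R)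
    (ev : nat -> state R -> Prop) : R :=
  limn (fun N => expect E N [:: P] 0 s
                   (fun K t s' => (nilp K && `[< ev t s' >])%:R)).

Definition expected_time_le (R : realType) (E : env R) (P : cmd) (s : state R)
    (B : R) : Prop :=
  forall N, expect E N [:: P] 0 s (fun _ t _ => t%:R) <= B.

Definition natceil (R : realType) (x : R) : nat := `|Num.ceil x|%N.

(* r and c are the prescribed real values rounded up to integers; [F] stands  *)
(* for the Frobenius norm of A.                                               *)
Definition nrows (R : realType) (n k : nat) (F kappa eps eta : R) : nat :=
  natceil (2 ^+ 10 * ln (8 * n%:R / eta) * kappa ^+ 4 * k%:R ^+ 2 * F ^+ 2
           / eps ^+ 2).

Definition ncols (R : realType) (r k : nat) (F kappa eps eta : R) : nat :=
  natceil (2 ^+ 6 * 3 ^+ 4 * ln (8 * r%:R / eta) * kappa ^+ 8 * k%:R ^+ 2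
           * F ^+ 2 / eps ^+ 2).

Definition row_sketch (R : realType) m n r (A : 'M[R[i]]_(m, n))
    (ii : {ffun 'I_r -> 'I_m}) : 'M[R[i]]_(r, n) :=
  \matrix_(s < r, j < n)
    (real_complex R (fnorm A / Num.sqrt r%:R / fnorm (row (ii s) A))
     * A (ii s) j).

(* [RR] is the row sketch, and [F] stands for the Frobenius norm of A. *)
Definition col_sketch (R : realType) n r c (F : R) (RR : 'M[R[i]]_(r, n))
    (jj : {ffun 'I_c -> 'I_n}) : 'M[R[i]]_(r, c) :=
  \matrix_(s < r, t < c)
    (real_complex R (F / Num.sqrt c%:R / fnorm (col (jj t) RR)) * RR s (jj t)).

(* Joint probability of drawing the row indices [ii] and the column indices   *)
(* [jj].                                                                      *)
Definition sampling_law (R : realType) m n r c (A : 'M[R[i]]_(m, n))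
    (ii : {ffun 'I_r -> 'I_m}) (jj : {ffun 'I_c -> 'I_n}) : R :=
  (\prod_(s < r) (fnorm (row (ii s) A) ^+ 2 / fnorm A ^+ 2)) *
  (\prod_(t < c) \sum_(s < r)
     r%:R^-1 * (normc (A (ii s) (jj t)) ^+ 2 / fnorm (row (ii s) A) ^+ 2)).

(* [w] is a possible output, given the sampled indices, when the constant     *)
(* hidden in the required accuracy of the coefficients [la] is [K].  Since    *)
(* x / 0 = 0, the terms with [sg 0 l = 0], which exist when A has rank less   *)
(* than k, have [la l = 0] and do not contribute.                             *)
Definition valid_output (R : realType) m n r c
    (A : 'M[R[i]]_(m, n)) (b : 'cV[R[i]]_m) (k : nat) (eps K : R)
    (ii : {ffun 'I_r -> 'I_m}) (jj : {ffun 'I_c -> 'I_n})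
    (w : 'cV[R[i]]_r) : Prop :=
  let RR := row_sketch A ii in
  exists (U : 'M[R[i]]_(r, minn r c)) (sg : 'rV[R]_(minn r c))
         (la : 'I_(minn r c) -> R[i]),
  let v l := real_complex R (sg 0 l)^-1 *: (RR ^t* *m col l U) in
  [/\ is_thin_svd (col_sketch (fnorm A) RR jj) U sg,
      (forall l : 'I_(minn r c), (l < k)%N ->
         normc (la l - ((v l) ^t* *m (A ^t* *m b)) 0 0)
           <= K * (eps * sg 0 l ^+ 2 * fnorm b / Num.sqrt k%:R)) &
      w = \sum_(l < minn r c | (l < k)%N)
            (la l / real_complex R (sg 0 l ^+ 3)) *: col l U].

Definition approx_solution (R : realType) m n r (A : 'M[R[i]]_(m, n))
    (ii : {ffun 'I_r -> 'I_m}) (w : 'cV[R[i]]_r) : 'cV[R[i]]_n :=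
  (row_sketch A ii) ^t* *m w.

(* Array 0 holds (m, n, k) and (kappa, eps, eta); all the rest is 0.          *)
Definition input_state (R : realType) (m n k : nat) (kappa eps eta : R)
    : state R :=
  State (fun a x => if a == 0%N then nth 0%N [:: m; n; k] x else 0%N)
        (fun a x => if a == 0%N
                    then real_complex R (nth 0 [:: kappa; eps; eta] x) else 0).

(* The program ends with r in cell 0 of integer array 1, the row and column   *)
(* indices in integer arrays 2 and 3, and w in complex array 1.               *)
Definition stores_indices (R : realType) m n r c (s : state R)
    (ii : {ffun 'I_r -> 'I_m}) (jj : {ffun 'I_c -> 'I_n}) : Prop :=
  [/\ nmem s 1 0 = r, (forall x : 'I_r, nmem s 2 x = ii x) &
      (forall y : 'I_c, nmem s 3 y = jj y)].

Definition stores_vector (R : realType) r (s : state R) (w : 'cV[R[i]]_r)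
    : Prop :=
  forall x : 'I_r, cmem s 1 x = w x 0.

(* What the query and sampling programs start from: the input parameters, the *)
(* description (i_1, ..., i_r), w of the solution, and a query index q.       *)
Definition description_state (R : realType) (m n k : nat) (kappa eps eta : R)
    r (ii : {ffun 'I_r -> 'I_m}) (w : 'cV[R[i]]_r) (q : nat) : state R :=
  State (fun a x => match a with
           | 0 => nth 0 [:: m; n; k; q] x
           | 1 => if x == 0 then r else 0
           | 2 => oapp (fun y => nat_of_ord (ii y)) 0 (insub x)
           | _ => 0
           end%N)
        (fun a x => match a with
           | 0%N => real_complex R (nth 0 [:: kappa; eps; eta] x)
           | 1%N => oapp (fun y => w y 0) 0 (insub x)
           | _ => 0
           end).

(* The answer to an entry query is left in cell 0 of complex array 2.         *)
Definition answers_queries (R : realType) (E : env R) (Q : cmd)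
    (init : nat -> state R) (x : 'cV[R[i]]_(en E)) (B : R) : Prop :=
  forall j : 'I_(en E),
    prob E Q (init j) (fun t s => t%:R <= B /\ cmem s 2 0 = x j 0) = 1.

Arguments answers_queries {R} E Q init x B.

(* The sample is left in cell 0 of integer array 4.  The probabilities sum to *)
(* 1, so that the program halts almost surely.                                *)
Definition samples_from (R : realType) (E : env R) (S : cmd)
    (init : state R) (x : 'cV[R[i]]_(en E)) (B : R) : Prop :=
  [/\ x != 0, expected_time_le E S init B &
      forall j : 'I_(en E),
        prob E S init (fun _ s => nmem s 4 0 = j)
          = normc (x j 0) ^+ 2 / fnorm x ^+ 2].

Arguments samples_from {R} E S init x B.

(* [soft_bound C p m n eta T] is C T times the p-th power of log_factor,      *)
(* which is at least 1 when m, n >= 1, 0 < eta < 1 and T >= 0.  A bound   *)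
(* O~(T) means soft_bound C p m n eta T for some constants C and p.           *)
Definition log_factor (R : realType) (m n : nat) (eta T : R) : R :=
  1 + ln (1 + T) + ln m%:R + ln n%:R + ln eta^-1.

Definition soft_bound (R : realType) (C : R) (p m n : nat) (eta T : R) : R :=
  C * T * log_factor m n eta T ^+ p.

(* Main.v *)
Require Import Defs.
From HB Require Import structures.
From mathcomp Require Import all_boot all_order all_algebra.
From mathcomp Require Import complex.
From mathcomp Require Import boolp classical_sets reals topology normedtype.
From mathcomp Require Import sequences exp.
From mathcomp Require Import ring lra zify.

Set Implicit Arguments.
Unset Strict Implicit.
Unset Printing Implicit Defensive.

Import Order.TTheory GRing.Theory Num.Theory.
Import numFieldNormedType.Exports.

Local Open Scope ring_scope.
Local Open Scope classical_set_scope.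
Local Open Scope sesquilinear_scope.

(** The rows and columns are sampled as prescribed.  Since [\rank A <= k] and
    [opnorm A <= 1], the square of the Frobenius norm is at most k, so the
    prescribed numbers of samples are large enough for concentration in the
    Frobenius norm: a Bernstein-type inequality for sums in a Hilbert space,
    obtained from the potential E exp (la * sqrt (la^-2 + |S|^2)), replaces a
    matrix Chernoff bound.  It gives |A^* A - R^* R| <= 1/(2 kappa^2) and
    |R R^* - C C^*| <= 1/(4 kappa^2), so R and C have the same column space and
    nonzero singular values at least 1/(2 kappa).

    All coefficients are obtained from a single estimate of y = R A^* b: if
    (i, j) is drawn with probability |A_ij|^2 / F^2, then F^2 b_i / A_ij times
    column j of R has mean y and second moment at most F^4 |b|^2.  The means of
    r independent batches are computed, and the centre of the smallest ball
    that contains more than half of them is close to y, except with probability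
    2^-r.  The coefficient of index l is then <U_l, y> / sg_l.

    To sample from x = R^* w, draw s uniformly, then j from row s of R, and
    accept j with probability |x_j|^2 / (|w|^2 |R_.j|^2); a trial succeeds with
    probability |x|^2 / (F^2 |w|^2) >= 1/(2 kappa^2 F^2). *)

(** * Program logic *)

(** Everything has to fit into r^2 c + r^3 steps, since r^2 c already is the announced bound up to
    logarithms. Estimating the k coefficients one by one is replaced by one estimate of y, each
    sample of which costs r queries: as U has orthonormal columns, an error e in y is an error at
    most e in every <U_l, y>. Coefficient l is <U_l, y> / sg_l and may be off by a multiple of eps
    sg_l^2 |b| / sqrt k, so with sg_l >= 1/(2 kappa) an error of order eps |b| / (sqrt k kappa^3) in
    y is allowed. The variance F^4 |b|^2 then asks for about F^4 k kappa^6 / eps^2 samples, which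
    the prescribed c covers because F^2 <= k. Chebyshev's inequality on such a batch fails with
    constant probability, and a factor 1/eta in the number of samples would not be polylogarithmic;
    hence the r batches and the selection of a central one. The regression program always halts
    within the bound, so the law of the indices is exact; only the rejection loop of the sampler is
    unbounded and needs an argument of its own. *)

Fixpoint nwrites (c : cmd) : seq nat :=
  match c with
  | NSet a _ _ | Flip a _ _ | Unif a _ _ | SampleRow a _ | SampleCol a _ _ =>
      [:: a]
  | Seq c1 c2 | If _ c1 c2 => nwrites c1 ++ nwrites c2
  | While _ c1 => nwrites c1
  | _ => [::]
  end.

Fixpoint cwrites (c : cmd) : seq nat :=
  match c with
  | CSet a _ _ | QueryB a _ _ | QueryA a _ _ _ | QueryRowNorm a _ _
  | QueryNorm a _ => [:: a]
  | Svd _ _ _ u v => [:: u; v]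
  | Seq c1 c2 | If _ c1 c2 => cwrites c1 ++ cwrites c2
  | While _ c1 => cwrites c1
  | _ => [::]
  end.

(** Framing is by whole arrays: the array numbers of a command are literals, so the written arrays
    can be read off the syntax, unlike the written cells. *)
Definition frame (R : realType) (L : seq cmd) (s s' : state R) : Prop :=
  (forall a x, a \notin flatten (map nwrites L) -> nmem s' a x = nmem s a x) /\
  (forall a x, a \notin flatten (map cwrites L) -> cmem s' a x = cmem s a x).

Lemma frame_refl (R : realType) L (s : state R) : frame L s s.
Proof. by []. Qed.

Lemma frame_trans (R : realType) L (s1 s2 s3 : state R) :
  frame L s1 s2 -> frame L s2 s3 -> frame L s1 s3.
Proof.
by move=> [h1 h2] [h3 h4]; split=> a x ha; [rewrite h3 ?h1|rewrite h4 ?h2].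
Qed.

Lemma frame_sub (R : realType) L1 L2 (s s' : state R) :
  {subset flatten (map nwrites L1) <= flatten (map nwrites L2)} ->
  {subset flatten (map cwrites L1) <= flatten (map cwrites L2)} ->
  frame L1 s s' -> frame L2 s s'.
Proof.
move=> hn hc [h1 h2]; split=> a x ha.
  by rewrite h1 //; apply: contra ha; apply: hn.
by rewrite h2 //; apply: contra ha; apply: hc.
Qed.

Lemma frame_unfold (R : realType) c (s s1 s2 : state R) :
  frame (unfold_cmd s c) s1 s2 -> frame [:: c] s1 s2.
Proof.
case: c => /=; try by move=> *; apply: frame_sub; last eassumption.
- by move=> c1 c2; apply: frame_sub => a; rewrite /= !cats0.
- move=> e c1 c2; case: (beval s e); apply: frame_sub => a;
    by rewrite /= !cats0 mem_cat => ->; rewrite ?orbT.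
- move=> e c1; case: (beval s e); apply: frame_sub => a;
    by rewrite //= !cats0 mem_cat orbb.
Qed.

Definition elapsed (R : realType) (_ : seq cmd) (t : nat) (_ : state R) : R :=
  t%:R.

(* Running [L] from [s] amounts to drawing [o] with probability [w o] and then
   moving to the state [ss o], in [st o] steps and [tt o] units of time.  The
   last clause covers runs interrupted within [L]: the truncated subtraction
   then gives a run that is stopped after [L], hence later. *)
Definition rnd (R : realType) (E : env R) (L : seq cmd) (s : state R)
    (W : finType) (w : W -> R) (tb : nat) (Q : W -> state R -> Prop) : Prop :=
  exists (n0 : nat) (st tt : W -> nat) (ss : W -> state R),
  [/\ (forall o, 0 <= w o) /\ \sum_o w o = 1,
      forall o, (st o <= n0)%N,
      forall o, w o != 0 ->
        [/\ (tt o <= tb)%N, frame L s (ss o) & Q o (ss o)],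
      forall N K t f, (n0 <= N)%N ->
        expect E N (L ++ K) t s f
        = \sum_o w o * expect E (N - st o)%N K (t + tt o)%N (ss o) f &
      forall N K t,
        expect E N (L ++ K) t s (@elapsed R)
        <= \sum_o w o * expect E (N - st o)%N K (t + tt o)%N (ss o)
                          (@elapsed R)].

Section Rules.
Variables (R : realType) (E : env R).
Implicit Types (s : state R) (c : cmd) (L K : seq cmd).

Lemma sum_unit F : \sum_(o : unit) F o = F tt :> R.
Proof. by rewrite (bigD1 tt) //= big1 => [|[]//]; rewrite addr0. Qed.

Lemma rnd_conseq L s (W : finType) (w : W -> R) tb tb'
    (Q Q' : W -> state R -> Prop) :
  rnd E L s w tb Q -> (tb <= tb')%N ->
  (forall o s', w o != 0 -> frame L s s' -> Q o s' -> Q' o s') ->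
  rnd E L s w tb' Q'.
Proof.
move=> [n0 [st [tt [ss [h1 h2 h3 h4 h5]]]]] htb hQ.
exists n0, st, tt, ss; split=> // o wo.
have [k1 k2 k3] := h3 o wo; split=> //; first exact: leq_trans htb.
exact: hQ.
Qed.

(** The composition rules build outcomes as nested pairs, often with [unit]; this lemma restores the
    outcome type wanted by the caller. *)
Lemma rnd_bij L s (W W' : finType) (h : W' -> W) (w : W -> R) w' tb Q Q' :
  bijective h -> (forall o, w' o = w (h o)) ->
  (forall o s', Q (h o) s' -> Q' o s') ->
  rnd E L s w tb Q -> rnd E L s w' tb Q'.
Proof.
move=> hh ww' hQ [n0 [st [tt [ss [[h1 h1'] h2 h3 h4 h5]]]]].
have hr F : \sum_o F o = \sum_o F (h o) :> R.
  by rewrite (reindex h) //; apply: onW_bij.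
exists n0, (st \o h), (tt \o h), (ss \o h); split=> /=.
- split; first by move=> o; rewrite ww'.
  by rewrite -h1' hr; apply: eq_bigr => o _; rewrite ww'.
- by move=> o.
- by move=> o; rewrite ww' => /h3[? ? ?]; split=> //; apply: hQ.
- move=> N K t f hN; rewrite h4 // hr.
  by apply: eq_bigr => o _; rewrite ww'.
- move=> N K t; apply: (le_trans (h5 _ _ _)); rewrite hr.
  by apply: ler_sum => o _; rewrite ww'.
Qed.

Lemma rnd_nil s (Q : unit -> state R -> Prop) :
  Q tt s -> rnd E [::] s (fun _ : unit => 1) 0 Q.
Proof.
move=> hQ; exists 0%N, (fun=> 0%N), (fun=> 0%N), (fun=> s).
have hs := sum_unit.
split=> //.
- by move=> [] _; split.
- by move=> N K t f _; rewrite hs mul1r subn0 addn0.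
- by move=> N K t; rewrite hs mul1r subn0 addn0.
Qed.

Lemma rnd_atomic c s (W : finType) (w : W -> R) (ss : W -> state R) tb Q :
  unfold_cmd s c = [::] ->
  atomic_step E s c = [seq (w o, ss o) | o <- enum W] ->
  (forall o, 0 <= w o) -> \sum_o w o = 1 -> (cost E s c <= tb)%N ->
  (forall o, w o != 0 -> frame [:: c] s (ss o) /\ Q o (ss o)) ->
  rnd E [:: c] s w tb Q.
Proof.
move=> hu ha hw hw1 hc hQ.
exists 1%N, (fun=> 1%N), (fun=> cost E s c), ss; split=> //.
- by move=> o /hQ[].
- move=> [|N] K t f // _ /=.
  rewrite ha hu /= big_map big_enum /=.
  by apply: eq_bigr => o _; rewrite subn1.
(* A run stopped before this command has elapsed time t, at most that of the run charged for the
   command. *)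
- move=> [|N] K t /=.
    rewrite -mulr_suml hw1 mul1r.
    by rewrite /elapsed /= ler_nat leq_addr.
  rewrite ha hu /= big_map big_enum /=.
  by apply: ler_sum => o _; rewrite subn1.
Qed.

Lemma rnd_control c s (W : finType) (w : W -> R) tb tb' Q :
  atomic_step E s c = dirac1 R s ->
  rnd E (unfold_cmd s c) s w tb Q ->
  (cost E s c + tb <= tb')%N ->
  rnd E [:: c] s w tb' Q.
Proof.
move=> ha [n0 [st [tt [ss [[h1 h1'] h2 h3 h4 h5]]]]] htb.
exists n0.+1, (fun o => (st o).+1), (fun o => cost E s c + tt o)%N, ss.
split=> //.
- move=> o /h3[k1 k2 k3]; split=> //; last exact: frame_unfold k2.
  by apply: leq_trans htb; rewrite leq_add2l.
- move=> [|N] K t f // hN /=.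
  rewrite ha big_seq1 /= mul1r h4 //.
  by apply: eq_bigr => o _; rewrite subSS addnA.
- move=> [|N] K t /=.
    have -> : elapsed (c :: K) t s = \sum_o w o * t%:R :> R.
      by rewrite -mulr_suml h1' mul1r.
    apply: ler_sum => o _; apply: ler_wpM2l => //.
    by rewrite /elapsed ler_nat leq_addr.
  rewrite ha big_seq1 /= mul1r.
  apply: (le_trans (h5 _ _ _)).
  by apply: ler_sum => o _; rewrite subSS addnA.
Qed.

(** The law and the outcome states of [L2] may depend on the first outcome. After an outcome of
    weight 0 the conditional law need not even sum to 1, as for the entries of a zero row. *)
Lemma rnd_cat L1 L2 s (W1 W2 : finType) (w1 : W1 -> R) (w2 : W1 -> W2 -> R)
    tb1 tb2 Q1 Q2 :
  rnd E L1 s w1 tb1 Q1 ->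
  (forall o s1, w1 o != 0 -> frame L1 s s1 -> Q1 o s1 ->
     rnd E L2 s1 (w2 o) tb2 (Q2 o)) ->
  (forall o p, 0 <= w2 o p) -> (forall o, w1 o != 0 -> \sum_p w2 o p = 1) ->
  rnd E (L1 ++ L2) s (fun p => w1 p.1 * w2 p.1 p.2) (tb1 + tb2)
    (fun p => Q2 p.1 p.2).
Proof.
move=> [n1 [st1 [tt1 [ss1 [[h1 h1'] h2 h3 h4 h5]]]]] H hw2 hw2'.
(* Witnesses are chosen outcome by outcome; those of weight 0 get a dummy, which [ok] keeps out of
   the common step bound. *)
have {H} : forall o, exists z : nat * (W2 -> nat) * (W2 -> nat) * (W2 -> state R),
  let: (n0, st, te, ss) := z in
  w1 o != 0 ->
  [/\ forall o, (st o <= n0)%N,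
      forall p, w2 o p != 0 ->
        [/\ (te p <= tb2)%N, frame L2 (ss1 o) (ss p) & Q2 o p (ss p)],
      forall N K t f, (n0 <= N)%N ->
        expect E N (L2 ++ K) t (ss1 o) f
        = \sum_p w2 o p * expect E (N - st p)%N K (t + te p)%N (ss p) f &
      forall N K t,
        expect E N (L2 ++ K) t (ss1 o) (@elapsed R)
        <= \sum_p w2 o p * expect E (N - st p)%N K (t + te p)%N (ss p)
                          (@elapsed R)].
  move=> o; have [wo|wo] := eqVneq (w1 o) 0.
    by exists (0%N, fun=> 0%N, fun=> 0%N, fun=> s).
  have [k1 k2 k3] := h3 o wo.
  have [n0 [st [tt [ss [_ ? ? ? ?]]]]] := H _ _ wo k2 k3.
  by exists (n0, st, tt, ss).
move/choice => [z hz].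
pose n2 o := (z o).1.1.1; pose st2 o := (z o).1.1.2.
pose tt2 o := (z o).1.2; pose ss2 o := (z o).2.
pose ok o := w1 o != 0.
have {}hz o : ok o ->
  [/\ forall p, (st2 o p <= n2 o)%N,
      forall p, w2 o p != 0 ->
        [/\ (tt2 o p <= tb2)%N, frame L2 (ss1 o) (ss2 o p)
          & Q2 o p (ss2 o p)],
      forall N K t f, (n2 o <= N)%N ->
        expect E N (L2 ++ K) t (ss1 o) f
        = \sum_p w2 o p * expect E (N - st2 o p)%N K (t + tt2 o p)%N (ss2 o p) f &
      forall N K t,
        expect E N (L2 ++ K) t (ss1 o) (@elapsed R)
        <= \sum_p w2 o p * expect E (N - st2 o p)%N K (t + tt2 o p)%N (ss2 o p)
                          (@elapsed R)].
  by have := hz o; rewrite /n2 /st2 /tt2 /ss2; case: (z o) => [[[]]].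
pose n0 := (n1 + \max_(o | ok o) n2 o)%N.
exists n0, (fun p => if ok p.1 then st1 p.1 + st2 p.1 p.2 else 0)%N,
  (fun p => tt1 p.1 + tt2 p.1 p.2)%N, (fun p => ss2 p.1 p.2).
have pair_sum F : \sum_(p : W1 * W2) F p = \sum_o \sum_p F (o, p) :> R.
  by rewrite pair_bigA /=; apply: eq_bigr => -[].
split.
- split; first by move=> [o p]; apply: mulr_ge0.
  rewrite pair_sum -h1'; apply: eq_bigr => o _ /=; rewrite -mulr_sumr.
  have [->|wo] := eqVneq (w1 o) 0; first by rewrite mul0r.
  by rewrite hw2' ?mulr1.
- move=> [o p] /=; case: ifP => // oo; apply: leq_add => //.
  have [k1 _ _ _] := hz o oo; apply: (leq_trans (k1 p)).
  exact: (@leq_bigmax_cond _ ok n2 o oo).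
- move=> [o p] /=; rewrite mulf_eq0 negb_or => /andP[wo wp].
  have [k1 k2 k3] := h3 o wo; have [_ /(_ p wp)[k4 k5 k6] _ _] := hz o wo.
  split=> //; first exact: leq_add.
  apply: (@frame_trans _ _ _ (ss1 o)).
    apply: frame_sub k2 => a; rewrite map_cat flatten_cat mem_cat => -> //.
  by apply: frame_sub k5 => a; rewrite map_cat flatten_cat mem_cat orbC => ->.
- move=> N K t f hN; rewrite -catA h4; last first.
    by apply: leq_trans hN; rewrite leq_addr.
  rewrite pair_sum; apply: eq_bigr => o _ /=.
  have [->|oo] := eqVneq (w1 o) 0.
    by rewrite mul0r big1 // => p _; rewrite !mul0r.
  have [_ _ k _] := hz o oo.
  rewrite k; last first.
    rewrite leq_subRL; last first.
      by apply: leq_trans hN; apply: leq_trans (h2 o) (leq_addr _ _).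
    apply: leq_trans hN; apply: leq_add => //.
    exact: (@leq_bigmax_cond _ ok n2 o oo).
  rewrite mulr_sumr; apply: eq_bigr => p _.
  by rewrite mulrA /ok oo subnDA addnA.
- move=> N K t; rewrite -catA; apply: (le_trans (h5 _ _ _)).
  rewrite pair_sum; apply: ler_sum => o _ /=.
  have [->|oo] := eqVneq (w1 o) 0.
    by rewrite mul0r big1 // => p _; rewrite !mul0r.
  have [_ _ _ k] := hz o oo.
  apply: (le_trans (ler_wpM2l (h1 o) (k _ _ _))).
  rewrite mulr_sumr; apply: ler_sum => p _.
  by rewrite mulrA /ok oo subnDA addnA.
Qed.

Definition det L s tb (Q : state R -> Prop) : Prop :=
  rnd E L s (fun _ : unit => 1) tb (fun _ => Q).

Lemma det_rnd_cat L1 L2 s (W : finType) (w : W -> R) tb1 tb2 Q1 Q :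
  det L1 s tb1 Q1 ->
  (forall s1, frame L1 s s1 -> Q1 s1 -> rnd E L2 s1 w tb2 Q) ->
  rnd E (L1 ++ L2) s w (tb1 + tb2) Q.
Proof.
move=> H1 H2.
have H1' := H1; case: H1' => [n0 [st [tt' [ss [_ _ h _ _]]]]].
have [_ k2 k3] := h tt (oner_neq0 _).
have [_ [_ [_ [_ [[hw hw1] _ _ _ _]]]]] := H2 _ k2 k3.
apply: (@rnd_bij _ _ (unit * W)%type W (fun p => (tt, p))); last first.
- apply: (rnd_cat (w2 := fun _ => w) (Q2 := fun _ => Q) H1) => //.
  by move=> o s1 _ hf hs; apply: H2.
- by [].
- by move=> o /=; rewrite mul1r.
- by exists snd => [p|[[] p]].
Qed.

Lemma rnd_det_cat L1 L2 s (W : finType) (w : W -> R) tb1 tb2 Q1 Q :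
  rnd E L1 s w tb1 Q1 ->
  (forall o s1, w o != 0 -> frame L1 s s1 -> Q1 o s1 -> det L2 s1 tb2 (Q o)) ->
  rnd E (L1 ++ L2) s w (tb1 + tb2) Q.
Proof.
move=> H1 H2.
apply: (@rnd_bij _ _ (W * unit)%type W (fun p => (p, tt))); last first.
- apply: (rnd_cat (w2 := fun _ _ => 1) (Q2 := fun p _ => Q p) H1) => //.
  by move=> o; rewrite sum_unit.
- by [].
- by move=> o /=; rewrite mulr1.
- by exists fst => [p|[p []]].
Qed.

Lemma tuple_cons_bij (W : Type) n :
  bijective (fun p : W * n.-tuple W => [tuple of p.1 :: p.2]).
Proof.
exists (fun g => (thead g, [tuple of behead g])) => [[x g]|g] /=.
  by rewrite theadE; congr pair; apply: val_inj.
by rewrite [RHS]tuple_eta.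
Qed.

Lemma big_tuple_cons (W : finType) n (F : n.+1.-tuple W -> R) :
  \sum_g F g = \sum_x \sum_(g : n.-tuple W) F [tuple of x :: g].
Proof.
rewrite (reindex _ (onW_bij _ (tuple_cons_bij W n))) /=.
by rewrite pair_bigA /=; apply: eq_bigr => -[].
Qed.

Lemma big_tuple0 (W : finType) (F : 0.-tuple W -> R) :
  \sum_g F g = F [tuple].
Proof.
rewrite (bigD1 [tuple]) //= big1 ?addr0 // => g /eqP[].
exact: tuple0.
Qed.

Definition iid (W : finType) (w : W -> R) n (g : n.-tuple W) : R :=
  \prod_(x <- g) w x.

Lemma iid_ge0 (W : finType) (w : W -> R) n (g : n.-tuple W) :
  (forall x, 0 <= w x) -> 0 <= iid w g.
Proof. by move=> hw; apply: prodr_ge0. Qed.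

Lemma iid_sum1 (W : finType) (w : W -> R) n :
  \sum_x w x = 1 -> \sum_(g : n.-tuple W) iid w g = 1.
Proof.
move=> hw; elim: n => [|n IH]; first by rewrite big_tuple0 /iid big_nil.
rewrite big_tuple_cons -[RHS]hw; apply: eq_bigr => x _.
rewrite -[RHS]mulr1 -[in RHS]IH mulr_sumr.
by apply: eq_bigr => g _; rewrite /iid big_cons.
Qed.

(** The invariant is indexed by the history of the draws, so that after n rounds the outcome is the
    tuple of all draws and its law is the product law. *)
Lemma rnd_while e c (W : finType) (w : W -> R) tb n
    (Inv : seq W -> state R -> Prop) s :
  (forall x, 0 <= w x) -> \sum_x w x = 1 ->
  (forall h s', (size h < n)%N -> frame [:: c] s s' -> Inv h s' ->
     beval s' e /\
     rnd E [:: c] s' w tb (fun x => Inv (rcons h x))) ->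
  (forall h s', size h = n -> frame [:: c] s s' -> Inv h s' -> ~~ beval s' e) ->
  Inv [::] s ->
  rnd E [:: While e c] s (@iid _ w n) (n * (tb + (bcost e).+1) + (bcost e).+1)
    (fun g s' => Inv g s').
Proof.
move=> hw hw1 hstep hend hinit.
(* Generalised to p remaining rounds after a history h, only the remaining draws being random. *)
have claim : forall p h s', (size h + p)%N = n -> frame [:: c] s s' -> Inv h s' ->
  rnd E [:: While e c] s' (@iid _ w p) (p * (tb + (bcost e).+1) + (bcost e).+1)
    (fun g s' => Inv (h ++ g) s'); last first.
  exact: (claim n [::] s (add0n n) (frame_refl _ _) hinit).
elim=> [|p IH] h s' hp hf hi.
  have hne : ~~ beval s' e by apply: (hend h); rewrite -?hp ?addn0.
  apply: (@rnd_control _ _ _ _ 0) => //=; last by rewrite addn0.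
  rewrite (negbTE hne).
  apply: (@rnd_bij _ _ _ _ (fun=> tt) (fun=> 1) _ _ (fun _ => Inv h)).
  - exists (fun=> [tuple]) => [g|[]//]; by rewrite (tuple0 g).
  - by move=> g; rewrite (tuple0 g) /iid big_nil.
  - by move=> g s2; rewrite (tuple0 g) cats0.
  - exact: rnd_nil.
have hlt : (size h < n)%N by rewrite -hp addnS ltnS leq_addr.
have [he hb] := hstep h s' hlt hf hi.
apply: (@rnd_control _ _ _ _ (tb + (p * (tb + (bcost e).+1) + (bcost e).+1))).
- by [].
- rewrite /= he.
  apply: (@rnd_bij _ _ _ _ (fun g : p.+1.-tuple W => (thead g, [tuple of behead g])));
    last first.
  + apply: (@rnd_cat [:: c] [:: While e c] _ _ _ _ (fun _ => @iid _ w p) _ _ _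
      (fun x g => Inv (rcons h x ++ g)) hb).
    * move=> x s1 wx hf1 hi1; apply: IH => //.
        by rewrite size_rcons addSn -hp addnS.
      exact: frame_trans hf hf1.
    * by move=> _ g; apply: iid_ge0.
    * by move=> ? _; apply: iid_sum1.
  + by move=> g s2 /=; rewrite cat_rcons {3}(tuple_eta g).
  + by move=> g; rewrite {1}(tuple_eta g) /iid big_cons.
  + exists (fun p : W * p.-tuple W => [tuple of p.1 :: p.2]) => [g|[x g]] /=.
      by rewrite [RHS]tuple_eta.
    by rewrite theadE; congr pair; apply: val_inj.
- by rewrite /=; lia.
Qed.

Lemma det_while e c tb n (Inv : nat -> state R -> Prop) s :
  (forall k s', (k < n)%N -> frame [:: c] s s' -> Inv k s' ->
     beval s' e /\ det [:: c] s' tb (Inv k.+1)) ->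
  (forall s', frame [:: c] s s' -> Inv n s' -> ~~ beval s' e) ->
  Inv 0%N s ->
  det [:: While e c] s (n * (tb + (bcost e).+1) + (bcost e).+1) (Inv n).
Proof.
move=> hstep hend hinit.
apply: (@rnd_bij _ _ _ _ (fun _ => nseq_tuple n tt) (@iid _ (fun _ : unit => 1) n)
  _ _ (fun g => Inv (size g))).
- exists (fun=> tt); first by case.
  move=> g; apply: val_inj => /=; rewrite -[in LHS](size_tuple g).
  by elim: (val g) => //= -[] t ->.
- by move=> o; rewrite /iid big1.
- by move=> _ s'; rewrite size_tuple.
- apply: (@rnd_while _ _ _ _ _ _ (fun h => Inv (size h))) => //.
  + by rewrite sum_unit.
  + move=> h s' h1 h2 h3; have [h4 h5] := hstep _ _ h1 h2 h3; split=> //.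
    by apply: (rnd_conseq h5) => // x s2 _ _; rewrite size_rcons.
  + by move=> h s' h1 h2 h3; apply: hend; rewrite -?h1.
Qed.

Lemma rnd_seq_det c1 c2 s (W : finType) (w : W -> R) tb1 tb2 tb Q1 Q :
  det [:: c1] s tb1 Q1 ->
  (forall s1, frame [:: c1] s s1 -> Q1 s1 -> rnd E [:: c2] s1 w tb2 Q) ->
  (tb1 + tb2 < tb)%N ->
  rnd E [:: Seq c1 c2] s w tb Q.
Proof.
move=> h1 h2 h3; apply: (@rnd_control _ _ _ _ (tb1 + tb2)) => //=.
exact: (det_rnd_cat h1 h2).
Qed.

Lemma det_seq_rnd c1 c2 s (W : finType) (w : W -> R) tb1 tb2 tb Q1 Q :
  rnd E [:: c1] s w tb1 Q1 ->
  (forall o s1, w o != 0 -> frame [:: c1] s s1 -> Q1 o s1 ->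
     det [:: c2] s1 tb2 (Q o)) ->
  (tb1 + tb2 < tb)%N ->
  rnd E [:: Seq c1 c2] s w tb Q.
Proof.
move=> h1 h2 h3; apply: (@rnd_control _ _ _ _ (tb1 + tb2)) => //=.
exact: (rnd_det_cat h1 h2).
Qed.

Lemma rnd_seq c1 c2 s (W1 W2 : finType) (w1 : W1 -> R) (w2 : W1 -> W2 -> R)
    tb1 tb2 tb Q1 Q2 :
  rnd E [:: c1] s w1 tb1 Q1 ->
  (forall o s1, w1 o != 0 -> frame [:: c1] s s1 -> Q1 o s1 ->
     rnd E [:: c2] s1 (w2 o) tb2 (Q2 o)) ->
  (forall o p, 0 <= w2 o p) -> (forall o, w1 o != 0 -> \sum_p w2 o p = 1) ->
  (tb1 + tb2 < tb)%N ->
  rnd E [:: Seq c1 c2] s (fun p => w1 p.1 * w2 p.1 p.2) tb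
    (fun p => Q2 p.1 p.2).
Proof.
move=> h1 h2 h3 h4 h5; apply: (@rnd_control _ _ _ _ (tb1 + tb2)) => //=.
exact: (rnd_cat h1 h2).
Qed.

Lemma det_atomic c s s' tb (Q : state R -> Prop) :
  unfold_cmd s c = [::] -> atomic_step E s c = dirac1 R s' ->
  (cost E s c <= tb)%N -> frame [:: c] s s' -> Q s' -> det [:: c] s tb Q.
Proof.
move=> hu ha hc hf hQ; apply: (@rnd_atomic _ _ _ _ (fun=> s')) => //.
  by rewrite ha /dirac1 enumT unlock.
by rewrite sum_unit.
Qed.

Lemma frame_nset c s a x v : a \in nwrites c -> frame [:: c] s (nset s a x v).
Proof.
move=> ha; split=> // a' x' /=; rewrite cats0 => /negP ha'.
by case: eqP => // h; case: ha'; rewrite h.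
Qed.

Lemma frame_cset c s a x v : a \in cwrites c -> frame [:: c] s (cset s a x v).
Proof.
move=> ha; split=> // a' x' /=; rewrite cats0 => /negP ha'.
by case: eqP => // h; case: ha'; rewrite h.
Qed.

Lemma det_nset a x e s tb (Q : state R -> Prop) :
  ((ncost x + ncost e).+1 <= tb)%N ->
  Q (nset s a (neval s x) (neval s e)) -> det [:: NSet a x e] s tb Q.
Proof.
by move=> hc hQ; apply: det_atomic hQ => //; apply: frame_nset; rewrite inE.
Qed.

Lemma det_cset a x e s tb (Q : state R -> Prop) :
  ((ncost x + ccost e).+1 <= tb)%N ->
  Q (cset s a (neval s x) (ceval s e)) -> det [:: CSet a x e] s tb Q.
Proof.
by move=> hc hQ; apply: det_atomic hQ => //; apply: frame_cset; rewrite inE.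
Qed.

Lemma det_queryB a x e (i : 'I_(em E)) s tb (Q : state R -> Prop) :
  neval s e = i -> ((ncost x + ncost e + etau E).+1 <= tb)%N ->
  Q (cset s a (neval s x) (eb E i 0)) -> det [:: QueryB a x e] s tb Q.
Proof.
move=> hi hc hQ; apply: det_atomic hQ => //=; first by rewrite hi valK.
by apply: frame_cset; rewrite inE.
Qed.

Lemma det_queryA a x e1 e2 (i : 'I_(em E)) (j : 'I_(en E)) s tb
    (Q : state R -> Prop) :
  neval s e1 = i -> neval s e2 = j ->
  ((ncost x + ncost e1 + ncost e2 + etau E).+1 <= tb)%N ->
  Q (cset s a (neval s x) (eA E i j)) -> det [:: QueryA a x e1 e2] s tb Q.
Proof.
move=> hi hj hc hQ; apply: det_atomic hQ => //=; first by rewrite hi hj !valK.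
by apply: frame_cset; rewrite inE.
Qed.

Lemma det_queryRowNorm a x e (i : 'I_(em E)) s tb (Q : state R -> Prop) :
  neval s e = i -> ((ncost x + ncost e + etau E).+1 <= tb)%N ->
  Q (cset s a (neval s x) (real_complex R (fnorm (row i (eA E))))) ->
  det [:: QueryRowNorm a x e] s tb Q.
Proof.
move=> hi hc hQ; apply: det_atomic hQ => //=; first by rewrite hi valK.
by apply: frame_cset; rewrite inE.
Qed.

Lemma det_queryNorm a x s tb (Q : state R -> Prop) :
  ((ncost x + etau E).+1 <= tb)%N ->
  Q (cset s a (neval s x) (real_complex R (fnorm (eA E)))) ->
  det [:: QueryNorm a x] s tb Q.
Proof.
by move=> hc hQ; apply: det_atomic hQ => //; apply: frame_cset; rewrite inE.
Qed.

Section Sequences.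
Variables (W : finType) (w : W -> R) (Q : W -> state R -> Prop).

Lemma seq_nset a x e c s tb2 tb :
  rnd E [:: c] (nset s a (neval s x) (neval s e)) w tb2 Q ->
  ((ncost x + ncost e).+1 + tb2 < tb)%N ->
  rnd E [:: Seq (NSet a x e) c] s w tb Q.
Proof.
move=> h1 h2; apply: (rnd_seq_det (tb1 := (ncost x + ncost e).+1%N)
  (Q1 := eq (nset s a (neval s x) (neval s e)))).
- exact: det_nset.
- by move=> s1 _ <-; exact: h1.
- exact: h2.
Qed.

Lemma seq_cset a x e c s tb2 tb :
  rnd E [:: c] (cset s a (neval s x) (ceval s e)) w tb2 Q ->
  ((ncost x + ccost e).+1 + tb2 < tb)%N ->
  rnd E [:: Seq (CSet a x e) c] s w tb Q.
Proof.
move=> h1 h2; apply: (rnd_seq_det (tb1 := (ncost x + ccost e).+1%N)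
  (Q1 := eq (cset s a (neval s x) (ceval s e)))).
- exact: det_cset.
- by move=> s1 _ <-; exact: h1.
- exact: h2.
Qed.

Lemma seq_queryA a x e1 e2 (i : 'I_(em E)) (j : 'I_(en E)) c s tb2 tb :
  neval s e1 = i -> neval s e2 = j ->
  rnd E [:: c] (cset s a (neval s x) (eA E i j)) w tb2 Q ->
  ((ncost x + ncost e1 + ncost e2 + etau E).+1 + tb2 < tb)%N ->
  rnd E [:: Seq (QueryA a x e1 e2) c] s w tb Q.
Proof.
move=> hi hj h1 h2.
apply: (rnd_seq_det (tb1 := (ncost x + ncost e1 + ncost e2 + etau E).+1%N)
  (Q1 := eq (cset s a (neval s x) (eA E i j)))).
- exact: (det_queryA hi hj).
- by move=> s1 _ <-; exact: h1.
- exact: h2.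
Qed.

Lemma seq_queryB a x e (i : 'I_(em E)) c s tb2 tb :
  neval s e = i ->
  rnd E [:: c] (cset s a (neval s x) (eb E i 0)) w tb2 Q ->
  ((ncost x + ncost e + etau E).+1 + tb2 < tb)%N ->
  rnd E [:: Seq (QueryB a x e) c] s w tb Q.
Proof.
move=> hi h1 h2; apply: (rnd_seq_det (tb1 := (ncost x + ncost e + etau E).+1%N)
  (Q1 := eq (cset s a (neval s x) (eb E i 0)))).
- exact: (det_queryB hi).
- by move=> s1 _ <-; exact: h1.
- exact: h2.
Qed.

Lemma seq_queryNorm a x c s tb2 tb :
  rnd E [:: c] (cset s a (neval s x) (real_complex R (fnorm (eA E)))) w tb2 Q ->
  ((ncost x + etau E).+1 + tb2 < tb)%N ->
  rnd E [:: Seq (QueryNorm a x) c] s w tb Q.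
Proof.
move=> h1 h2.
apply: (rnd_seq_det (tb1 := (ncost x + etau E).+1%N)
  (Q1 := eq (cset s a (neval s x)
  (real_complex R (fnorm (eA E)))))).
- exact: det_queryNorm.
- by move=> s1 _ <-; exact: h1.
- exact: h2.
Qed.

End Sequences.

Lemma det_if e c1 c2 s tb tb' (Q : state R -> Prop) :
  ((bcost e).+1 + tb <= tb')%N ->
  (beval s e -> det [:: c1] s tb Q) -> (~~ beval s e -> det [:: c2] s tb Q) ->
  det [:: If e c1 c2] s tb' Q.
Proof.
move=> hc h1 h2; apply: (@rnd_control _ _ _ _ tb) => //=.
by case: ifPn => he; [apply: h1|apply: h2].
Qed.

Lemma det_skip s tb (Q : state R -> Prop) :
  (0 < tb)%N -> Q s -> det [:: Skip] s tb Q.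
Proof. by move=> hc hQ; apply: (@det_atomic _ _ s). Qed.

Lemma det_svd p q a u v s tb (Q : state R -> Prop) :
  (cost E s (Svd p q a u v) <= tb)%N ->
  Q (svd_store (esvd E) s (neval s p) (neval s q) a u v) ->
  det [:: Svd p q a u v] s tb Q.
Proof.
move=> hc hQ; apply: det_atomic hQ => //; split=> // a' x' /=.
rewrite !inE negb_or => /andP[h1 h2].
by rewrite (negbTE h1) (negbTE h2).
Qed.

Lemma rnd_sampleRow a x s tb (Q : 'I_(em E) -> state R -> Prop) :
  \sum_i fnorm (row i (eA E)) ^+ 2 / fnorm (eA E) ^+ 2 = 1 ->
  ((ncost x + etau E).+1 <= tb)%N ->
  (forall i, fnorm (row i (eA E)) ^+ 2 / fnorm (eA E) ^+ 2 != 0 ->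
     Q i (nset s a (neval s x) i)) ->
  rnd E [:: SampleRow a x] s
    (fun i => fnorm (row i (eA E)) ^+ 2 / fnorm (eA E) ^+ 2) tb Q.
Proof.
move=> h1 hc hQ.
apply: (@rnd_atomic _ _ _ _ (fun i : 'I_(em E) => nset s a (neval s x) i)) => //.
  by move=> i; apply: divr_ge0; apply: sqr_ge0.
by move=> i /hQ; split=> //; apply: frame_nset; rewrite inE.
Qed.

Lemma rnd_sampleCol a x e (i : 'I_(em E)) s tb
    (Q : 'I_(en E) -> state R -> Prop) :
  neval s e = i ->
  \sum_j normc (eA E i j) ^+ 2 / fnorm (row i (eA E)) ^+ 2 = 1 ->
  ((ncost x + ncost e + etau E).+1 <= tb)%N ->
  (forall j, normc (eA E i j) ^+ 2 / fnorm (row i (eA E)) ^+ 2 != 0 ->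
     Q j (nset s a (neval s x) j)) ->
  rnd E [:: SampleCol a x e] s
    (fun j => normc (eA E i j) ^+ 2 / fnorm (row i (eA E)) ^+ 2) tb Q.
Proof.
move=> hi h1 hc hQ.
apply: (@rnd_atomic _ _ _ _ (fun j : 'I_(en E) => nset s a (neval s x) j)) => //.
- by rewrite /= hi valK.
- by move=> j; apply: divr_ge0; apply: sqr_ge0.
- by move=> j /hQ; split=> //; apply: frame_nset; rewrite inE.
Qed.

Lemma rnd_unif a x e n s tb (Q : 'I_n -> state R -> Prop) :
  neval s e = n -> (0 < n)%N ->
  ((ncost x + ncost e).+1 <= tb)%N ->
  (forall v : 'I_n, Q v (nset s a (neval s x) v)) ->
  rnd E [:: Unif a x e] s (fun _ : 'I_n => n%:R^-1) tb Q.
Proof.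
move=> hn n0 hc hQ.
apply: (@rnd_atomic _ _ _ _ (fun v : 'I_n => nset s a (neval s x) v)) => //=.
- by rewrite hn -val_enum_ord -map_comp; apply: eq_map.
- by move=> _; rewrite invr_ge0 ler0n.
- rewrite sumr_const card_ord -(mulr_natl (n%:R^-1 : R)) divff //.
  by rewrite pnatr_eq0 -lt0n.
- by move=> v _; split=> //; apply: frame_nset; rewrite inE.
Qed.

Lemma rnd_flip a x e s tb p (Q : bool -> state R -> Prop) :
  complex.Re (ceval s e) = p -> 0 <= p <= 1 ->
  ((ncost x + ccost e).+1 <= tb)%N ->
  (forall b : bool, Q b (nset s a (neval s x) b)) ->
  rnd E [:: Flip a x e] s (fun b : bool => if b then p else 1 - p) tb Q.
Proof.
move=> hp /andP[p0 p1] hc hQ.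
apply: (@rnd_atomic _ _ _ _ (fun b : bool => nset s a (neval s x) b)) => //=.
- by rewrite hp min_r // max_r // enumT unlock.
- by case=> //; rewrite subr_ge0.
- by rewrite big_bool /= addrC subrK.
- by move=> v _; split=> //; apply: frame_nset; rewrite inE.
Qed.

End Rules.

Definition For (a : nat) (e : nexp) (c : cmd) : cmd :=
  Seq (NSet a (NLit 0) (NLit 0))
    (While (BNLt (NGet a (NLit 0)) e)
       (Seq c (NSet a (NLit 0) (NAdd (NGet a (NLit 0)) (NLit 1))))).

Section ForRules.
Variables (R : realType) (E : env R).

(** The postcondition of the body is stated for the state after the counter has been incremented,
    and [e] must keep its value because the test evaluates it anew in each round. *)
Lemma rnd_for a e c (W : finType) (w : W -> R) tb tb' n
    (Inv : seq W -> state R -> Prop) s :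
  (forall x, 0 <= w x) -> \sum_x w x = 1 ->
  a \notin nwrites c ->
  (forall s', frame [:: For a e c] s s' -> neval s' e = n) ->
  Inv [::] (nset s a 0 0) ->
  (forall h s', (size h < n)%N -> frame [:: For a e c] s s' ->
     nmem s' a 0 = size h -> Inv h s' ->
     rnd E [:: c] s' w tb
       (fun x s'' => Inv (rcons h x) (nset s'' a 0 (size h).+1))) ->
  (n * (tb + 11 + ncost e) + ncost e + 8 <= tb')%N ->
  rnd E [:: For a e c] s (@iid _ _ w n) tb' (fun g s' => Inv g s').
Proof.
move=> hw hw1 ha he hinit hstep htb.
set body := Seq c (NSet a (NLit 0) (NAdd (NGet a (NLit 0)) (NLit 1))).
have hfr s' : frame [:: body] (nset s a 0 0) s' -> frame [:: For a e c] s s'.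
  move=> hf; apply: (@frame_trans _ _ _ (nset s a 0 0)).
    by apply: frame_nset; rewrite inE eqxx.
  by apply: frame_sub hf => b; rewrite /= !cats0 ?inE => ->; rewrite ?orbT.
apply: (@rnd_seq_det _ _ _ _ _ _ _ 3
         (n * ((tb + 7) + (ncost e + 3).+1) + (ncost e + 3).+1) _
         (fun s' => s' = nset s a 0 0)).
- exact: det_nset.
- move=> s1 _ ->.
  pose Inv' h s' := nmem s' a 0 = size h /\ Inv h s'.
  suff H : rnd E [:: While (BNLt (NGet a (NLit 0)) e) body] (nset s a 0 0)
      (@iid _ _ w n) (n * (tb + 7 + (ncost e + 3).+1) + (ncost e + 3).+1)
      (fun g s' => Inv' g s').
    by apply: (rnd_conseq H) => // o s' _ _ [].
  rewrite (_ : (ncost e + 3)%N = bcost (BNLt (NGet a (NLit 0)) e)); last first.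
    by rewrite /=; lia.
  apply: rnd_while => //.
  + move=> h s' hh hf [hi1 hi2]; split.
      by rewrite /= hi1 he //; apply: hfr.
    apply: (@det_seq_rnd _ _ _ _ _ _ _ tb 6 _
      (fun x s'' => Inv (rcons h x) (nset s'' a 0 (size h).+1))).
    * by apply: hstep => //; apply: hfr.
    * move=> x s2 wx hf2 hi3; apply: det_nset => //=.
      have -> : nmem s2 a 0 = size h.
        by rewrite hf2.1 ?hi1 //= cats0.
      by split; rewrite ?addn1 // /= !eqxx size_rcons.
    * lia.
  + by move=> h s' hh hf [hi1 hi2]; rewrite /= hi1 he ?hh ?ltnn //; apply: hfr.
  + by split=> //=; rewrite !eqxx.
- by move: htb; lia.
Qed.

Lemma det_for a e c tb tb' n (Inv : nat -> state R -> Prop) s :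
  a \notin nwrites c ->
  (forall s', frame [:: For a e c] s s' -> neval s' e = n) ->
  Inv 0%N (nset s a 0 0) ->
  (forall (k : 'I_n) s', frame [:: For a e c] s s' ->
     nmem s' a 0 = k -> Inv k s' ->
     det E [:: c] s' tb (fun s'' => Inv k.+1 (nset s'' a 0 k.+1))) ->
  (n * (tb + 11 + ncost e) + ncost e + 8 <= tb')%N ->
  det E [:: For a e c] s tb' (Inv n).
Proof.
move=> ha he hinit hstep htb.
apply: (@rnd_bij _ _ _ _ _ _ (fun _ => nseq_tuple n tt) (@iid _ _ (fun _ : unit => 1) n)
  _ _ (fun g => Inv (size g))).
- exists (fun=> tt); first by case.
  move=> g; apply: val_inj => /=; rewrite -[in LHS](size_tuple g).
  by elim: (val g) => //= -[] t ->.
- by move=> o; rewrite /iid big1.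
- by move=> _ s'; rewrite size_tuple.
- apply: (@rnd_for _ _ _ _ _ tb tb' n (fun h => Inv (size h))) => //.
    by rewrite sum_unit.
  move=> h s' h1 h2 h3 h4; apply: (rnd_conseq (hstep (Ordinal h1) _ h2 h3 h4)) => //.
  by move=> x s2 _ _; rewrite size_rcons.
Qed.

End ForRules.

(** Since all runs halt within a common number of steps, the sequence that defines [prob] is
    eventually constant. *)
Lemma prob_rnd (R : realType) (E : env R) P s (W : finType) (w : W -> R) tb Q :
  rnd E [:: P] s w tb Q ->
  exists (te : W -> nat) (ss : W -> state R),
    (forall o, w o != 0 -> (te o <= tb)%N /\ Q o (ss o)) /\
    forall ev : nat -> state R -> Prop,
      prob E P s ev = \sum_o w o * `[< ev (te o) (ss o) >]%:R.
Proof.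
move=> [n0 [st [te [ss [_ _ h3 h4 _]]]]].
exists te, ss; split=> [o /h3[]//|ev].
rewrite /prob; apply: lim_near_cst => //.
exists n0 => // N /= hN.
rewrite -[[:: P]]/([:: P] ++ [::]) h4 //.
apply: eq_bigr => o _; rewrite add0n.
by case: (N - st o)%N.
Qed.

(** * Linear algebra *)

Section Complex.
Variable R : realType.
Local Notation C := R[i].
Local Notation "x %:C" := (real_complex R x) : ring_scope.
Implicit Types (x y : R) (z u : C).

Lemma ReD z u : complex.Re (z + u) = complex.Re z + complex.Re u.
Proof. by case: z => ? ?; case: u. Qed.

Lemma ReN z : complex.Re (- z) = - complex.Re z.
Proof. by case: z. Qed.

Lemma ReZ x z : complex.Re (x%:C * z) = x * complex.Re z.
Proof. by case: z => a b; rewrite /= mul0r subr0. Qed.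

Lemma Re_sum (I : Type) (r : seq I) (P : pred I) (F : I -> C) :
  complex.Re (\sum_(i <- r | P i) F i) = \sum_(i <- r | P i) complex.Re (F i).
Proof. by elim/big_rec2: _ => //= i x y _ <-; rewrite ReD. Qed.

Lemma conjCE z : Num.conj z = conjc z.
Proof. by []. Qed.

Lemma Re_conj z : complex.Re (Num.conj z) = complex.Re z.
Proof. by case: z. Qed.

Lemma conj_real x : Num.conj (x%:C) = x%:C.
Proof. by rewrite conjCE conjc_real. Qed.

Lemma normc_sqE z : normc z ^+ 2 = complex.Re z ^+ 2 + complex.Im z ^+ 2.
Proof. by case: z => a b /=; rewrite sqr_sqrtr // addr_ge0 // sqr_ge0. Qed.

Lemma normc_sq_Re z : normc z ^+ 2 = complex.Re (Num.conj z * z).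
Proof. by rewrite normc_sqE; case: z => a b /=; ring. Qed.

Lemma conj_mul_normc z : Num.conj z * z = (normc z ^+ 2)%:C.
Proof.
rewrite normc_sqE conjCE; case: z => a b; apply/eqP; rewrite eq_complex /=.
by apply/andP; split; apply/eqP; ring.
Qed.

Lemma normc_ge0 z : 0 <= normc z.
Proof. by case: z => a b /=; apply: sqrtr_ge0. Qed.

Lemma normc_real x : normc (x%:C) = `|x|.
Proof. by rewrite /= expr0n addr0 sqrtr_sqr. Qed.

End Complex.

Notation "x %:C" := (real_complex _ x) : ring_scope.

(** * The Frobenius norm and its real inner product *)

Section Frobenius.
Variable R : realType.
Local Notation C := R[i].

(** The real part of the Frobenius inner product makes matrices a real Hilbert space, the setting of
    Cauchy-Schwarz and of the concentration bound. *)
Definition rdot m n (X Y : 'M[C]_(m, n)) : R := complex.Re (\tr (X ^t* *m Y)).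

Lemma rdotE m n (X Y : 'M[C]_(m, n)) :
  rdot X Y = \sum_i \sum_j complex.Re (Num.conj (X i j) * Y i j).
Proof.
rewrite /rdot /mxtrace Re_sum exchange_big /=; apply: eq_bigr => j _.
by rewrite mxE Re_sum; apply: eq_bigr => i _; rewrite !mxE.
Qed.

Lemma fnorm_ge0 m n (X : 'M[C]_(m, n)) : 0 <= fnorm X.
Proof. exact: sqrtr_ge0. Qed.

Lemma fnorm_sqE m n (X : 'M[C]_(m, n)) :
  fnorm X ^+ 2 = \sum_i \sum_j normc (X i j) ^+ 2.
Proof.
rewrite sqr_sqrtr // sumr_ge0 // => i _; apply: sumr_ge0 => j _.
exact: sqr_ge0.
Qed.

Lemma fnorm_sq m n (X : 'M[C]_(m, n)) : fnorm X ^+ 2 = rdot X X.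
Proof.
rewrite fnorm_sqE rdotE; apply: eq_bigr => i _; apply: eq_bigr => j _.
exact: normc_sq_Re.
Qed.

Lemma rdotDr m n (X Y Z : 'M[C]_(m, n)) : rdot X (Y + Z) = rdot X Y + rdot X Z.
Proof. by rewrite /rdot mulmxDr mxtraceD ReD. Qed.

Lemma rdotNr m n (X Y : 'M[C]_(m, n)) : rdot X (- Y) = - rdot X Y.
Proof. by rewrite /rdot mulmxN raddfN ReN. Qed.

Lemma rdotZr m n (X Y : 'M[C]_(m, n)) (a : R) :
  rdot X (a%:C *: Y) = a * rdot X Y.
Proof. by rewrite /rdot -scalemxAr mxtraceZ ReZ. Qed.

Lemma rdotC m n (X Y : 'M[C]_(m, n)) : rdot X Y = rdot Y X.
Proof.
rewrite !rdotE; apply: eq_bigr => i _; apply: eq_bigr => j _.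
by rewrite -Re_conj rmorphM /= conjCK mulrC.
Qed.

Lemma rdotDl m n (X Y Z : 'M[C]_(m, n)) : rdot (X + Y) Z = rdot X Z + rdot Y Z.
Proof. by rewrite rdotC rdotDr !(rdotC Z). Qed.

Lemma rdotNl m n (X Y : 'M[C]_(m, n)) : rdot (- X) Y = - rdot X Y.
Proof. by rewrite rdotC rdotNr rdotC. Qed.

Lemma rdotZl m n (X Y : 'M[C]_(m, n)) (a : R) :
  rdot (a%:C *: X) Y = a * rdot X Y.
Proof. by rewrite rdotC rdotZr rdotC. Qed.

Lemma rdot0r m n (X : 'M[C]_(m, n)) : rdot X 0 = 0.
Proof. by rewrite /rdot mulmx0 raddf0. Qed.

Lemma rdot_sumr m n (I : Type) (r : seq I) (P : pred I) (X : 'M[C]_(m, n)) F :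
  rdot X (\sum_(i <- r | P i) F i) = \sum_(i <- r | P i) rdot X (F i).
Proof.
by elim/big_rec2: _ => [|i y z _ <-]; rewrite ?rdot0r ?rdotDr.
Qed.

Lemma adjM m n p (A : 'M[C]_(m, n)) (B : 'M[C]_(n, p)) :
  (A *m B) ^t* = B ^t* *m A ^t*.
Proof. by rewrite trmx_mul map_mxM. Qed.

Lemma adjK m n (A : 'M[C]_(m, n)) : A ^t* ^t* = A.
Proof. exact: trmxCK. Qed.

Lemma rdot_adj m n p (A : 'M[C]_(m, n)) (X : 'M[C]_(n, p)) (Y : 'M[C]_(m, p)) :
  rdot (A *m X) Y = rdot X (A ^t* *m Y).
Proof. by rewrite /rdot adjM mulmxA. Qed.

Lemma rdot_adj_adj m n (X Y : 'M[C]_(m, n)) : rdot (X ^t*) (Y ^t*) = rdot X Y.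
Proof.
rewrite !rdotE exchange_big /=; apply: eq_bigr => i _; apply: eq_bigr => j _.
by rewrite !mxE -Re_conj rmorphM /= !conjCK.
Qed.

Lemma fnorm_adj m n (X : 'M[C]_(m, n)) : fnorm (X ^t*) = fnorm X.
Proof.
apply: (@pexpIrn _ 2) => //; rewrite ?nnegrE ?fnorm_ge0 //.
by rewrite !fnorm_sq rdot_adj_adj.
Qed.

Lemma fnorm_sqD m n (X Y : 'M[C]_(m, n)) :
  fnorm (X + Y) ^+ 2 = fnorm X ^+ 2 + 2 * rdot X Y + fnorm Y ^+ 2.
Proof. by rewrite !fnorm_sq rdotDl !rdotDr (rdotC Y X); ring. Qed.

Lemma fnormN m n (X : 'M[C]_(m, n)) : fnorm (- X) = fnorm X.
Proof.
apply: (@pexpIrn _ 2) => //; rewrite ?nnegrE ?fnorm_ge0 //.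
by rewrite !fnorm_sq rdotNl rdotNr opprK.
Qed.

Lemma fnorm_sqZ m n (a : C) (X : 'M[C]_(m, n)) :
  fnorm (a *: X) ^+ 2 = normc a ^+ 2 * fnorm X ^+ 2.
Proof.
rewrite !fnorm_sqE mulr_sumr; apply: eq_bigr => i _.
rewrite mulr_sumr; apply: eq_bigr => j _.
by rewrite mxE ComplexField.Normc.normcM exprMn.
Qed.

Lemma fnormZ m n (a : C) (X : 'M[C]_(m, n)) :
  fnorm (a *: X) = normc a * fnorm X.
Proof.
apply: (@pexpIrn _ 2) => //; rewrite ?nnegrE ?mulr_ge0 ?fnorm_ge0 ?normc_ge0 //.
by rewrite fnorm_sqZ exprMn.
Qed.

Lemma fnorm0 m n : fnorm (0 : 'M[C]_(m, n)) = 0.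
Proof.
by apply/eqP; rewrite -[_ == 0](@sqrf_eq0 R) fnorm_sq rdot0r.
Qed.

Lemma fnorm_entry m n (X : 'M[C]_(m, n)) i j : normc (X i j) <= fnorm X.
Proof.
rewrite -(@ler_pXn2r _ 2) ?nnegrE ?fnorm_ge0 ?normc_ge0 // fnorm_sqE.
rewrite (bigD1 i) //= (bigD1 j) //= -addrA lerDl.
apply: addr_ge0; apply: sumr_ge0 => *; first exact: sqr_ge0.
by apply: sumr_ge0 => *; apply: sqr_ge0.
Qed.

Lemma fnorm_eq0 m n (X : 'M[C]_(m, n)) : (fnorm X == 0) = (X == 0).
Proof.
apply/eqP/eqP => [h|->]; last exact: fnorm0.
apply/matrixP => i j; rewrite mxE.
apply: ComplexField.Normc.eq0_normc; apply/eqP.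
by rewrite eq_le normc_ge0 -h fnorm_entry.
Qed.

Lemma fnorm_gt0 m n (X : 'M[C]_(m, n)) : (0 < fnorm X) = (X != 0).
Proof. by rewrite lt_def fnorm_ge0 andbT fnorm_eq0. Qed.

(** Expand the squared norm of |Y| X - |X| Y, which is nonnegative. *)
Lemma rdot_le m n (X Y : 'M[C]_(m, n)) : rdot X Y <= fnorm X * fnorm Y.
Proof.
have [->|Y0] := eqVneq Y 0; first by rewrite rdot0r fnorm0 mulr0.
have [->|X0] := eqVneq X 0; first by rewrite rdotC rdot0r fnorm0 mul0r.
have x0 : 0 < fnorm X by rewrite fnorm_gt0.
have y0 : 0 < fnorm Y by rewrite fnorm_gt0.
have := sqr_ge0 (fnorm ((fnorm Y)%:C *: X - (fnorm X)%:C *: Y)).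
rewrite fnorm_sqD fnormN !fnorm_sqZ rdotNr rdotZl rdotZr !normc_real.
rewrite !ger0_norm ?fnorm_ge0 // => h.
have p : 0 < 2 * (fnorm X * fnorm Y) by rewrite !mulr_gt0.
by rewrite -(ler_pM2l p); nra.
Qed.

Lemma ler_rdot m n (X Y : 'M[C]_(m, n)) : `|rdot X Y| <= fnorm X * fnorm Y.
Proof.
by rewrite ler_norml rdot_le andbT lerNl -rdotNl -(fnormN X) rdot_le.
Qed.

Lemma fnormD m n (X Y : 'M[C]_(m, n)) : fnorm (X + Y) <= fnorm X + fnorm Y.
Proof.
rewrite -(@ler_pXn2r _ 2) ?nnegrE ?addr_ge0 ?fnorm_ge0 // fnorm_sqD.
have := rdot_le X Y; nra.
Qed.

Lemma fnorm_sq_rows m n (X : 'M[C]_(m, n)) :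
  fnorm X ^+ 2 = \sum_i fnorm (row i X) ^+ 2.
Proof.
rewrite fnorm_sqE; apply: eq_bigr => i _.
by rewrite fnorm_sqE big_ord1; apply: eq_bigr => j _; rewrite mxE.
Qed.

Lemma fnorm_sq_cols m n (X : 'M[C]_(m, n)) :
  fnorm X ^+ 2 = \sum_j fnorm (col j X) ^+ 2.
Proof.
rewrite fnorm_sqE exchange_big; apply: eq_bigr => j _.
by rewrite fnorm_sqE; apply: eq_bigr => i _; rewrite big_ord1 mxE.
Qed.

Lemma entry_mul_le n (X : 'rV[C]_n) (Y : 'cV[C]_n) :
  normc ((X *m Y) 0 0) <= fnorm X * fnorm Y.
Proof.
set z := (X *m Y) 0 0.
have [->|z0] := eqVneq z 0.
  by rewrite (normc_real 0) normr0 mulr_ge0 ?fnorm_ge0.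
have p : 0 < normc z.
  rewrite lt_def normc_ge0 andbT; apply: contra z0 => /eqP h.
  by apply/eqP/ComplexField.Normc.eq0_normc.
have h : normc z ^+ 2 = rdot (z *: X ^t*) Y.
  rewrite normc_sq_Re /rdot linearZ /= map_mxZ /= -scalemxAl mxtraceZ adjK.
  by rewrite trace_mx11.
have := rdot_le (z *: X ^t*) Y.
by rewrite -h fnormZ fnorm_adj expr2 -mulrA ler_pM2l.
Qed.

Lemma fnormM m n p (A : 'M[C]_(m, n)) (B : 'M[C]_(n, p)) :
  fnorm (A *m B) <= fnorm A * fnorm B.
Proof.
rewrite -(@ler_pXn2r _ 2) ?nnegrE ?mulr_ge0 ?fnorm_ge0 // exprMn.
rewrite (fnorm_sq_rows A) (fnorm_sq_cols B) fnorm_sqE mulr_suml.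
apply: ler_sum => i _; rewrite mulr_sumr; apply: ler_sum => j _.
rewrite -exprMn ler_pXn2r ?nnegrE ?mulr_ge0 ?fnorm_ge0 ?normc_ge0 //.
apply: le_trans (entry_mul_le _ _).
have -> // : (row i A *m col j B) 0 0 = (A *m B) i j.
by rewrite !mxE; apply: eq_bigr => l _; rewrite !mxE.
Qed.

Lemma fnorm_isoL m n p (U : 'M[C]_(m, n)) (X : 'M[C]_(n, p)) :
  U ^t* *m U = 1%:M -> fnorm (U *m X) = fnorm X.
Proof.
move=> hU; apply: (@pexpIrn _ 2) => //; rewrite ?nnegrE ?fnorm_ge0 //.
by rewrite !fnorm_sq rdot_adj mulmxA hU mul1mx.
Qed.

(** |U^* X|^2 is the inner product of U U^* X with X, and U U^* X has the same norm as U^* X. *)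
Lemma fnorm_coisoL m n p (U : 'M[C]_(m, n)) (X : 'M[C]_(m, p)) :
  U ^t* *m U = 1%:M -> fnorm (U ^t* *m X) <= fnorm X.
Proof.
move=> hU; have [h|h] := eqVneq (fnorm (U ^t* *m X)) 0.
  by rewrite h fnorm_ge0.
have p0 : 0 < fnorm (U ^t* *m X) by rewrite lt_def h fnorm_ge0.
rewrite -(ler_pM2l p0) -expr2 fnorm_sq -rdot_adj.
by rewrite -[X in _ <= X * _](fnorm_isoL _ hU) rdot_le.
Qed.

Lemma opnorm_le m n (A : 'M[C]_(m, n)) (v : 'cV[C]_n) :
  fnorm (A *m v) <= opnorm A * fnorm v.
Proof.
have [->|v0] := eqVneq v 0; first by rewrite mulmx0 !fnorm0 mulr0.
have p0 : 0 < fnorm v by rewrite fnorm_gt0.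
rewrite -ler_pdivrMr //.
apply: ub_le_sup.
  exists (fnorm A) => _ [u /= hu <-]; apply: (le_trans (fnormM _ _)).
  by rewrite ler_piMr ?fnorm_ge0.
exists ((fnorm v)^-1%:C *: v) => /=.
  by rewrite fnormZ normc_real gtr0_norm ?invr_gt0 // mulVf ?gt_eqF.
by rewrite -scalemxAr fnormZ normc_real gtr0_norm ?invr_gt0 // mulrC.
Qed.

Lemma opnorm_adj_le m n (A : 'M[C]_(m, n)) (v : 'cV[C]_m) (a : R) :
  0 <= a -> opnorm A <= a -> fnorm (A ^t* *m v) <= a * fnorm v.
Proof.
move=> a0 ha; set u := A ^t* *m v.
have [h|h] := eqVneq (fnorm u) 0; first by rewrite h mulr_ge0 ?fnorm_ge0.
have p0 : 0 < fnorm u by rewrite lt_def h fnorm_ge0.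
rewrite -(ler_pM2l p0) -expr2 fnorm_sq {2}/u -rdot_adj.
apply: (le_trans (rdot_le _ _)); rewrite mulrA ler_wpM2r ?fnorm_ge0 //.
apply: (le_trans (opnorm_le _ _)).
by rewrite mulrC ler_wpM2l ?fnorm_ge0.
Qed.

End Frobenius.

(** * Consequences of a bound on the pseudoinverse *)

Section PseudoInverse.
Variable R : realType.
Local Notation C := R[i].
Variables (m n : nat) (A : 'M[C]_(m, n)) (Ap : 'M[C]_(n, m)) (kappa : R).
Hypotheses (hAp : is_pseudoinverse A Ap) (hkappa : 0 < kappa)
  (hApk : opnorm Ap <= kappa).

Lemma fnorm_le_pinv (z : 'cV[C]_n) :
  Ap *m A *m z = z -> fnorm z <= kappa * fnorm (A *m z).
Proof.
move=> hz; rewrite -{1}hz -mulmxA; apply: (le_trans (opnorm_le _ _)).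
by rewrite ler_wpM2r ?fnorm_ge0.
Qed.

Lemma pinv_adj : Ap *m A *m A ^t* = A ^t*.
Proof.
case: hAp => h1 h2 h3 h4.
by rewrite -{1}h4 -adjM mulmxA h1.
Qed.

(** With p the projection of b, A A^+ p = p and A^* p = A^* b; since A A^+ is Hermitian, p is the
    image of A^* b under the adjoint of A^+. This turns the assumption on the projection into a
    lower bound for |A^* b|. *)
Lemma colspace_proj_le (b : 'cV[C]_m) :
  fnorm (colspace_proj A b) <= kappa * fnorm (A ^t* *m b).
Proof.
case: hAp => h1 h2 h3 h4.
set p := colspace_proj A b.
have hp : A *m Ap *m p = p.
  have : (b^T *m proj_ortho A^T <= A^T)%MS by apply: proj_ortho_sub.
  case/submxP => D hD.
  by rewrite /p /colspace_proj hD trmx_mul trmxK mulmxA h1.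
have hq : A ^t* *m p = A ^t* *m b.
  have /orthomx1P := proj_ortho_compl_sub A^T b^T.
  rewrite mulmxBl => /eqP; rewrite subr_eq0 => /eqP h.
  apply: trmx_inj; rewrite !trmx_mul /p /colspace_proj trmxK.
  have -> : (A ^t*)^T = A^T ^t* by apply/matrixP => i j; rewrite !mxE.
  by rewrite h.
rewrite -hp -h3 adjM -mulmxA hq.
exact: opnorm_adj_le (ltW hkappa) hApk.
Qed.

Hypotheses (hA0 : A != 0) (hA1 : opnorm A <= 1).

(** Any nonzero column of A^* will do. It is the test vector for the bounds 1 <= [kappa] and 1 <=
    [kappa * fnorm A]. *)
Lemma exists_rowspace_vector : exists z : 'cV[C]_n, z != 0 /\ Ap *m A *m z = z.
Proof.
have [j hj] : exists j, A ^t* *m delta_mx j 0 != 0 :> 'cV[C]_n.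
  apply/existsP; apply: contraNT hA0 => /existsPn h.
  rewrite -[A]adjK (_ : A ^t* = 0) ?trmx0 ?map_mx0 //.
  apply/matrixP => i j; have /negPn/eqP := h j.
  by rewrite -colE => /matrixP/(_ i 0); rewrite !mxE.
exists (A ^t* *m delta_mx j 0); split=> //.
by rewrite mulmxA pinv_adj.
Qed.

Lemma kappa_ge1 : 1 <= kappa.
Proof.
have [z [z0 hz]] := exists_rowspace_vector.
have p0 : 0 < fnorm z by rewrite fnorm_gt0.
have h := fnorm_le_pinv hz.
have h2 := opnorm_le A z.
have h3 : fnorm (A *m z) <= fnorm z.
  by apply: (le_trans h2); rewrite ler_piMl ?fnorm_ge0.
rewrite -(ler_pM2r p0) mul1r; apply: (le_trans h).
by rewrite ler_wpM2l // ltW.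
Qed.

Lemma kappa_fnorm_ge1 : 1 <= kappa * fnorm A.
Proof.
have [z [z0 hz]] := exists_rowspace_vector.
have p0 : 0 < fnorm z by rewrite fnorm_gt0.
have h := fnorm_le_pinv hz.
rewrite -(ler_pM2r p0) mul1r -mulrA; apply: (le_trans h).
by rewrite ler_wpM2l ?fnormM // ltW.
Qed.

End PseudoInverse.

(** * Thin singular value decompositions *)

Section ThinSvd.
Variable R : realType.
Local Notation C := R[i].
Variables (p q : nat) (M : 'M[C]_(p, q)).
Local Notation l := (minn p q).
Variables (U : 'M[C]_(p, l)) (sg : 'rV[R]_l).
Hypothesis hsvd : is_thin_svd M U sg.
Local Notation dg s := (diag_mx (map_mx (real_complex R) s)).

Lemma svd_iso : U ^t* *m U = 1%:M.
Proof. by case: hsvd => V []. Qed.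

Lemma svd_adj (u : 'cV[C]_p) :
  fnorm (M ^t* *m u) ^+ 2 = \sum_i sg 0 i ^+ 2 * normc ((U ^t* *m u) i 0) ^+ 2.
Proof.
case: hsvd => V [_ hV -> h0 _].
rewrite !adjM adjK -!mulmxA (fnorm_isoL _ hV) fnorm_sqE.
apply: eq_bigr => i _; rewrite big_ord1.
rewrite tr_diag_mx map_diag_mx mul_diag_mx mxE ComplexField.Normc.normcM exprMn.
congr (_ * _); rewrite -[sg 0 i ^+ 2]real_normK ?num_real // -normc_real.
by congr (normc _ ^+ 2); rewrite !mxE; apply: conj_real.
Qed.

Lemma fnorm_delta n (i : 'I_n) : fnorm (delta_mx i 0 : 'cV[C]_n) = 1.
Proof.
apply: (@pexpIrn _ 2) => //; rewrite ?nnegrE ?fnorm_ge0 // expr1n.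
rewrite fnorm_sqE (bigD1 i) //= big_ord1 big1 => [|j /negbTE hj].
  by rewrite !mxE !eqxx (normc_real 1) normr1 expr1n addr0.
by rewrite big_ord1 mxE hj (normc_real 0) normr0 expr0n.
Qed.

Lemma svd_mulV : exists V : 'M[C]_(q, l),
  V ^t* *m V = 1%:M /\ M *m V = U *m dg sg.
Proof.
case: hsvd => V [_ hV -> h0 _]; exists V; split=> //.
by rewrite -!mulmxA hV mulmx1.
Qed.

Lemma svd_fnorm : fnorm M ^+ 2 = \sum_i sg 0 i ^+ 2.
Proof.
case: hsvd => V [hU hV -> h0 _].
rewrite -fnorm_adj !adjM adjK (fnorm_isoL _ hV).
rewrite -fnorm_adj !adjM adjK (fnorm_isoL _ hU) adjK fnorm_sqE.
apply: eq_bigr => i _; rewrite (bigD1 i) //= big1 => [|j /negbTE hj].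
  by rewrite !mxE eqxx mulr1n normc_real real_normK ?num_real ?addr0.
by rewrite !mxE eq_sym hj mulr0n (normc_real 0) normr0 expr0n.
Qed.

(** M maps the i-th right singular vector, of norm 1, to [sg 0 i] times a unit vector. *)
Lemma svd_le_opnorm i : sg 0 i <= opnorm M.
Proof.
have [V [hV hMV]] := svd_mulV.
have h0 : 0 <= sg 0 i by case: hsvd => ? [].
have -> : sg 0 i = fnorm (M *m (V *m delta_mx i 0 : 'cV[C]_q)).
  rewrite mulmxA hMV -mulmxA (fnorm_isoL _ svd_iso).
  have -> : dg sg *m delta_mx i 0 = (sg 0 i)%:C *: delta_mx i 0 :> 'cV[C]_l.
    apply/matrixP => a c; rewrite mul_diag_mx !mxE.
    by have [->|] := eqVneq a i; rewrite //= !mulr0.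
  by rewrite fnormZ fnorm_delta mulr1 normc_real ger0_norm.
apply: (le_trans (opnorm_le _ _)).
by rewrite (fnorm_isoL _ hV) fnorm_delta mulr1.
Qed.

(** If [sg 0 i] were nonzero, the first i+1 columns of U, which are independent, would all lie in
    the image of M. *)
Lemma svd_rank (i : 'I_l) k : (\rank M <= k)%N -> (k <= i)%N -> sg 0 i = 0.
Proof.
move=> hr hki; apply/eqP/negPn/negP => hi.
have [_ [_ _ _ h0 hmono]] := hsvd.
have [V [hV hMV]] := svd_mulV.
pose f (a : 'I_i.+1) : 'I_l := widen_ord (ltn_ord i) a.
have hf a : sg 0 (f a) != 0.
  have h1 : sg 0 i <= sg 0 (f a) by apply: hmono; rewrite /= -ltnS.
  by rewrite gt_eqF // (lt_le_trans _ h1) // lt_def hi h0.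
pose X := colsub f V *m dg (\row_a (sg 0 (f a))^-1).
have hX : M *m X = colsub f U.
  rewrite /X mulmxA (mulmx_colsub f M V) hMV.
  apply/matrixP => a c; rewrite mul_mx_diag !mxE.
  rewrite (bigD1 (f c)) //= big1 => [|j /negbTE hj]; last first.
    by rewrite !mxE hj mulr0.
  by rewrite !mxE eqxx mulr1n addr0 -mulrA -rmorphM /= divff // mulr1.
have hU : (colsub f U) ^t* *m colsub f U = 1%:M.
  have := svd_iso => /matrixP h.
  apply/matrixP => a c; have := h (f a) (f c); rewrite !mxE => hh.
  transitivity (((f a == f c)%:R : C)); last first.
    by congr (_ %:R); rewrite -val_eqE.
  rewrite -hh.
  by apply: eq_bigr => j _; rewrite !mxE.
have h1 : (i.+1 <= \rank (colsub f U))%N.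
  by rewrite -[X in (X <= _)%N](mxrank1 C) -hU mxrankM_maxr.
have h2 : (\rank (colsub f U) <= \rank M)%N by rewrite -hX mxrankM_maxl.
by have := leq_trans h1 (leq_trans h2 hr); rewrite ltnNge hki.
Qed.

End ThinSvd.

(** * Lower bounds that survive the two sketches *)

Section Core.
Variable R : realType.
Local Notation C := R[i].

Lemma scaled_delta l (a : C) (i j : 'I_l) :
  (a *: delta_mx i 0 : 'cV[C]_l) j 0 = a * (j == i)%:R.
Proof. by rewrite !mxE eqxx andbT. Qed.

Lemma sum_ltn_le l k : \sum_(i < l) ((i < k)%N%:R : R) <= k%:R.
Proof.
have -> : \sum_(i < l) ((i < k)%N%:R : R) = (minn l k)%:R.
  elim: l => [|l IH]; first by rewrite big_ord0 min0n.
  rewrite big_ord_recr /= IH -natrD; congr (_ %:R).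
  by case: (ltnP l k) => h; lia.
by rewrite ler_nat geq_minr.
Qed.

(** The routine is applied to A itself: at most k singular values are nonzero, and none exceeds
    1. *)
Lemma fnorm_sq_le_rank m n (A : 'M[C]_(m, n)) k (svd : svd_routine R) :
  svd_correct svd -> (\rank A <= k)%N -> opnorm A <= 1 ->
  fnorm A ^+ 2 <= k%:R.
Proof.
move=> hsvd hk h1; have h := hsvd _ _ A; rewrite (svd_fnorm h).
apply: (le_trans _ (sum_ltn_le (minn m n) k)).
apply: ler_sum => i _; case: (ltnP i k) => hi; last first.
  by rewrite (svd_rank h hk hi) expr0n.
have [_ [_ _ _ h0 _]] := h.
by rewrite expr_le1 // (le_trans (svd_le_opnorm h i)).
Qed.

Variables (m n : nat) (A : 'M[C]_(m, n)) (Ap : 'M[C]_(n, m)) (kappa : R).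
Hypotheses (hAp : is_pseudoinverse A Ap) (hkappa : 0 < kappa)
  (hApk : opnorm Ap <= kappa).
Variables (r : nat) (RR : 'M[C]_(r, n)).
Hypothesis hRR : exists D, RR = D *m A.
Hypothesis hE1 : fnorm (A ^t* *m A - RR ^t* *m RR) <= (2 * kappa ^+ 2)^-1.

Lemma rowspace_RR : RR *m (Ap *m A) = RR.
Proof.
by case: hRR => D ->; case: hAp => h _ _ _; rewrite -mulmxA (mulmxA A) h.
Qed.

(** On the row space |z|^2 <= kappa^2 |A z|^2, and replacing A by R changes |A z|^2 by at most |z|^2
    / (2 kappa^2), so that half of |z|^2 remains. *)
Lemma sketch_lb (z : 'cV[C]_n) : Ap *m A *m z = z ->
  fnorm z ^+ 2 <= 2 * kappa ^+ 2 * fnorm (RR *m z) ^+ 2.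
Proof.
move=> hz.
have k2 : 0 < kappa ^+ 2 by apply: exprn_gt0.
have h1 : fnorm z ^+ 2 <= kappa ^+ 2 * fnorm (A *m z) ^+ 2.
  rewrite -exprMn ler_pXn2r ?nnegrE ?mulr_ge0 ?fnorm_ge0 ?(ltW hkappa) //.
  exact: fnorm_le_pinv hApk _ hz.
pose X := A ^t* *m A - RR ^t* *m RR; have hX : fnorm X <= _ := hE1.
have h2 : fnorm (A *m z) ^+ 2 - fnorm (RR *m z) ^+ 2 = rdot z (X *m z).
  by rewrite !fnorm_sq !rdot_adj !mulmxA /X mulmxBl rdotDr rdotNr.
have h3 : rdot z (X *m z) <= fnorm z ^+ 2 * (2 * kappa ^+ 2)^-1.
  apply: (le_trans (rdot_le _ _)); rewrite expr2 -mulrA ler_wpM2l ?fnorm_ge0 //.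
  by apply: (le_trans (fnormM _ _)); rewrite mulrC ler_wpM2l ?fnorm_ge0.
have h4 : kappa ^+ 2 * (fnorm z ^+ 2 * (2 * kappa ^+ 2)^-1) = fnorm z ^+ 2 / 2.
  by field; rewrite gt_eqF.
have h5 : kappa ^+ 2 * (fnorm (A *m z) ^+ 2 - fnorm (RR *m z) ^+ 2)
   <= fnorm z ^+ 2 / 2.
  by rewrite -h4 ler_pM2l // h2.
by move: h1 h5; rewrite mulrBr -mulrA; lra.
Qed.

(** The projection z of v on the row space has the same image u = R z. Then |u|^2 is the inner
    product of z with R^* u, at most |z| |R^* u|, and |z| is bounded by |u| through [sketch_lb]. *)
Lemma sketch_adj_lb (v : 'cV[C]_n) :
  fnorm (RR *m v) ^+ 2 <= 2 * kappa ^+ 2 * fnorm (RR ^t* *m (RR *m v)) ^+ 2.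
Proof.
have k2 : 0 < kappa ^+ 2 by apply: exprn_gt0.
pose z := Ap *m A *m v.
have hz : Ap *m A *m z = z.
  by case: hAp => _ h _ _; rewrite /z !mulmxA h.
have hu : RR *m v = RR *m z by rewrite /z mulmxA rowspace_RR.
rewrite hu; have := sketch_lb hz; set u := RR *m z => h1.
have [h0|h0] := eqVneq (fnorm u) 0.
  by rewrite h0 expr0n mulr_ge0 ?sqr_ge0 // mulr_ge0 // ltW.
have p0 : 0 < fnorm u ^+ 2 by rewrite exprn_gt0 // lt_def h0 fnorm_ge0.
have h2 : fnorm u ^+ 2 <= fnorm z * fnorm (RR ^t* *m u).
  by rewrite fnorm_sq {1}/u rdot_adj rdot_le.
have h3 : fnorm u ^+ 2 * fnorm u ^+ 2 <= fnorm z ^+ 2 * fnorm (RR ^t* *m u) ^+ 2.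
  by rewrite -expr2 -exprMn ler_pXn2r ?nnegrE ?mulr_ge0 ?fnorm_ge0 ?(ltW p0).
rewrite -(ler_pM2l p0); apply: (le_trans h3).
apply: (le_trans (ler_wpM2r (sqr_ge0 _) h1)).
by rewrite le_eqVlt; apply/orP; left; apply/eqP; ring.
Qed.

Variables (c : nat) (CC : 'M[C]_(r, c)).
Hypothesis hCC : exists D, CC = RR *m D.
Hypothesis hE2 : fnorm (RR *m RR ^t* - CC *m CC ^t*) <= (4 * kappa ^+ 2)^-1.

(** Passing from R to C changes |R^* u|^2 by at most |u|^2 / (4 kappa^2), which costs half of the
    bound of [sketch_adj_lb]. *)
Lemma col_sketch_lb (v : 'cV[C]_n) :
  fnorm (RR *m v) ^+ 2 <= 4 * kappa ^+ 2 * fnorm (CC ^t* *m (RR *m v)) ^+ 2.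
Proof.
have k2 : 0 < kappa ^+ 2 by apply: exprn_gt0.
have := sketch_adj_lb v; set u := RR *m v => h1.
pose X := RR *m RR ^t* - CC *m CC ^t*; have hX : fnorm X <= _ := hE2.
have h2 : fnorm (RR ^t* *m u) ^+ 2 - fnorm (CC ^t* *m u) ^+ 2 = rdot u (X *m u).
  by rewrite /X mulmxBl rdotDr rdotNr !fnorm_sq !rdot_adj !adjK !(mulmxA _ _ u).
have h3 : rdot u (X *m u) <= fnorm u ^+ 2 * (4 * kappa ^+ 2)^-1.
  apply: (le_trans (rdot_le _ _)); rewrite expr2 -mulrA ler_wpM2l ?fnorm_ge0 //.
  by apply: (le_trans (fnormM _ _)); rewrite mulrC ler_wpM2l ?fnorm_ge0.
have h4 : kappa ^+ 2 * (fnorm u ^+ 2 * (4 * kappa ^+ 2)^-1) = fnorm u ^+ 2 / 4.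
  by field; rewrite gt_eqF.
have h5 : kappa ^+ 2 * (fnorm (RR ^t* *m u) ^+ 2 - fnorm (CC ^t* *m u) ^+ 2)
   <= fnorm u ^+ 2 / 4.
  by rewrite -h4 ler_pM2l // h2.
by move: h1 h5; rewrite mulrBr -!mulrA; lra.
Qed.

Variables (U : 'M[C]_(r, minn r c)) (sg : 'rV[R]_(minn r c)).
Hypothesis hsvd : is_thin_svd CC U sg.
Variable k : nat.
Hypothesis hk : (\rank A <= k)%N.

Lemma sg_ge0 i : 0 <= sg 0 i.
Proof. by case: hsvd => ? []. Qed.

Lemma sg_small (i : 'I_(minn r c)) : (k <= i)%N -> sg 0 i = 0.
Proof.
apply: (svd_rank hsvd); apply: (leq_trans _ hk).
case: hCC => D ->; case: hRR => D' ->.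
by apply: (leq_trans (mxrankM_maxl _ _)); apply: mxrankM_maxr.
Qed.

Lemma col_in_RR i : sg 0 i != 0 -> exists v, col i U = RR *m v.
Proof.
move=> hi; have [V [hV hMV]] := svd_mulV hsvd.
case: hCC => D hD.
exists (D *m (V *m ((sg 0 i)^-1%:C *: delta_mx i 0))).
rewrite mulmxA -hD mulmxA hMV -mulmxA -scalemxAr colE; congr (U *m _).
apply/matrixP => a b; rewrite mxE mul_diag_mx !mxE.
have [->|] := eqVneq a i; last by rewrite /= !mulr0.
by rewrite /= mulrA -rmorphM /= mulVf // mul1r.
Qed.

Lemma sg_lb i : sg 0 i != 0 -> 1 <= 2 * kappa * sg 0 i.
Proof.
move=> hi; have [v hv] := col_in_RR hi.
have := col_sketch_lb v; rewrite -hv (svd_adj hsvd).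
have hU : U ^t* *m col i U = delta_mx i 0.
  by rewrite colE mulmxA (svd_iso hsvd) mul1mx.
rewrite (bigD1 i) //= big1 ?addr0 => [|j hj]; last first.
  by rewrite hU mxE (negbTE hj) (normc_real 0) normr0 expr0n mulr0.
rewrite hU mxE !eqxx (normc_real 1) normr1 expr1n mulr1.
rewrite colE (fnorm_isoL _ (svd_iso hsvd)) fnorm_delta expr1n => h.
rewrite -(@ler_pXn2r _ 2) ?nnegrE ?mulr_ge0 ?sg_ge0 ?(ltW hkappa) // expr1n.
by apply: (le_trans h); rewrite le_eqVlt; apply/orP; left; apply/eqP; ring.
Qed.

(** On the column space of R the norm is controlled by that of C^* u, which involves only the
    components along singular vectors of nonzero value. *)
Lemma U_inj (v : 'cV[C]_n) :
  (forall i, sg 0 i != 0 -> (U ^t* *m (RR *m v)) i 0 = 0) -> RR *m v = 0.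
Proof.
move=> h; apply/eqP; rewrite -fnorm_eq0 -sqrf_eq0.
have := col_sketch_lb v; rewrite (svd_adj hsvd) big1 => [|i _].
  by rewrite mulr0 => h0; rewrite eq_le h0 sqr_ge0.
have [->|hi] := eqVneq (sg 0 i) 0; first by rewrite expr0n mul0r.
by rewrite h // (normc_real 0) normr0 expr0n mulr0.
Qed.

Variable yh : 'cV[C]_r.
Hypothesis hyh : exists v, yh = RR *m v.

(** The fourth power collects the division by sg in the coefficient of index i and the sg^3 of the
    output; a vanishing sg gives a zero term because x / 0 = 0. *)
Definition regression_vector : 'cV[C]_r :=
  \sum_(i < minn r c | (i < k)%N)
     ((U ^t* *m yh) i 0 / (sg 0 i ^+ 4)%:C) *: col i U.

Lemma w_in_RR : exists v, regression_vector = RR *m v.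
Proof.
apply: (big_ind (fun w => exists v, w = RR *m v)).
- by exists 0; rewrite mulmx0.
- by move=> _ _ [v ->] [v' ->]; exists (v + v'); rewrite mulmxDr.
- move=> i _; have [->|hi] := eqVneq (sg 0 i) 0.
    by exists 0; rewrite expr0n /= invr0 mulr0 scale0r mulmx0.
  by have [v ->] := col_in_RR hi; eexists; rewrite scalemxAr.
Qed.

(** Pairing the sum with U_i isolates the coefficient of index i, so if it were 0, [yh] would be
    orthogonal to all singular vectors of nonzero value, and [U_inj] would give [yh] = 0. *)
Lemma w_neq0 : yh != 0 -> regression_vector != 0.
Proof.
apply: contra => /eqP hw; case: hyh => v hv.
rewrite hv; apply/eqP; apply: U_inj => i hi; rewrite -hv.
have hik : (i < k)%N by case: (ltnP i k) => // /sg_small /eqP; rewrite (negbTE hi).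
have : (U ^t* *m regression_vector) i 0 = 0 by rewrite hw mulmx0 mxE.
rewrite mulmx_sumr summxE (bigD1 i) //= big1 ?addr0 => [|j /andP[_ /negbTE hj]].
  rewrite -scalemxAr colE mulmxA (svd_iso hsvd) mul1mx scaled_delta eqxx mulr1.
  move/eqP; rewrite mulf_eq0 invr_eq0 => /orP[/eqP//|].
  by rewrite (inj_eq (@complexI R) _ 0) expf_eq0 (negbTE hi).
rewrite -scalemxAr colE mulmxA (svd_iso hsvd) mul1mx.
rewrite scaled_delta.
by rewrite eq_sym hj mulr0.
Qed.

Lemma fnorm_w_le :
  fnorm regression_vector ^+ 2
  <= 2 * kappa ^+ 2 * fnorm (RR ^t* *m regression_vector) ^+ 2.
Proof. by have [v ->] := w_in_RR; apply: sketch_adj_lb. Qed.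

Variables (b : 'cV[C]_m) (eps K : R).
Hypotheses (heps : 0 <= eps) (hK : 0 <= K).

(** An error in y is divided by sg, while the allowance carries sg^2; the missing sg^3 is supplied
    by (2 kappa sg)^3 >= 1, whence the constant 8 kappa^3. For sg = 0 both sides are 0. *)
Lemma coefficient_accuracy i :
  fnorm (yh - RR *m (A ^t* *m b))
    <= K * (eps * fnorm b / Num.sqrt k%:R) / (8 * kappa ^+ 3) ->
  normc ((sg 0 i)^-1%:C * (U ^t* *m yh) i 0
    - (((sg 0 i)^-1%:C *: (RR ^t* *m col i U)) ^t* *m (A ^t* *m b)) 0 0)
  <= K * (eps * sg 0 i ^+ 2 * fnorm b / Num.sqrt k%:R).
Proof.
set y := RR *m _; set e := eps * _ / _ => h.
have -> : (((sg 0 i)^-1%:C *: (RR ^t* *m col i U)) ^t* *m (A ^t* *m b)) 0 0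
   = (sg 0 i)^-1%:C * (U ^t* *m y) i 0.
  rewrite linearZ /= map_mxZ /= -scalemxAl mxE; congr (_ * _); first exact: conj_real.
  rewrite adjM adjK -mulmxA -/y colE adjM -mulmxA !mxE.
  rewrite (bigD1 i) //= big1 ?addr0 => [|j /negbTE hj]; last first.
    by rewrite !mxE hj /= conjC0 mul0r.
  by rewrite !mxE !eqxx /= conjC1 mul1r.
rewrite -mulrBr ComplexField.Normc.normcM normc_real.
have hs := sg_ge0 i; rewrite ger0_norm ?invr_ge0 //.
have -> : (U ^t* *m yh) i 0 - (U ^t* *m y) i 0 = (U ^t* *m (yh - y)) i 0.
  by rewrite mulmxBr !mxE.
have [h0|hi] := eqVneq (sg 0 i) 0.
  by rewrite h0 invr0 mul0r expr0n mulr0 !mul0r mulr0.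
have p0 : 0 < sg 0 i by rewrite lt_def hi.
rewrite ler_pdivrMl //.
apply: (le_trans (fnorm_entry _ _ _)).
apply: (le_trans (fnorm_coisoL _ (svd_iso hsvd))).
apply: (le_trans h).
have -> : eps * sg 0 i ^+ 2 * fnorm b / Num.sqrt k%:R = e * sg 0 i ^+ 2.
  by rewrite /e; ring.
have e0 : 0 <= e by rewrite /e !mulr_ge0 ?fnorm_ge0 ?invr_ge0 ?sqrtr_ge0.
rewrite ler_pdivrMr ?mulr_gt0 ?exprn_gt0 //.
have : 1 ^+ 3 <= (2 * kappa * sg 0 i) ^+ 3.
  by rewrite ler_pXn2r ?nnegrE ?mulr_ge0 ?(ltW hkappa) //; apply: sg_lb.
rewrite expr1n => h3.
have -> : sg 0 i * (K * (e * sg 0 i ^+ 2)) * (8 * kappa ^+ 3)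
  = K * e * (2 * kappa * sg 0 i) ^+ 3 by ring.
by rewrite -[leLHS]mulr1 ler_wpM2l // mulr_ge0.
Qed.

End Core.

(** * Concentration *)

Section Concentration.
Variables (R : realType) (p q : nat) (W : finType) (w : W -> R).
Local Notation C := R[i].
Local Notation V := 'M[C]_(p, q).
Hypotheses (hw : forall x, 0 <= w x) (hw1 : \sum_x w x = 1).

Lemma iid_cons n x (g : n.-tuple W) : iid w [tuple of x :: g] = w x * iid w g.
Proof. by rewrite /iid big_cons. Qed.

Variable xi : W -> V.
Hypothesis hxi : \sum_x (w x)%:C *: xi x = 0.

Lemma mean_rdot (x0 : V) : \sum_x w x * rdot x0 (xi x) = 0.
Proof.
transitivity (rdot x0 (\sum_x (w x)%:C *: xi x)); last first.
  by rewrite hxi rdot0r.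
rewrite rdot_sumr.
by apply: eq_bigr => x _; rewrite rdotZr.
Qed.

(** The starting point [x0] is arbitrary so that the induction can peel off the first draw; the
    cross term vanishes in mean. *)
Lemma second_moment n (x0 : V) :
  \sum_(g : n.-tuple W) iid w g * fnorm (x0 + \sum_(x <- g) xi x) ^+ 2
  = fnorm x0 ^+ 2 + n%:R * \sum_x w x * fnorm (xi x) ^+ 2.
Proof.
elim: n x0 => [|n IH] x0.
  by rewrite big_tuple0 /iid !big_nil addr0 mul1r mul0r addr0.
rewrite big_tuple_cons.
transitivity (\sum_x w x * (fnorm (x0 + xi x) ^+ 2 +
    n%:R * \sum_x w x * fnorm (xi x) ^+ 2)).
  apply: eq_bigr => x _; rewrite -IH mulr_sumr; apply: eq_bigr => g _.
  by rewrite iid_cons big_cons addrA mulrA.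
set T := \sum_x w x * fnorm (xi x) ^+ 2.
transitivity (\sum_x (w x * fnorm x0 ^+ 2 + 2 * (w x * rdot x0 (xi x))
    + w x * fnorm (xi x) ^+ 2 + w x * (n%:R * T))).
  by apply: eq_bigr => x _; rewrite fnorm_sqD; ring.
rewrite !big_split /= -!mulr_suml hw1 -mulr_sumr mean_rdot -/T -natr1; ring.
Qed.

Variables (B la : R).
Hypotheses (hB : forall x, w x != 0 -> fnorm (xi x) <= B) (hB0 : 0 <= B)
  (hla : 0 < la) (hlaB : la * B <= 1 / 2).

(* A smooth substitute for [expR (la * fnorm x)], which it dominates. *)
Let psi (x : V) : R := expR (la * Num.sqrt (la ^- 2 + fnorm x ^+ 2)).

(** exp (-y) >= 1 - y gives exp y <= 1 / (1 - y), and the quadratic dominates this quotient for y <=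
    1/2. *)
Lemma expR_quadratic (y : R) : y <= 1 / 2 -> expR y <= 1 + y + 2 * y ^+ 2.
Proof.
move=> hy; have h1 : 0 < 1 - y by lra.
have h2 : expR y <= (1 - y)^-1.
  have -> : expR y = (expR (- y))^-1 by rewrite expRN invrK.
  by rewrite lef_pV2 ?posrE ?expR_gt0 //; apply: expR_ge1Dx.
apply: (le_trans h2); rewrite -[leLHS]mul1r ler_pdivrMr //.
have h3 : 0 <= y ^+ 2 * (1 - 2 * y) by rewrite mulr_ge0 ?sqr_ge0 //; lra.
have -> : (1 + y + 2 * y ^+ 2) * (1 - y) = 1 + y ^+ 2 * (1 - 2 * y) by ring.
by lra.
Qed.

(** With q = sqrt (la^-2 + |x0|^2), the square root lies below its tangent at q^2, which splits the
    increment of the exponent into a part linear in [xi], of mean 0, and la |xi|^2 / (2 q). As q >=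
    1 / la, the second part is at most la^2 B^2 / 2; as q >= |x0|, the first is at most la B <= 1/2,
    so the quadratic bound on exp applies and adds 2 la^2 B^2. *)
Lemma psi_step (x0 : V) :
  \sum_x w x * psi (x0 + xi x) <= psi x0 * expR (5 / 2 * la ^+ 2 * B ^+ 2).
Proof.
set a := la ^- 2.
have a0 : 0 < a by rewrite invr_gt0 exprn_gt0.
set qq := Num.sqrt (a + fnorm x0 ^+ 2).
have s0 : 0 < a + fnorm x0 ^+ 2 by rewrite ltr_pwDl ?sqr_ge0.
have q0 : 0 < qq by rewrite sqrtr_gt0.
have q2 : qq ^+ 2 = a + fnorm x0 ^+ 2 by rewrite sqr_sqrtr ?ltW.
have qx : fnorm x0 <= qq.
  rewrite -(@ler_pXn2r _ 2) ?nnegrE ?fnorm_ge0 ?(ltW q0) // q2.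
  by rewrite lerDr ltW.
have ql : la^-1 <= qq.
  rewrite -(@ler_pXn2r _ 2) ?nnegrE ?invr_ge0 ?(ltW q0) ?(ltW hla) // q2 exprVn.
  by rewrite lerDl sqr_ge0.
pose y x := la * (rdot x0 (xi x) / qq).
have step x : w x != 0 ->
    psi (x0 + xi x) <= psi x0 * expR (la ^+ 2 * B ^+ 2 / 2)
      * (1 + y x + 2 * (la ^+ 2 * B ^+ 2)).
  move=> wx; have hb := hB wx.
  set d := 2 * rdot x0 (xi x) + fnorm (xi x) ^+ 2.
  have hq' : Num.sqrt (a + fnorm (x0 + xi x) ^+ 2) <= qq + d / (2 * qq).
    have hd : 0 <= qq ^+ 2 + d.
      rewrite q2 /d -addrA addrA -[X in _ + X + _]addr0.
      have := sqr_ge0 (fnorm (x0 + xi x)); rewrite fnorm_sqD => h.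
      by move: a0 h; lra.
    have hn : 0 <= qq + d / (2 * qq).
      have -> : qq + d / (2 * qq) = (qq ^+ 2 + (qq ^+ 2 + d)) / (2 * qq).
        by field; rewrite gt_eqF.
      by apply: divr_ge0; [apply: addr_ge0; rewrite ?sqr_ge0|rewrite mulr_ge0 // ltW].
    rewrite -(@ler_pXn2r _ 2) ?nnegrE ?sqrtr_ge0 // sqr_sqrtr; last first.
      by rewrite addr_ge0 ?sqr_ge0 ?(ltW a0).
    have -> : (qq + d / (2 * qq)) ^+ 2 = qq ^+ 2 + d + (d / (2 * qq)) ^+ 2.
      by field; rewrite gt_eqF.
    rewrite q2 fnorm_sqD /d; have := sqr_ge0 (d / (2 * qq)); rewrite /d; lra.
  have hy : `|y x| <= la * B.
    rewrite normrM gtr0_norm // ler_wpM2l ?(ltW hla) // normrM normfV.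
    rewrite (gtr0_norm q0) ler_pdivrMr //.
    apply: (le_trans (ler_rdot _ _)); rewrite mulrC.
    by apply: ler_pM => //; apply: fnorm_ge0.
  have hy2 : y x ^+ 2 <= la ^+ 2 * B ^+ 2.
    by rewrite -real_normK ?num_real // -exprMn ler_pXn2r ?nnegrE ?mulr_ge0 ?(ltW hla).
  have h1 : la * Num.sqrt (a + fnorm (x0 + xi x) ^+ 2)
      <= la * qq + la ^+ 2 * B ^+ 2 / 2 + y x.
    apply: (le_trans (ler_wpM2l (ltW hla) hq')).
    have -> : la * (qq + d / (2 * qq))
       = la * qq + (la * (fnorm (xi x) ^+ 2) / qq / 2) + y x.
      by rewrite /y /d; field; rewrite gt_eqF.
    rewrite lerD2r lerD2l ler_pM2r ?invr_gt0 //.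
    have h2 : qq^-1 <= la by rewrite -[la]invrK lef_pV2 ?posrE ?invr_gt0.
    have h3 : fnorm (xi x) ^+ 2 <= B ^+ 2.
      by rewrite ler_pXn2r ?nnegrE ?fnorm_ge0.
    have h4 : fnorm (xi x) ^+ 2 * qq^-1 <= B ^+ 2 * la.
      by apply: ler_pM => //; rewrite ?sqr_ge0 ?invr_ge0 ?(ltW q0).
    have -> : la ^+ 2 * B ^+ 2 = la * (B ^+ 2 * la) by ring.
    by rewrite -mulrA ler_pM2l.
  rewrite /psi -/a -/qq.
  apply: (@le_trans _ _ (expR (la * qq + la ^+ 2 * B ^+ 2 / 2 + y x))).
    by rewrite ler_expR.
  rewrite !expRD ler_wpM2l ?mulr_ge0 ?expR_ge0 //.
  have hy1 : y x <= 1 / 2 by apply: le_trans hlaB; apply: le_trans hy; apply: ler_norm.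
  apply: (le_trans (expR_quadratic hy1)); lra.
apply: (@le_trans _ _ (\sum_x w x * (psi x0 * expR (la ^+ 2 * B ^+ 2 / 2)
      * (1 + y x + 2 * (la ^+ 2 * B ^+ 2))))).
  apply: ler_sum => x _; have [->|wx] := eqVneq (w x) 0; first by rewrite !mul0r.
  by rewrite ler_wpM2l // step.
have -> : \sum_x w x * (psi x0 * expR (la ^+ 2 * B ^+ 2 / 2)
      * (1 + y x + 2 * (la ^+ 2 * B ^+ 2)))
  = psi x0 * expR (la ^+ 2 * B ^+ 2 / 2) * (1 + 2 * (la ^+ 2 * B ^+ 2)).
  under eq_bigr do rewrite mulrCA.
  rewrite -mulr_sumr; congr (_ * _).
  under eq_bigr do rewrite !mulrDr mulr1.
  rewrite !big_split /= -mulr_suml hw1 mul1r.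
  rewrite (_ : \sum_x w x * y x = 0) ?addr0 //.
  transitivity (la / qq * \sum_x w x * rdot x0 (xi x)).
    by rewrite mulr_sumr; apply: eq_bigr => x _; rewrite /y; ring.
  by rewrite mean_rdot mulr0.
rewrite -mulrA ler_wpM2l ?expR_ge0 //.
apply: (@le_trans _ _ (expR (la ^+ 2 * B ^+ 2 / 2) * expR (2 * (la ^+ 2 * B ^+ 2)))).
  by rewrite ler_wpM2l ?expR_ge0 // expR_ge1Dx.
by rewrite -expRD ler_expR; lra.
Qed.

Lemma psi_iid n (x0 : V) :
  \sum_(g : n.-tuple W) iid w g * psi (x0 + \sum_(x <- g) xi x)
  <= psi x0 * expR (n%:R * (5 / 2 * la ^+ 2 * B ^+ 2)).
Proof.
elim: n x0 => [|n IH] x0.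
  by rewrite big_tuple0 /iid !big_nil addr0 mul1r mul0r expR0 mulr1.
rewrite big_tuple_cons.
apply: (@le_trans _ _ (\sum_x w x * (psi (x0 + xi x) *
    expR (n%:R * (5 / 2 * la ^+ 2 * B ^+ 2))))).
  apply: ler_sum => x _; apply: le_trans (ler_wpM2l (hw x) (IH _)).
  rewrite mulr_sumr; apply: ler_sum => g _.
  by rewrite iid_cons big_cons addrA mulrA.
under eq_bigr do rewrite mulrA.
rewrite -mulr_suml; set t := 5 / 2 * _ * _.
have -> : n.+1%:R * t = t + n%:R * t by rewrite mulrSr; ring.
rewrite expRD mulrA.
by rewrite ler_wpM2r ?expR_ge0 // psi_step.
Qed.

(** Markov's inequality for [psi]; the summand 1 in the exponent comes from the value exp 1 of [psi]
    at the origin. *)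
Lemma tail_iid n (u : R) :
  \sum_(g : n.-tuple W) iid w g * (u <= fnorm (\sum_(x <- g) xi x))%R%:R
  <= expR (1 + n%:R * (5 / 2 * la ^+ 2 * B ^+ 2) - la * u).
Proof.
have h := psi_iid n 0.
have h0 : psi 0 = expR 1.
  rewrite /psi fnorm0 expr0n addr0 -exprVn sqrtr_sqr ger0_norm ?invr_ge0 ?(ltW hla) //.
  by rewrite divff // gt_eqF.
rewrite h0 -expRD in h.
rewrite expRD expRN ler_pdivlMr ?expR_gt0 //.
apply: le_trans h; rewrite mulr_suml; apply: ler_sum => g _.
rewrite add0r -mulrA ler_wpM2l ?iid_ge0 //.
case: (leP u (fnorm _)) => hu; last by rewrite mul0r expR_ge0.
rewrite mul1r ler_expR ler_wpM2l ?(ltW hla) //; apply: (le_trans hu).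
rewrite -{1}(ger0_norm (fnorm_ge0 _)) -sqrtr_sqr ler_sqrt.
  by rewrite lerDr invr_ge0 sqr_ge0.
by rewrite addr_ge0 ?invr_ge0 ?sqr_ge0.
Qed.

End Concentration.

(** * Tail bounds for independent sums and for majorities *)

Section Tails.
Variables (R : realType) (W : finType) (w : W -> R).
Hypotheses (hw : forall x, 0 <= w x) (hw1 : \sum_x w x = 1).

Lemma hoeffding p q (xi : W -> 'M[R[i]]_(p, q)) (B u : R) n :
  \sum_x (w x)%:C *: xi x = 0 ->
  (forall x, w x != 0 -> fnorm (xi x) <= B) -> 0 < B -> 0 < u ->
  2 * u <= 5 * n%:R * B ->
  \sum_(g : n.-tuple W) iid w g * (u <= fnorm (\sum_(x <- g) xi x))%R%:R
  <= expR (1 - u ^+ 2 / (10 * n%:R * B ^+ 2)).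
Proof.
move=> h1 h2 B0 u0 hu.
have n0 : (0 : R) < n%:R.
  rewrite ltr0n lt0n; apply/eqP => n0; move: hu; rewrite n0 mulr0 mul0r; lra.
(* This value minimises the exponent 5/2 n la^2 B^2 - la u; the assumption 2 u <= 5 n B amounts to
   la B <= 1/2. *)
pose la := u / (5 * n%:R * B ^+ 2).
have nb : 0 < 5 * n%:R * B ^+ 2 by rewrite !mulr_gt0 ?exprn_gt0.
have la0 : 0 < la by rewrite divr_gt0.
have laB : la * B <= 1 / 2.
  have -> : la * B = u / (5 * n%:R * B) by rewrite /la; field; rewrite !gt_eqF.
  rewrite ler_pdivrMr ?mulr_gt0 //; lra.
have := tail_iid hw hw1 h1 h2 (ltW B0) la0 laB n u.
congr (_ <= expR _); rewrite /la; field; by rewrite !gt_eqF.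
Qed.

Lemma markov_square (V : W -> R) (a : R) :
  (forall x, 0 <= V x) -> 0 <= a -> 16 * \sum_x w x * V x <= a ->
  \sum_x w x * (a < V x)%R%:R <= 1 / 16.
Proof.
move=> hV ha h.
(* The threshold may be 0, as happens for b = 0; the mean is then 0 and V vanishes wherever w does
   not. *)
have [a0|a0] := eqVneq a 0.
  suff -> : \sum_x w x * (a < V x)%R%:R = 0 by lra.
  have hs : \sum_x w x * V x = 0.
    apply/eqP; rewrite eq_le; apply/andP; split; first by lra.
    by apply: sumr_ge0 => x _; apply: mulr_ge0.
  apply: big1 => x _; have := hs; move/eqP; rewrite psumr_eq0; last first.
    by move=> y _; apply: mulr_ge0.
  move/allP => /(_ x (mem_index_enum x)) /=; rewrite mulf_eq0 => /orP[/eqP->|/eqP->].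
    by rewrite mul0r.
  by rewrite a0 ltxx mulr0.
have ap : 0 < a by rewrite lt_def a0.
rewrite -(ler_pM2l ap).
apply: (@le_trans _ _ (\sum_x w x * V x)); last by lra.
rewrite mulr_sumr; apply: ler_sum => x _; rewrite mulrCA ler_wpM2l //.
by case: (ltP a (V x)) => hx; rewrite ?mulr1 ?mulr0 ?(ltW hx).
Qed.

Lemma iid_prod n (F : W -> R) :
  \sum_(g : n.-tuple W) iid w g * \prod_(x <- g) F x = (\sum_x w x * F x) ^+ n.
Proof.
elim: n => [|n IH]; first by rewrite big_tuple0 /iid !big_nil mulr1.
rewrite big_tuple_cons exprS -IH mulr_suml; apply: eq_bigr => x _.
rewrite mulr_sumr; apply: eq_bigr => g _.
by rewrite /iid !big_cons; ring.
Qed.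

(** Chernoff's bound with weight 16 per bad element: the indicator is at most 16^count / 4^n, and
    the mean of 16^bad is at most 1 + 15/16 < 2, which leaves (2 / 4)^n. *)
Lemma majority_tail n (bad : pred W) :
  \sum_x w x * (bad x)%:R <= 1 / 16 ->
  \sum_(g : n.-tuple W) iid w g * (n <= 2 * count bad g)%N%:R <= 2^-1 ^+ n.
Proof.
move=> h.
apply: (@le_trans _ _ (\sum_(g : n.-tuple W) iid w g *
    ((4 ^+ n)^-1 * \prod_(x <- g) 16 ^+ bad x))).
  apply: ler_sum => g _; apply: ler_wpM2l; first exact: iid_ge0.
  have -> : \prod_(x <- g) 16 ^+ bad x = 4 ^+ (2 * count bad g) :> R.
    elim: (val g) => [|x s IH]; first by rewrite big_nil.
    rewrite big_cons IH /= mulnDr exprD; congr (_ * _).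
    by case: (bad x) => /=; rewrite ?muln0 ?muln1 ?expr0 //; ring.
  have p0 : (0 : R) < 4 ^+ n by rewrite exprn_gt0.
  rewrite mulrC ler_pdivlMr //.
  case: leqP => hn; last by rewrite mul0r exprn_ge0.
  by rewrite mul1r ler_eXn2l //; lra.
under eq_bigr do rewrite mulrCA.
rewrite -mulr_sumr iid_prod -exprVn -exprMn.
have h1 : \sum_x w x * 16 ^+ bad x = 1 + 15 * \sum_x w x * (bad x)%:R.
  rewrite mulr_sumr -[X in X + _]hw1 -big_split /=; apply: eq_bigr => x _.
  by case: (bad x) => /=; ring.
have h0 : 0 <= \sum_x w x * (bad x)%:R by apply: sumr_ge0 => x _; rewrite mulr_ge0.
by apply: lerXn2r; rewrite ?nnegrE ?h1; lra.
Qed.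

End Tails.

(** * Gram matrices of length-square samples *)

Section Sampling.
Variable R : realType.
Local Notation C := R[i].

Definition gram p q (X : 'M[C]_(p, q)) := X *m X ^t*.

Lemma fnorm_sqB_mean p q (W : finType) (w : W -> R) (X : W -> 'M[C]_(p, q))
    (mu : 'M[C]_(p, q)) :
  \sum_x w x = 1 -> \sum_x (w x)%:C *: X x = mu ->
  \sum_x w x * fnorm (X x - mu) ^+ 2
  = \sum_x w x * fnorm (X x) ^+ 2 - fnorm mu ^+ 2.
Proof.
move=> hw1 hmu.
have h : \sum_x w x * rdot (X x) mu = fnorm mu ^+ 2.
  rewrite fnorm_sq -[X in _ = rdot _ X]hmu rdot_sumr; apply: eq_bigr => x _.
  by rewrite rdotZr rdotC.
transitivity (\sum_x (w x * fnorm (X x) ^+ 2 - 2 * (w x * rdot (X x) mu)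
   + w x * fnorm mu ^+ 2)).
  by apply: eq_bigr => x _; rewrite fnorm_sqD rdotNr fnormN; ring.
rewrite big_split /= sumrB -mulr_sumr -mulr_suml h hw1; ring.
Qed.

Lemma centered p q (W : finType) (w : W -> R) (X : W -> 'M[C]_(p, q))
    (mu : 'M[C]_(p, q)) :
  \sum_x w x = 1 -> \sum_x (w x)%:C *: X x = mu ->
  \sum_x (w x)%:C *: (X x - mu) = 0.
Proof.
move=> hw1 hmu; under eq_bigr do rewrite scalerBr.
rewrite sumrB hmu -scaler_suml.
have -> : \sum_i (w i)%:C = 1 :> C by rewrite -rmorph_sum hw1 rmorph1.
by rewrite scale1r subrr.
Qed.

Lemma gram_cols p q (M : 'M[C]_(p, q)) :
  M *m M ^t* = \sum_j col j M *m (col j M) ^t*.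
Proof.
apply/matrixP => a b; rewrite !mxE summxE; apply: eq_bigr => j _.
by rewrite !mxE big_ord1 !mxE.
Qed.

Lemma fnorm_outer p (u : 'cV[C]_p) : fnorm (u *m u ^t*) <= fnorm u ^+ 2.
Proof. by apply: (le_trans (fnormM _ _)); rewrite fnorm_adj expr2. Qed.

Variables (p n : nat) (M : 'M[C]_(p, n)) (W : finType) (w : W -> R)
  (cc : W -> 'I_n).
Hypotheses (hM : M != 0) (hw : forall x, 0 <= w x) (hw1 : \sum_x w x = 1).
Hypothesis hcc : forall j,
  \sum_(x | cc x == j) w x = fnorm (col j M) ^+ 2 / fnorm M ^+ 2.
Let F := fnorm M.
Let X x : 'M[C]_(p, p) :=
  (F ^+ 2 / fnorm (col (cc x) M) ^+ 2)%:C *: (col (cc x) M *m (col (cc x) M) ^t*).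

Let F0 : 0 < F. Proof. by rewrite /F fnorm_gt0. Qed.

Lemma mean_outer : \sum_x (w x)%:C *: X x = M *m M ^t*.
Proof.
rewrite gram_cols (partition_big cc predT) //=; apply: eq_bigr => j _.
transitivity (\sum_(x | cc x == j) (w x)%:C *:
    ((F ^+ 2 / fnorm (col j M) ^+ 2)%:C *: (col j M *m (col j M) ^t*))).
  by apply: eq_bigr => x /eqP hx; rewrite /X hx.
rewrite -scaler_suml -rmorph_sum hcc scalerA -rmorphM /=.
have [h|h] := eqVneq (fnorm (col j M)) 0.
  move/eqP: h; rewrite fnorm_eq0 => /eqP ->.
  by rewrite mul0mx scaler0.
have -> : fnorm (col j M) ^+ 2 / fnorm M ^+ 2 * (F ^+ 2 / fnorm (col j M) ^+ 2) = 1.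
  by rewrite -/F; field; rewrite h gt_eqF.
by rewrite scale1r.
Qed.

(** The length-square weights make the bound the same for all columns, however small. *)
Lemma outer_bound x : fnorm (X x) <= F ^+ 2.
Proof.
rewrite /X fnormZ normc_real ger0_norm; last by rewrite divr_ge0 ?sqr_ge0.
have [h|h] := eqVneq (fnorm (col (cc x) M)) 0.
  by rewrite h expr0n invr0 mulr0 mul0r sqr_ge0.
have p0 : 0 < fnorm (col (cc x) M) ^+ 2 by rewrite exprn_gt0 // lt_def h fnorm_ge0.
rewrite mulrAC ler_pdivrMr // ler_wpM2l ?sqr_ge0 //.
exact: fnorm_outer.
Qed.

(** [hoeffding] for the centred outer products, bounded by 2 F^2, at deviation c delta. The map [cc]
    reads the column off a richer outcome, because a drawn column comes with the row that produced
    it. *)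
Lemma col_concentration c (delta : R) :
  (0 < c)%N -> 0 < delta -> delta <= 5 * F ^+ 2 ->
  \sum_(g : c.-tuple W) iid w g *
    (delta <= fnorm (M *m M ^t* -
       gram (col_sketch F M [ffun t => cc (tnth g t)])))%R%:R
  <= expR (1 - c%:R * delta ^+ 2 / (40 * F ^+ 4)).
Proof.
move=> c0 d0 dF.
have cR : (0 : R) < c%:R by rewrite ltr0n.
have hc := centered hw1 mean_outer.
have hb x : w x != 0 -> fnorm (X x - M *m M ^t*) <= 2 * F ^+ 2.
  move=> _; apply: (le_trans (fnormD _ _)); rewrite fnormN mulr_natl mulr2n.
  apply: lerD; first exact: outer_bound.
  by apply: (le_trans (fnormM _ _)); rewrite fnorm_adj expr2.
have := hoeffding hw hw1 hc hb (B := 2 * F ^+ 2) (u := c%:R * delta) (n := c).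
have -> : 1 - (c%:R * delta) ^+ 2 / (10 * c%:R * (2 * F ^+ 2) ^+ 2)
  = 1 - c%:R * delta ^+ 2 / (40 * F ^+ 4).
  by field; rewrite !gt_eqF.
have B0 : 0 < 2 * F ^+ 2 by rewrite mulr_gt0 ?exprn_gt0.
have hu : 2 * (c%:R * delta) <= 5 * c%:R * (2 * F ^+ 2).
  have -> : 2 * (c%:R * delta) = c%:R * (2 * delta) by ring.
  have -> : 5 * c%:R * (2 * F ^+ 2) = c%:R * (2 * (5 * F ^+ 2)) by ring.
  by rewrite ler_pM2l // ler_pM2l.
move=> /(_ B0 (mulr_gt0 cR d0) hu) h; apply: le_trans h.
rewrite le_eqVlt; apply/orP; left; apply/eqP; apply: eq_bigr => g _.
congr (_ * _%:R); congr (nat_of_bool _).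
rewrite /gram; set CC := col_sketch _ _ _.
have hCC : CC *m CC ^t* = c%:R^-1%:C *: \sum_(x <- g) X x.
  rewrite gram_cols big_tuple scaler_sumr; apply: eq_bigr => t _.
  set x := tnth g t; set a := F / Num.sqrt c%:R / fnorm (col (cc x) M).
  have -> : col t CC = a%:C *: col (cc x) M.
    by apply/matrixP => s z; rewrite !mxE !ffunE.
  rewrite linearZ /= map_mxZ /= -scalemxAl -scalemxAr scalerA scalerA.
  congr (_ *: _); rewrite [X in _ * X](conj_real a) -!rmorphM /=; congr (_%:C).
  have hs : Num.sqrt c%:R ^+ 2 = c%:R :> R by rewrite sqr_sqrtr ?ler0n.
  by rewrite /a -[in RHS]hs -!exprVn; ring.
have -> : M *m M ^t* - CC *m CC ^t*
    = (- (c%:R^-1))%:C *: \sum_(x <- g) (X x - M *m M ^t*).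
  rewrite hCC sumrB scalerBr.
  have -> : \sum_(x <- g) M *m M ^t* = c%:R%:C *: (M *m M ^t*).
    rewrite big_const_seq count_predT size_tuple -Monoid.iteropE /=.
    by rewrite rmorph_nat scaler_nat; elim: (c) => //= k IH; rewrite mulrS -IH.
  rewrite scalerA -rmorphM /= mulNr mulVf ?gt_eqF // rmorphN1 scaleN1r opprK.
  by rewrite rmorphN /= scaleNr addrC.
rewrite fnormZ normc_real normrN ger0_norm ?invr_ge0 ?ler0n //.
by rewrite [X in (_ <= X)%R = _]mulrC ler_pdivlMr // mulrC.
Qed.

End Sampling.

(** * An unbiased estimator of R A^* b *)

Section Estimator.
Variable R : realType.
Local Notation C := R[i].
Variables (m n r : nat) (A : 'M[C]_(m, n)) (b : 'cV[C]_m) (RR : 'M[C]_(r, n)).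
Hypotheses (hA : A != 0) (hRR : fnorm RR = fnorm A).

Definition entry_law (x : 'I_m * 'I_n) : R :=
  fnorm (row x.1 A) ^+ 2 / fnorm A ^+ 2 *
  (normc (A x.1 x.2) ^+ 2 / fnorm (row x.1 A) ^+ 2).

Definition estimate (x : 'I_m * 'I_n) : 'cV[C]_r :=
  ((fnorm A ^+ 2)%:C * b x.1 0 / A x.1 x.2) *: col x.2 RR.

Lemma entry_lawE x : entry_law x = normc (A x.1 x.2) ^+ 2 / fnorm A ^+ 2.
Proof.
rewrite /entry_law; have [h|h] := eqVneq (fnorm (row x.1 A)) 0.
  have -> : normc (A x.1 x.2) = 0.
    apply/eqP; rewrite eq_le normc_ge0 andbT -h.
    have := fnorm_entry (row x.1 A) 0 x.2; by rewrite mxE.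
  by rewrite expr0n !mul0r mulr0.
have h2 : fnorm A != 0 by rewrite fnorm_eq0.
by field; rewrite h h2.
Qed.

Lemma entry_law_ge0 x : 0 <= entry_law x.
Proof. by rewrite entry_lawE divr_ge0 ?sqr_ge0. Qed.

Lemma entry_law_sum1 : \sum_x entry_law x = 1.
Proof.
under eq_bigr do rewrite entry_lawE.
rewrite -mulr_suml -(pair_bigA _ (fun i j => normc (A i j) ^+ 2)) /= -fnorm_sqE.
by rewrite divff // expf_eq0 fnorm_eq0.
Qed.

Lemma estimate_mean :
  \sum_x (entry_law x)%:C *: estimate x = RR *m (A ^t* *m b).
Proof.
have h2 : fnorm A != 0 by rewrite fnorm_eq0.
transitivity (\sum_i \sum_j (Num.conj (A i j) * b i 0) *: col j RR).
  rewrite pair_bigA; apply: eq_bigr => -[i j] _ /=.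
  rewrite entry_lawE /estimate /= scalerA; congr (_ *: _).
  (* A zero entry of A is never drawn, and its term in R A^* b is 0 as well. *)
  have [->|h] := eqVneq (A i j) 0.
    by rewrite (normc_real 0) normr0 expr0n mul0r rmorph0 mul0r conjC0 mul0r.
  have -> : (normc (A i j) ^+ 2 / fnorm A ^+ 2)%:C
      = Num.conj (A i j) * A i j / (fnorm A ^+ 2)%:C.
    by rewrite conj_mul_normc -fmorphV -rmorphM.
  have h3 : ((fnorm A ^+ 2)%:C : C) != 0.
    by rewrite fmorph_eq0 expf_eq0 (negbTE h2).
  by move: h3; move: ((fnorm A ^+ 2)%:C) => f2 h3; field; rewrite h h3.
rewrite exchange_big /=.
apply/matrixP => s z; rewrite mxE summxE; apply: eq_bigr => j _.
rewrite -scaler_suml mxE ord1 !mxE mulrC; congr (_ * _).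
by apply: eq_bigr => i _; rewrite !mxE.
Qed.

(** The factor |A_ij|^2 of the law cancels the division by A_ij, leaving F^2 |b_i|^2 |R_.j|^2, whose
    sums over i and j separate. *)
Lemma estimate_sq :
  \sum_x entry_law x * fnorm (estimate x) ^+ 2 <= fnorm A ^+ 4 * fnorm b ^+ 2.
Proof.
have h2 : fnorm A != 0 by rewrite fnorm_eq0.
apply: (@le_trans _ _ (\sum_i \sum_j
   fnorm A ^+ 2 * normc (b i 0) ^+ 2 * fnorm (col j RR) ^+ 2)).
  rewrite pair_bigA; apply: ler_sum => -[i j] _ /=.
  rewrite entry_lawE /estimate /= fnorm_sqZ mulrA ler_wpM2r ?sqr_ge0 //.
  have [->|h] := eqVneq (A i j) 0.
    rewrite (normc_real 0) normr0 expr0n !mul0r; apply: mulr_ge0; exact: sqr_ge0.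
  rewrite !ComplexField.Normc.normcM ComplexField.Normc.normcV normc_real.
  rewrite ger0_norm ?sqr_ge0 //.
  have h3 : normc (A i j) != 0.
    by apply: contra h => /eqP/ComplexField.Normc.eq0_normc ->.
  rewrite le_eqVlt; apply/orP; left; apply/eqP; field; by rewrite h3 h2.
under eq_bigr do rewrite -mulr_sumr -fnorm_sq_cols hRR.
rewrite -mulr_suml -mulr_sumr le_eqVlt; apply/orP; left; apply/eqP.
have -> : \sum_i normc (b i 0) ^+ 2 = fnorm b ^+ 2.
  by rewrite fnorm_sqE; apply: eq_bigr => i _; rewrite big_ord1.
ring.
Qed.

Definition batch_mean N (h : seq ('I_m * 'I_n)) : 'cV[C]_r :=
  (N%:R^-1)%:C *: \sum_(x <- h) estimate x.

(** Chebyshev's inequality: averaging N independent draws divides the variance, at most F^4 |b|^2,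
    by N. The level 1/16 is the one that [majority_tail] amplifies. *)
Lemma batch_error N (tau : R) : (0 < N)%N -> 0 <= tau ->
  16 * (fnorm A ^+ 4 * fnorm b ^+ 2) <= N%:R * tau ^+ 2 ->
  \sum_(h : N.-tuple ('I_m * 'I_n)) iid entry_law h *
    (tau < fnorm (batch_mean N h - RR *m (A ^t* *m b)))%R%:R <= 1 / 16.
Proof.
move=> N0 t0 ht; set y := RR *m _.
have NR : (0 : R) < N%:R by rewrite ltr0n.
have hw := entry_law_ge0; have hw1 := entry_law_sum1.
have hc := centered hw1 estimate_mean.
have e (h : N.-tuple ('I_m * 'I_n)) : fnorm (batch_mean N h - y) ^+ 2
    = N%:R^-1 ^+ 2 * fnorm (\sum_(x <- h) (estimate x - y)) ^+ 2.
  rewrite sumrB; have -> : \sum_(x <- h) y = N%:R%:C *: y.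
    rewrite big_const_seq count_predT size_tuple -Monoid.iteropE /=.
    by rewrite rmorph_nat scaler_nat; elim: (N) => //= k IH; rewrite mulrS -IH.
  have -> : batch_mean N h - y
      = (N%:R^-1)%:C *: (\sum_(x <- h) estimate x - N%:R%:C *: y).
    by rewrite scalerBr scalerA -rmorphM /= mulVf ?gt_eqF // rmorph1 scale1r.
  by rewrite fnormZ exprMn normc_real real_normK ?num_real.
have := @markov_square R _ (@iid _ _ entry_law N) _
  (fun h => fnorm (batch_mean N h - y) ^+ 2) (tau ^+ 2).
have hi : forall x : N.-tuple ('I_m * 'I_n), 0 <= iid entry_law x.
  by move=> h; apply: iid_ge0.
move=> /(_ hi (fun=> sqr_ge0 _) (sqr_ge0 _)) H.
apply: le_trans (H _).
  apply: ler_sum => h _; rewrite ler_wpM2l // ler_nat.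
  by rewrite ltr_pXn2r ?nnegrE ?fnorm_ge0.
under eq_bigr do rewrite e mulrCA.
rewrite -mulr_sumr.
have := second_moment hw1 hc N 0.
under eq_bigr do rewrite add0r.
move=> ->; rewrite fnorm0 expr0n add0r (fnorm_sqB_mean hw1 estimate_mean).
have h1 := estimate_sq; have h3 := sqr_ge0 (fnorm y).
set S := \sum_x _ in h1 *; set Y := fnorm y ^+ 2 in h3 *.
have -> : 16 * (N%:R^-1 ^+ 2 * (N%:R * (S - Y))) = 16 * (S - Y) / N%:R.
  by field; rewrite gt_eqF.
rewrite ler_pdivrMr // [leRHS]mulrC; apply: le_trans ht; lra.
Qed.

End Estimator.

(** * A central point among mostly accurate estimates *)

Section Median.
Variables (R : realType) (r : nat).
Local Notation C := R[i].

(* [rho] is the least squared radius of a ball which is centred at one of the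
   points and contains more than half of them, and [p] is its centre. *)
Definition selected (Y : nat -> 'cV[C]_r) (q p : nat) : Prop :=
  (p < q)%N /\ exists rho : R,
  (q < 2 * count (fun a => fnorm (Y p - Y a) ^+ 2 <= rho)%R (iota 0 q))%N /\
  forall a b, (a < q)%N -> (b < q)%N ->
   (q < 2 * count (fun b' => fnorm (Y a - Y b') ^+ 2
                     <= fnorm (Y a - Y b) ^+ 2)%R (iota 0 q))%N ->
   rho <= fnorm (Y a - Y b) ^+ 2.

Lemma count_majority (T : eqType) (s : seq T) (P Q : pred T) :
  (size s < 2 * count P s)%N -> (size s < 2 * count Q s)%N ->
  exists2 x, x \in s & P x && Q x.
Proof.
move=> h1 h2; apply/hasP; rewrite has_count.
suff : (0 < count (predI P Q) s)%N by [].
have := count_predUI P Q s; have := count_size (predU P Q) s.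
move: (count (predU P Q) s) (count (predI P Q) s) => u v; lia.
Qed.

Lemma count_le_in (T : eqType) (s : seq T) (P Q : pred T) :
  {in s, forall x, P x -> Q x} -> (count P s <= count Q s)%N.
Proof.
elim: s => //= x s IH h; apply: leq_add; last first.
  by apply: IH => z zs; apply: h; rewrite inE zs orbT.
by have := h x (mem_head _ _); case: (P x) => // ->.
Qed.

(** Around a point within t of y, radius 2 t captures all such points, which are a majority, so the
    least radius is at most 2 t. The ball selected at p then shares a point with that majority,
    which gives 2 t + t. *)
Lemma selected_close (Y : nat -> 'cV[C]_r) q p (y : 'cV[C]_r) (t : R) :
  0 <= t -> selected Y q p ->
  (q < 2 * count (fun a => fnorm (Y a - y) <= t)%R (iota 0 q))%N ->
  fnorm (Y p - y) <= 3 * t.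
Proof.
move=> t0 [hp [rho [h1 h2]]] h3.
pose good a := fnorm (Y a - y) <= t.
have hab a b : good a -> good b -> fnorm (Y a - Y b) ^+ 2 <= (2 * t) ^+ 2.
  move=> ha hb; rewrite ler_pXn2r ?nnegrE ?fnorm_ge0 ?mulr_ge0 //.
  have -> : Y a - Y b = (Y a - y) + - (Y b - y) by rewrite opprB addrA subrK.
  apply: (le_trans (fnormD _ _)); rewrite fnormN; move: ha hb; rewrite /good; lra.
have [a ha] : exists a, (a < q)%N && good a.
  have : has good (iota 0 q) by rewrite has_count; move: h3; rewrite /good; lia.
  by case/hasP => a; rewrite mem_iota add0n => /= ha hg; exists a; rewrite ha.
have /andP[aq ag] := ha.
have hi0 : (Ordinal aq : 'I_q) \in [pred b : 'I_q | good b] by rewrite inE.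
(* Admissible radii are distances between points, hence the farthest good point from a. *)
case: (arg_maxP (fun b : 'I_q => fnorm (Y a - Y b) ^+ 2) hi0) => b hb hmax.
have hrho : rho <= (2 * t) ^+ 2.
  apply: le_trans (hab a b ag hb); apply: h2 => //.
  apply: (leq_trans h3); rewrite leq_mul2l /=.
  apply: count_le_in => z; rewrite mem_iota add0n => /= zq zg.
  exact: (hmax (Ordinal zq)).
have sz : size (iota 0 q) = q by rewrite size_iota.
have [z _ /andP[hz1 hz2]] := count_majority (s := iota 0 q)
  (ltac:(rewrite sz; exact: h1)) (ltac:(rewrite sz; exact: h3)).
have h4 : fnorm (Y p - Y z) <= 2 * t.
  rewrite -(@ler_pXn2r _ 2) ?nnegrE ?fnorm_ge0 ?mulr_ge0 //.
  exact: le_trans hz1 hrho.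
have -> : Y p - y = (Y p - Y z) + (Y z - y) by rewrite addrA subrK.
by apply: (le_trans (fnormD _ _)); move: h4 hz2 => /=; lra.
Qed.

End Median.

(** * The regression program *)

(* Integer arrays: 5 the number c of columns, 8, 10 and 13 loop counters, 9 a
   uniform row, 11 and 12 the indices of a drawn entry, 14 the selected batch.
   Complex arrays: 3 the norm of A, 4 and 5 the real bounds on r and c, 6 the
   norms of the sampled rows, 9 the column sketch, 10 and 11 its singular
   vectors and values, 12 and 13 entries of b and A, 15 the batch means, one
   per row, 16 their mutual distances. *)
Definition nv (a : nat) : nexp := NGet a (NLit 0).
Definition cv (a : nat) : cexp := CGet a (NLit 0).
Definition clit (v : nat) : cexp := CNat (NLit v).
Definition cdiv (x y : cexp) : cexp := CMul x (CInv y).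
Fixpoint cpow (x : cexp) (n : nat) : cexp :=
  if n is n'.+1 then CMul x (cpow x n') else clit 1.

Lemma ceval_cpow (R : realType) (s : state R) x n :
  ceval s (cpow x n) = ceval s x ^+ n.
Proof. by elim: n => //= n ->; rewrite exprS. Qed.

Definition rows_bound : cexp :=
  cdiv (CMul (CMul (CMul (CMul (cpow (clit 2) 10)
    (CLn (cdiv (CMul (clit 8) (CNat (NGet 0 (NLit 1)))) (CGet 0 (NLit 2)))))
    (cpow (CGet 0 (NLit 0)) 4)) (cpow (CNat (NGet 0 (NLit 2))) 2))
    (cpow (cv 3) 2)) (cpow (CGet 0 (NLit 1)) 2).

Definition cols_bound : cexp :=
  cdiv (CMul (CMul (CMul (CMul (CMul (cpow (clit 2) 6) (cpow (clit 3) 4))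
    (CLn (cdiv (CMul (clit 8) (CNat (nv 1))) (CGet 0 (NLit 2)))))
    (cpow (CGet 0 (NLit 0)) 8)) (cpow (CNat (NGet 0 (NLit 2))) 2))
    (cpow (cv 3) 2)) (cpow (CGet 0 (NLit 1)) 2).

Lemma Re_real (R : realType) (x : R) : complex.Re x%:C = x.
Proof. by []. Qed.

Definition incr (a : nat) : cmd := NSet a (NLit 0) (NAdd (nv a) (NLit 1)).

Definition compute_sizes : cmd :=
  Seq (QueryNorm 3 (NLit 0))
  (Seq (CSet 4 (NLit 0) rows_bound)
  (Seq (While (BCLt (CNat (nv 1)) (cv 4)) (incr 1))
  (Seq (CSet 5 (NLit 0) cols_bound)
       (While (BCLt (CNat (nv 5)) (cv 5)) (incr 5))))).

Definition sample_rows : cmd :=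
  For 8 (nv 1) (Seq (SampleRow 2 (nv 8)) (QueryRowNorm 6 (nv 8) (NGet 2 (nv 8)))).

Definition sample_cols : cmd :=
  For 8 (nv 5) (Seq (Unif 9 (NLit 0) (nv 1))
                    (SampleCol 3 (nv 8) (NGet 2 (nv 9)))).

(* The entry of the row sketch in row [cell 0 of array a], when the entry of A
   is in array 8, the norms of the rows in array 6 and that of A in array 3. *)
Definition sketch_entry (a : nat) : cexp :=
  CMul (cdiv (cdiv (cv 3) (CSqrt (CNat (nv 1)))) (CGet 6 (nv a))) (cv 8).

Definition cabs2 (x : cexp) : cexp := CMul (CConj x) x.

Definition build_column : cmd :=
  Seq (CSet 7 (NLit 0) (clit 0))
  (Seq (For 10 (nv 1)
     (Seq (QueryA 8 (NLit 0) (NGet 2 (nv 10)) (NGet 3 (nv 8)))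
     (Seq (CSet 9 (NAdd (NMul (nv 10) (nv 5)) (nv 8)) (sketch_entry 10))
          (CSet 7 (NLit 0) (CAdd (cv 7) (cabs2 (sketch_entry 10)))))))
  (For 10 (nv 1)
     (CSet 9 (NAdd (NMul (nv 10) (nv 5)) (nv 8))
        (CMul (cdiv (cdiv (cv 3) (CSqrt (CNat (nv 5)))) (CSqrt (cv 7)))
           (CGet 9 (NAdd (NMul (nv 10) (nv 5)) (nv 8))))))).

Definition build_sketch : cmd :=
  Seq (For 8 (nv 5) build_column) (Svd (nv 1) (nv 5) 9 10 11).

Ltac rd :=
  cbn [nmem cmem nset cset neval ceval beval nv cv clit cdiv];
  repeat match goal with
  | |- context [@eq_op Datatypes_nat__canonical__eqtype_Equality ?a ?b] =>
      let v := eval vm_compute in (@eq_op Datatypes_nat__canonical__eqtype_Equality a b) in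
      match v with
      | true => change (@eq_op Datatypes_nat__canonical__eqtype_Equality a b) with true
      | false => change (@eq_op Datatypes_nat__canonical__eqtype_Equality a b) with false
      end
  end; cbn [andb].

Section Programs.
Variable R : realType.
Local Notation C := R[i].
Variables (m n k : nat) (A : 'M[C]_(m, n)) (b : 'cV[C]_m) (kappa eps eta : R)
  (svd : svd_routine R) (tau : nat).
Local Notation E := (Env A b svd tau).
Local Notation F := (fnorm A).

Lemma natceilP (x : R) (v : nat) : 0 <= x -> (v%:R < x) = (v < natceil x)%N.
Proof.
move=> x0; rewrite /natceil.
have h : (0 <= Num.ceil x)%R by rewrite -(ceil0 R) le_ceil.
rewrite -[v%:R]/(v%:Z%:~R) -ceil_gt_int.
by rewrite -{1}(gez0_abs h) ltz_nat.
Qed.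

Definition has_inputs (s : state R) : Prop :=
  [/\ nmem s 0 0 = m, nmem s 0 1 = n, nmem s 0 2 = k &
    [/\ cmem s 0 0 = kappa%:C, cmem s 0 1 = eps%:C & cmem s 0 2 = eta%:C]].

Definition rows_real : R :=
  2 ^+ 10 * ln (8 * n%:R / eta) * kappa ^+ 4 * k%:R ^+ 2 * F ^+ 2 / eps ^+ 2.

Definition cols_real (r : nat) : R :=
  2 ^+ 6 * 3 ^+ 4 * ln (8 * r%:R / eta) * kappa ^+ 8 * k%:R ^+ 2 * F ^+ 2
  / eps ^+ 2.

Lemma ceval_rows_bound s : has_inputs s -> cmem s 3 0 = F%:C ->
  ceval s rows_bound = rows_real%:C.
Proof.
case=> h1 h2 h3 [h4 h5 h6] h7.
have h8 : ceval s (cdiv (CMul (clit 8) (CNat (NGet 0 (NLit 1)))) (CGet 0 (NLit 2)))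
    = (8 * n%:R / eta)%:C.
  by rewrite /= h2 h6 !(rmorphM, fmorphV, rmorph_nat).
rewrite /rows_bound /=; move: h8 => /= ->.
rewrite Re_real h3 h4 h5 h7 /rows_real !exprS !expr0.
by rewrite !(rmorphM, fmorphV, rmorph_nat, rmorph1).
Qed.

Lemma ceval_cols_bound s r : has_inputs s -> cmem s 3 0 = F%:C ->
  nmem s 1 0 = r -> ceval s cols_bound = (cols_real r)%:C.
Proof.
case=> h1 h2 h3 [h4 h5 h6] h7 hr.
have h8 : ceval s (cdiv (CMul (clit 8) (CNat (nv 1))) (CGet 0 (NLit 2)))
    = (8 * r%:R / eta)%:C.
  by rewrite /= hr h6 !(rmorphM, fmorphV, rmorph_nat).
rewrite /cols_bound /=; move: h8 => /= ->.
rewrite Re_real h3 h4 h5 h7 /cols_real !exprS !expr0.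
by rewrite !(rmorphM, fmorphV, rmorph_nat, rmorph1).
Qed.

Local Notation r := (nrows n k F kappa eps eta).
Local Notation c := (ncols r k F kappa eps eta).

(** The machine has no rounding instruction, so the ceilings r and c are reached by counting; the
    cost, linear in r + c, is negligible. *)
Lemma count_up (a x : nat) (s : state R) (X : R) :
  0 <= X -> nmem s a 0 = 0%N -> cmem s x 0 = X%:C ->
  det E [:: While (BCLt (CNat (nv a)) (cv x)) (incr a)] s
    (natceil X * 15 + 8) (fun s' => nmem s' a 0 = natceil X).
Proof.
move=> hX ha hx.
apply: (@rnd_conseq _ _ _ _ _ _ _ _
  (fun _ s' => nmem s' a 0 = natceil X /\ cmem s' x 0 = X%:C)); last first.
- by move=> o s' _ _ [].
- exact: leqnn.
have hlt s' v : nmem s' a 0 = v -> cmem s' x 0 = X%:C ->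
    beval s' (BCLt (CNat (nv a)) (cv x)) = (v < natceil X)%N.
  move=> h1 h2; rewrite /= h1 h2 -natceilP //=.
  by rewrite -(rmorph_nat (real_complex R)).
apply: (@rnd_conseq _ _ _ _ _ _
  (natceil X * (6 + (bcost (BCLt (CNat (nv a)) (cv x))).+1)
   + (bcost (BCLt (CNat (nv a)) (cv x))).+1) _
  (fun _ s' => nmem s' a 0 = natceil X /\ cmem s' x 0 = X%:C)).
- apply: (@det_while _ _ _ _ 6 _
    (fun v s' => nmem s' a 0 = v /\ cmem s' x 0 = X%:C)).
  + move=> v s' hv _ [h1 h2]; split; first by rewrite (hlt _ v).
    apply: det_nset => //; rewrite /= !eqxx /= h1; split=> //; lia.
  + by move=> s' _ [h1 h2]; rewrite (hlt _ (natceil X)) // ltnn.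
  + by [].
- by rewrite /=; lia.
- by [].
Qed.

Lemma compute_sizes_spec s : has_inputs s ->
  nmem s 1 0 = 0%N -> nmem s 5 0 = 0%N -> 0 <= rows_real -> 0 <= cols_real r ->
  det E [:: compute_sizes] s (2000 + tau + 15 * (r + c))
    (fun s' => [/\ nmem s' 1 0 = r, nmem s' 5 0 = c & cmem s' 3 0 = F%:C]).
Proof.
move=> hin h1 h5 hr hc.
apply: (seq_queryNorm (tb2 := (15 * (r + c) + 1950)%N)); last by rewrite /=; lia.
set s1 := cset _ _ _ _.
have hin1 : has_inputs s1 by [].
apply: (seq_cset (tb2 := (15 * (r + c) + 1500)%N)); last by rewrite /=; lia.
rewrite (ceval_rows_bound hin1) //; set s2 := cset s1 _ _ _.
apply: (rnd_seq_det (tb1 := (r * 15 + 8)%N) (tb2 := (15 * c + 1400)%N)).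
- exact: (@count_up 1 4).
- move=> s3 hf3 hr3.
  have h3 : cmem s3 3 0 = F%:C by rewrite hf3.2.
  have hin3 : has_inputs s3.
    by case: hin => ? ? ? [? ? ?]; split; rewrite ?hf3.1 //; split; rewrite ?hf3.2.
  apply: (seq_cset (tb2 := (c * 15 + 8)%N)); last by rewrite /=; lia.
  rewrite (ceval_cols_bound hin3 h3 hr3).
  set s4 := cset _ _ _ _.
  apply: rnd_conseq (leqnn _) _; first apply: (@count_up 5 5 _ (cols_real r)) => //.
    by rewrite /= hf3.1.
  move=> o s' _ hf hc'; split=> //; first by rewrite hf.1.
  by rewrite hf.2.
- by rewrite /=; lia.
Qed.

End Programs.

Section Sampling.
Variable R : realType.
Local Notation C := R[i].
Variables (m n : nat) (A : 'M[C]_(m, n)) (b : 'cV[C]_m)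
  (svd : svd_routine R) (tau : nat).
Local Notation E := (Env A b svd tau).
Local Notation F := (fnorm A).
Hypothesis hA : A != 0.
Variables (r c : nat).

Definition row_law (i : 'I_m) : R := fnorm (row i A) ^+ 2 / F ^+ 2.

Lemma row_law_ge0 i : 0 <= row_law i.
Proof. by rewrite divr_ge0 ?sqr_ge0. Qed.

Lemma row_law_sum1 : \sum_i row_law i = 1.
Proof.
by rewrite -mulr_suml -fnorm_sq_rows divff // expf_eq0 fnorm_eq0.
Qed.

Lemma row_law_neq0 i : row_law i != 0 -> row i A != 0.
Proof.
by apply: contra => /eqP h; rewrite /row_law h fnorm0 expr0n mul0r.
Qed.

Lemma nth_mapE (T : Type) (T' : Type) (y : T') (f : T -> T') q (g : q.-tuple T)
    (x : 'I_q) : nth y (map f g) x = f (tnth g x).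
Proof. by rewrite -tnth_map (tnth_nth y). Qed.

Lemma sample_rows_spec s : nmem s 1 0 = r ->
  rnd E [:: sample_rows] s (@iid _ _ row_law r) (r * (2 * tau + 40) + 10)
    (fun g s' => forall x : 'I_r, nmem s' 2 x = tnth g x /\
       cmem s' 6 x = (fnorm (row (tnth g x) A))%:C).
Proof.
move=> hr.
pose Inv (h : seq 'I_m) s' := forall x, (x < size h)%N ->
  nmem s' 2 x = nth 0%N (map val h) x /\
  cmem s' 6 x = nth 0 [seq (fnorm (row i A))%:C | i <- h] x.
suff H : rnd E [:: sample_rows] s (@iid _ _ row_law r) (r * (2 * tau + 40) + 10)
    (fun g => Inv g).
  apply: (rnd_conseq H) => // g s' _ _ hs x.
  by have := hs x; rewrite size_tuple !nth_mapE; apply.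
apply: (@rnd_for _ _ _ _ _ _ _ (2 * tau + 20) _ r Inv) => //.
- exact: row_law_ge0.
- exact: row_law_sum1.
- by move=> s' hf; rewrite /= hf.1.
- move=> h s' hh hf h8 hinv.
  apply: (@det_seq_rnd _ _ _ _ _ _ _ (tau + 4) (tau + 8) _
    (fun (i : 'I_m) s2 => s2 = nset s' 2 (size h) i)).
  + apply: (@rnd_sampleRow _ E) => //=.
    * exact: row_law_sum1.
    * lia.
    * by move=> i _; rewrite h8.
  + move=> i s2 _ _ ->; apply: (@det_queryRowNorm _ E _ _ _ i); rd.
    * by rewrite h8 eqxx.
    * rewrite /=; lia.
    * move=> x; rewrite size_rcons ltnS leq_eqVlt => hx; rd.
      rewrite h8 !map_rcons !nth_rcons !size_map.
      by case/orP: hx => [/eqP ->|hx]; rewrite ?eqxx ?ltnn // hx ltn_eqF //; apply: hinv.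
  + by lia.
- by rewrite /=; lia.
Qed.

Variable ii : 'I_r -> 'I_m.
Hypothesis hii : forall x, row (ii x) A != 0.
Hypothesis hr0 : (0 < r)%N.

(** The row s is kept in the outcome: the pair is drawn in two stages with product weights, and only
    its second component goes to array 3. *)
Definition col_law (p : 'I_r * 'I_n) : R :=
  r%:R^-1 * (normc (A (ii p.1) p.2) ^+ 2 / fnorm (row (ii p.1) A) ^+ 2).

Lemma col_law_ge0 p : 0 <= col_law p.
Proof. by rewrite mulr_ge0 ?invr_ge0 ?ler0n // divr_ge0 ?sqr_ge0. Qed.

Lemma row_entries_sum1 i : row i A != 0 ->
  \sum_j normc (A i j) ^+ 2 / fnorm (row i A) ^+ 2 = 1.
Proof.
move=> hi; rewrite -mulr_suml.
have -> : \sum_j normc (A i j) ^+ 2 = fnorm (row i A) ^+ 2.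
  by rewrite fnorm_sqE big_ord1; apply: eq_bigr => j _; rewrite mxE.
by rewrite divff // expf_eq0 fnorm_eq0.
Qed.

Lemma col_law_sum1 : \sum_p col_law p = 1.
Proof.
rewrite -(pair_bigA _ (fun s j => r%:R^-1 *
  (normc (A (ii s) j) ^+ 2 / fnorm (row (ii s) A) ^+ 2))) /=.
under eq_bigr do rewrite -mulr_sumr row_entries_sum1 // mulr1.
by rewrite sumr_const card_ord -(mulr_natl (r%:R^-1 : R)) divff // pnatr_eq0 -lt0n.
Qed.

Lemma sample_cols_spec s : nmem s 1 0 = r -> nmem s 5 0 = c ->
  (forall x : 'I_r, nmem s 2 x = ii x) ->
  rnd E [:: sample_cols] s (@iid _ _ col_law c) (c * (tau + 40) + 10)
    (fun g s' => forall y : 'I_c, nmem s' 3 y = (tnth g y).2).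
Proof.
move=> hr hc h2.
pose Inv (h : seq ('I_r * 'I_n)) (s' : state R) := forall x, (x < size h)%N ->
  nmem s' 3 x = nth 0%N (map (fun p => val p.2) h) x.
suff H : rnd E [:: sample_cols] s (@iid _ _ col_law c) (c * (tau + 40) + 10)
    (fun g => Inv g).
  apply: (rnd_conseq H) => // g s' _ _ hs x.
  by have := hs x; rewrite size_tuple nth_mapE; apply.
apply: (@rnd_for _ _ _ _ _ _ _ (tau + 20) _ c Inv) => //.
- exact: col_law_ge0.
- exact: col_law_sum1.
- by move=> s' hf; rewrite /= hf.1.
- move=> h s' hh hf h8 hinv.
  pose Q (x : 'I_r) (j : 'I_n) (s2 : state R) :=
    Inv (rcons h (x, j)) (nset s2 8 0 (size h).+1).
  suff H : rnd E [:: Seq (Unif 9 (NLit 0) (nv 1))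
        (SampleCol 3 (nv 8) (NGet 2 (nv 9)))] s' col_law (tau + 20)
        (fun p => Q p.1 p.2).
    by apply: (rnd_conseq H) => // -[x j].
  apply: (@rnd_seq _ E _ _ s' 'I_r 'I_n (fun=> r%:R^-1)
     (fun x j => normc (A (ii x) j) ^+ 2 / fnorm (row (ii x) A) ^+ 2) 6 (tau + 10) _
    (fun (x : 'I_r) s2 => s2 = nset s' 9 0 x) Q).
  + apply: rnd_unif => //.
    by rewrite /= hf.1.
  + move=> x s2 _ _ ->; apply: (@rnd_sampleCol _ E _ _ _ (ii x)) => //.
    * by rd; rewrite hf.1 // h2.
    * exact: row_entries_sum1.
    * by rewrite /=; lia.
    * move=> j _ z; rewrite size_rcons ltnS leq_eqVlt => hz; rd.
      rewrite h8 map_rcons nth_rcons size_map.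
      by case/orP: hz => [/eqP ->|hz]; rewrite ?eqxx ?ltnn // hz ltn_eqF //; apply: hinv.
  + by move=> x j; rewrite divr_ge0 ?sqr_ge0.
  + by move=> x _; apply: row_entries_sum1.
  + by lia.
- by rewrite /=; lia.
Qed.

End Sampling.

Lemma sum_ltnS (V : nmodType) q (G : 'I_q -> V) (x : 'I_q) :
  \sum_(i < q | (i < x.+1)%N) G i = \sum_(i < q | (i < x)%N) G i + G x.
Proof.
rewrite (bigD1 x) /= ?ltnSn // addrC; congr (_ + _).
apply: eq_bigl => i; rewrite ltnS -val_eqE /=.
by rewrite [RHS]ltn_neqAle andbC.
Qed.

Lemma sum_ltn0 (V : nmodType) q (G : 'I_q -> V) :
  \sum_(i < q | (i < 0)%N) G i = 0.
Proof. by rewrite big_pred0. Qed.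

Lemma sum_ltn_all (V : nmodType) q (G : 'I_q -> V) :
  \sum_(i < q | (i < q)%N) G i = \sum_i G i.
Proof. by apply: eq_bigl => i; rewrite ltn_ord. Qed.

Lemma cell_inj w x y x' y' : (y < w)%N -> (y' < w)%N ->
  (x * w + y == x' * w + y')%N = (x == x') && (y == y').
Proof.
move=> hy hy'; apply/eqP/andP => [h|[/eqP-> /eqP->]//].
have w0 : (0 < w)%N by apply: leq_trans hy.
have h1 : x = x' by have := congr1 (divn^~ w) h;
  rewrite !divnMDl // !divn_small // !addn0.
by move: h; rewrite h1 => /addnI ->.
Qed.

Lemma Re_nat (R : realType) (v : nat) : complex.Re (v%:R : R[i]) = v%:R.
Proof. by rewrite -(rmorph_nat (real_complex R)). Qed.

(** * The column sketch and its singular vectors *)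

Section Sketch.
Variable R : realType.
Local Notation C := R[i].
Variables (m n : nat) (A : 'M[C]_(m, n)) (b : 'cV[C]_m)
  (svd : svd_routine R) (tau : nat).
Local Notation E := (Env A b svd tau).
Local Notation F := (fnorm A).
Variables (r c : nat) (ii : {ffun 'I_r -> 'I_m}) (jj : {ffun 'I_c -> 'I_n}).
Local Notation RR := (row_sketch A ii).
Local Notation CC := (col_sketch F RR jj).

Definition has_rows (s : state R) : Prop :=
  [/\ nmem s 1 0 = r, forall x : 'I_r, nmem s 2 x = ii x, cmem s 3 0 = F%:C &
    forall x : 'I_r, cmem s 6 x = (fnorm (row (ii x) A))%:C].

Lemma has_rows_frame L s s' :
  [&& 1%N \notin flatten (map nwrites L), 2%N \notin flatten (map nwrites L),
      3%N \notin flatten (map cwrites L) & 6%N \notin flatten (map cwrites L)] ->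
  frame L s s' -> has_rows s -> has_rows s'.
Proof.
move=> /and4P[h1 h2 h3 h4] hf [k1 k2 k3 k4].
by split=> *; rewrite ?hf.1 ?hf.2.
Qed.

Lemma ceval_sketch_entry s a (x : 'I_r) j : has_rows s -> nmem s a 0 = x ->
  cmem s 8 0 = A (ii x) j -> ceval s (sketch_entry a) = RR x j.
Proof.
move=> [h1 h2 h3 h4] ha h8; rewrite /= ha h1 h3 h4 h8 Re_nat mxE.
by rewrite !(rmorphM, fmorphV).
Qed.

Lemma cabs2E (s : state R) e : ceval s (cabs2 e) = (normc (ceval s e) ^+ 2)%:C.
Proof. exact: conj_mul_normc. Qed.

(** The column is stored unscaled while its squared norm accumulates, and rescaled in a second pass.
    The last clause protects the other columns, which share array 9 and so are not covered by
    [frame]. *)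
Lemma build_column_spec s (y : 'I_c) :
  has_rows s -> nmem s 5 0 = c -> nmem s 3 y = jj y -> nmem s 8 0 = y ->
  det E [:: build_column] s (r * (tau + 300) + 60) (fun s' =>
    (forall x : 'I_r, cmem s' 9 (x * c + y)%N = CC x y) /\
    (forall z, (forall x : 'I_r, z != (x * c + y)%N) -> cmem s' 9 z = cmem s 9 z)).
Proof.
move=> hs hc hj h8.
apply: (seq_cset (tb2 := (r * (tau + 300) + 50)%N)); last by rewrite /=; lia.
set s1 := cset s _ _ _.
have hs1 : has_rows s1 by case: hs.
pose Inv1 a (s' : state R) :=
  [/\ cmem s' 7 0 = (\sum_(x < r | (x < a)%N) normc (RR x (jj y)) ^+ 2)%:C,
      forall x : 'I_r, (x < a)%N -> cmem s' 9 (x * c + y)%N = RR x (jj y) &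
      forall z, (forall x : 'I_r, z != (x * c + y)%N) -> cmem s' 9 z = cmem s 9 z].
apply: (@rnd_seq_det _ _ _ _ _ _ _ (r * (tau + 200) + 15) (r * 70 + 15) _ (Inv1 r)).
- apply: (@det_for _ _ _ _ _ (tau + 180)).
  + by [].
  + by move=> s' hf; rewrite /= hf.1 //; case: hs1.
  + by split; rewrite ?sum_ltn0.
  + move=> x s' hf h10 [i1 i2 i3].
    have hs' : has_rows s' by apply: has_rows_frame hf hs1.
    have hc' : nmem s' 5 0 = c by rewrite hf.1.
    have h8' : nmem s' 8 0 = y by rewrite hf.1.
    apply: (@seq_queryA _ E _ _ _ _ _ _ _ (ii x) (jj y) _ _ 150); last 1 first.
      by rewrite /=; lia.
    * by rewrite /= h10; case: hs'.
    * by rewrite /= h8' hf.1.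
    set s2 := cset s' _ _ _.
    have hs2 : has_rows s2 by case: hs'.
    apply: (seq_cset (tb2 := 80)); last by [].
    rewrite (@ceval_sketch_entry s2 10 x (jj y)) //; set s3 := cset s2 _ _ _.
    have hs3 : has_rows s3 by case: hs2.
    apply: det_cset => //.
    have -> : ceval s3 (CAdd (cv 7) (cabs2 (sketch_entry 10)))
        = (\sum_(z < r | (z < x.+1)%N) normc (RR z (jj y)) ^+ 2)%:C.
      rewrite sum_ltnS rmorphD /= -i1 -(@ceval_sketch_entry s3 10 x (jj y)) //.
      by rewrite -cabs2E.
    split.
    * by rd.
    * move=> z hz; rewrite /s3 /s2; rd; rewrite h10 h8' hc' cell_inj // eqxx andbT.
      move: hz; rewrite ltnS leq_eqVlt => /orP[/eqP/val_inj ->|hz].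
        by rewrite eqxx.
      by rewrite ltn_eqF //; apply: i2.
    * move=> z hz; rewrite /s3 /s2; rd; rewrite h10 h8' hc' (negbTE (hz x)); exact: i3.
  + by rewrite /=; lia.
- move=> s2 hf2 [i1 i2 i3].
  have hs2 : has_rows s2 by apply: has_rows_frame hf2 hs1.
  have hacc : cmem s2 7 0 = (fnorm (col (jj y) RR) ^+ 2)%:C.
    rewrite i1 sum_ltn_all fnorm_sqE; congr (_%:C); apply: eq_bigr => x _.
    by rewrite big_ord1 [col _ _ _ _]mxE.
  pose Inv2 a (s' : state R) :=
    (forall x : 'I_r, cmem s' 9 (x * c + y)%N
       = if (x < a)%N then CC x y else RR x (jj y)) /\
    (forall z, (forall x : 'I_r, z != (x * c + y)%N) -> cmem s' 9 z = cmem s 9 z).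
  apply: (@rnd_conseq _ _ _ _ _ _ (r * 70 + 15) _ (fun _ => Inv2 r)); last 2 first.
  + exact: leqnn.
  + by move=> _ s' _ _ [j1 j2]; split=> // x; rewrite j1 ltn_ord.
  apply: (@det_for _ _ _ _ _ 50).
  + by [].
  + by move=> s' hf; rewrite /= hf.1 //; case: hs2.
  + by split=> // x; rewrite ltn0; apply: i2.
  + move=> x s' hf h10 [j1 j2].
    have hs' : has_rows s' by apply: has_rows_frame hf hs2.
    have hc' : nmem s' 5 0 = c by rewrite hf.1 // hf2.1.
    have h8' : nmem s' 8 0 = y by rewrite hf.1 // hf2.1.
    apply: det_cset => //.
    set v := ceval s' _.
    have hv : v = CC x y.
      rewrite /v /= h10 h8' hc' j1 ltnn Re_nat.
      case: hs' => _ _ -> _; rewrite hf.2 // hacc Re_real sqrtr_sqr.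
      rewrite ger0_norm ?fnorm_ge0 // [in RHS]mxE.
      by rewrite !(rmorphM, fmorphV).
    split.
    * move=> z; rd; rewrite h10 h8' hc' cell_inj // eqxx andbT ltnS.
      by case: (ltngtP z x) (j1 z) => [h|h|/val_inj ->].
    * move=> z hz; rd; rewrite h10 h8' hc' (negbTE (hz x)); exact: j2.
  + by rewrite /=; lia.
- by lia.
Qed.

Lemma build_sketch_spec s :
  has_rows s -> nmem s 5 0 = c -> (forall y : 'I_c, nmem s 3 y = jj y) ->
  let U := (svd CC).1 in let sg := (svd CC).2 in
  let l := minn r c in
  det E [:: build_sketch] s (c * (r * (tau + 300) + 100) + r * c * l + 40)
    (fun s' => (forall (x : 'I_r) (y : 'I_l), cmem s' 10 (x * l + y)%N = U x y) /\
               (forall y : 'I_l, cmem s' 11 y = (sg 0 y)%:C)).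
Proof.
move=> hs hc hj U sg l.
pose Inv a (s' : state R) := forall (x : 'I_r) (y : 'I_c), (y < a)%N ->
  cmem s' 9 (x * c + y)%N = CC x y.
apply: (@rnd_seq_det _ _ _ _ _ _ _ (c * (r * (tau + 300) + 80) + 15)
   (r * c * l + 10) _ (Inv c)).
- apply: (@det_for _ _ _ _ _ (r * (tau + 300) + 60)).
  + by [].
  + by move=> s' hf; rewrite /= hf.1.
  + by [].
  + move=> y s' hf h8 hi.
    have hs' : has_rows s' by apply: has_rows_frame hf hs.
    apply: (rnd_conseq (@build_column_spec s' y hs' _ _ h8)).
    * by rewrite hf.1.
    * by rewrite hf.1.
    * exact: leqnn.
    move=> _ s2 _ hf2 [k1 k2] x z; rewrite ltnS leq_eqVlt; rd.
    case/orP => [/eqP/val_inj ->|hz]; first exact: k1.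
    rewrite k2; first exact: hi.
    by move=> x'; rewrite cell_inj // negb_and [X in _ || X]neq_ltn hz orbT.
  + by rewrite /=; nia.
- move=> s2 hf2 hi.
  have hs2 : has_rows s2 by apply: has_rows_frame hf2 hs.
  have hr2 : nmem s2 1 0 = r by case: hs2.
  have hc2 : nmem s2 5 0 = c by rewrite hf2.1.
  apply: det_svd; first by rewrite /= hr2 hc2 /l; lia.
  rewrite [neval _ _]/= [neval _ (nv 5)]/= hr2 hc2.
  have hM : \matrix_(x < r, y < c) cmem s2 9 (x * c + y)%N = CC.
    by apply/matrixP => x y; rewrite mxE hi.
  split.
  + move=> x y; rewrite /svd_store /= hM.
    have l0 : (0 < minn r c)%N by apply: leq_ltn_trans (ltn_ord y).
    rewrite divnMDl // divn_small // addn0 modnMDl modn_small //.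
    by rewrite !valK.
  + by move=> y; rewrite /svd_store /= hM valK.
- by rewrite /=; lia.
Qed.

End Sketch.

Definition add_sample : cmd :=
  For 13 (nv 1)
    (Seq (QueryA 8 (NLit 0) (NGet 2 (nv 13)) (nv 12))
         (CSet 15 (NAdd (NMul (nv 8) (nv 1)) (nv 13))
            (CAdd (CGet 15 (NAdd (NMul (nv 8) (nv 1)) (nv 13)))
                  (CMul (cv 14) (sketch_entry 13))))).

Definition estimate_coef (M : nat) : cexp :=
  CMul (CInv (CNat (NMul (NLit M) (nv 5))))
    (cdiv (CMul (CMul (cv 3) (cv 3)) (cv 12)) (cv 13)).

Definition one_sample (M : nat) : cmd :=
  Seq (SampleRow 11 (NLit 0))
  (Seq (SampleCol 12 (NLit 0) (nv 11))
  (Seq (QueryB 12 (NLit 0) (nv 11))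
  (Seq (QueryA 13 (NLit 0) (nv 11) (nv 12))
  (Seq (CSet 14 (NLit 0) (estimate_coef M)) add_sample)))).

Definition estimate_batches (M : nat) : cmd :=
  For 8 (nv 1) (For 10 (NMul (NLit M) (nv 5)) (one_sample M)).

Lemma estimateE (R : realType) m n r (A : 'M[R[i]]_(m, n)) b
    (RR : 'M[R[i]]_(r, n)) p x :
  estimate A b RR p x 0
  = (fnorm A ^+ 2)%:C * b p.1 0 / A p.1 p.2 * RR x p.2.
Proof. by rewrite /estimate !mxE. Qed.

Section Estimates.
Variable R : realType.
Local Notation C := R[i].
Variables (m n : nat) (A : 'M[C]_(m, n)) (b : 'cV[C]_m)
  (svd : svd_routine R) (tau : nat).
Local Notation E := (Env A b svd tau).
Local Notation F := (fnorm A).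
Hypothesis hA : A != 0.
Variables (r c M : nat) (ii : {ffun 'I_r -> 'I_m}).
Local Notation RR := (row_sketch A ii).
Local Notation N := (M * c)%N.
Local Notation est := (estimate A b RR).

Lemma add_sample_spec s (a : 'I_r) (j : 'I_n) (v : C) :
  has_rows A ii s -> nmem s 8 0 = a -> nmem s 12 0 = j -> cmem s 14 0 = v ->
  det E [:: add_sample] s (r * (tau + 100) + 15) (fun s' =>
    (forall x : 'I_r, cmem s' 15 (a * r + x)%N
       = cmem s 15 (a * r + x)%N + v * RR x j) /\
    (forall z, (forall x : 'I_r, z != (a * r + x)%N) ->
       cmem s' 15 z = cmem s 15 z)).
Proof.
move=> hs h8 h12 h14.
pose Inv y (s' : state R) :=
  (forall x : 'I_r, cmem s' 15 (a * r + x)%N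
       = cmem s 15 (a * r + x)%N + (if (x < y)%N then v * RR x j else 0)) /\
  (forall z, (forall x : 'I_r, z != (a * r + x)%N) -> cmem s' 15 z = cmem s 15 z).
apply: (@rnd_conseq _ _ _ _ _ _ (r * (tau + 100) + 15) _ (fun _ => Inv r)); last 2 first.
- exact: leqnn.
- by move=> _ s' _ _ [j1 j2]; split=> // x; rewrite j1 ltn_ord.
apply: (@det_for _ _ _ _ _ (tau + 80)).
- by [].
- by move=> s' hf; rewrite /= hf.1 //; case: hs.
- by split=> // x; rewrite ltn0 addr0.
- move=> x s' hf h13 [j1 j2].
  have hs' : has_rows A ii s' by apply: has_rows_frame hf hs.
  have h8' : nmem s' 8 0 = a by rewrite hf.1.
  have hr' : nmem s' 1 0 = r by case: hs'.
  apply: (@seq_queryA _ E _ _ _ _ _ _ _ (ii x) j _ _ 60); last 1 first.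
    by rewrite /=; lia.
  * by rewrite /= h13; case: hs'.
  * by rewrite /= hf.1.
  set s2 := cset s' _ _ _.
  have hs2 : has_rows A ii s2 by case: hs'.
  apply: det_cset => //.
  set u := ceval s2 _.
  have hu : u = cmem s 15 (a * r + x)%N + v * RR x j.
    have e14 : cmem s' 14 0 = v by rewrite hf.2.
    have -> : u = cmem s' 15 (a * r + x)%N + cmem s' 14 0 * ceval s2 (sketch_entry 13).
      by rewrite /u /= h8' h13 hr'.
    by rewrite (@ceval_sketch_entry _ _ _ A _ ii s2 13 x j) // e14 j1 ltnn addr0.
  split.
  * move=> z; rewrite /s2; rd; rewrite h13 h8' hr' cell_inj // eqxx /= ltnS.
    by case: (ltngtP z x) (j1 z) => [h|h|/val_inj ->].
  * by move=> z hz; rewrite /s2; rd; rewrite h13 h8' hr' (negbTE (hz x)); apply: j2.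
- by rewrite /=; lia.
Qed.

Lemma one_sample_spec s (a : 'I_r) :
  has_rows A ii s -> nmem s 5 0 = c -> nmem s 8 0 = a ->
  rnd E [:: one_sample M] s (entry_law A) (r * (tau + 100) + 5 * tau + 150)
    (fun p s' =>
    (forall x : 'I_r, cmem s' 15 (a * r + x)%N
       = cmem s 15 (a * r + x)%N + (N%:R^-1)%:C * est p x 0) /\
    (forall z, (forall x : 'I_r, z != (a * r + x)%N) ->
       cmem s' 15 z = cmem s 15 z)).
Proof.
move=> hs hc h8.
pose Q (i : 'I_m) (j : 'I_n) (s' : state R) :=
    (forall x : 'I_r, cmem s' 15 (a * r + x)%N
       = cmem s 15 (a * r + x)%N + (N%:R^-1)%:C * est (i, j) x 0) /\
    (forall z, (forall x : 'I_r, z != (a * r + x)%N) ->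
       cmem s' 15 z = cmem s 15 z).
suff H : rnd E [:: one_sample M] s (entry_law A)
     (r * (tau + 100) + 5 * tau + 150) (fun p => Q p.1 p.2).
  by apply: (rnd_conseq H) => // -[i j].
apply: (@rnd_seq _ E _ _ s 'I_m 'I_n (row_law A)
   (fun i j => normc (A i j) ^+ 2 / fnorm (row i A) ^+ 2)
   (tau + 5) (r * (tau + 100) + 4 * tau + 140) _
  (fun (i : 'I_m) s2 => s2 = nset s 11 0 i) Q).
- apply: (@rnd_sampleRow _ E) => //=; last by lia.
  exact: row_law_sum1.
(* A row that is drawn is nonzero, so its entries have a length-square law. *)
- move=> i s1 /row_law_neq0 hi _ ->.
  apply: (@det_seq_rnd _ _ _ _ _ _ _ (tau + 5) (r * (tau + 100) + 3 * tau + 130) _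
    (fun (j : 'I_n) s2 => s2 = nset (nset s 11 0 i) 12 0 j)).
  + apply: (@rnd_sampleCol _ E _ _ _ i) => //=; last by lia.
    exact: row_entries_sum1.
  + move=> j s2 _ _ ->.
    apply: (@seq_queryB _ E _ _ _ _ _ _ i _ _ (r * (tau + 100) + 2 * tau + 120)) => //;
      last by rewrite /=; lia.
    apply: (@seq_queryA _ E _ _ _ _ _ _ _ i j _ _ (r * (tau + 100) + 80)) => //;
      last by rewrite /=; lia.
    set s4 := cset _ 13 _ _.
    apply: (seq_cset (tb2 := r * (tau + 100) + 15)); last by rewrite /=; lia.
    set s5 := cset s4 _ _ _.
    have hv : ceval s4 (estimate_coef M)
        = (N%:R^-1)%:C * ((F ^+ 2)%:C * b i 0 / A i j).
      rewrite /s4 /estimate_coef; rd; rewrite hc; case: hs => _ _ -> _.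
      congr (_ * _); first by rewrite fmorphV rmorph_nat.
      by rewrite expr2 [in RHS]rmorphM.
    have hs5 : has_rows A ii s5 by case: hs.
    apply: (rnd_conseq (@add_sample_spec s5 a j _ hs5 _ _ _)) => //.
    move=> _ s6 _ _ [j1 j2]; split=> //; move=> x.
    rewrite j1; congr (_ + _).
    have -> : cmem s5 14 0 = ceval s4 (estimate_coef M) by [].
    by rewrite hv -mulrA estimateE.
  + by lia.
- by move=> i j; rewrite divr_ge0 ?sqr_ge0.
- by move=> i /row_law_neq0 hi; apply: row_entries_sum1.
- by lia.
Qed.

Lemma batch_mean_rcons h p x :
  batch_mean A b RR N (rcons h p) x 0
  = batch_mean A b RR N h x 0 + (N%:R^-1)%:C * est p x 0.
Proof.
by rewrite /batch_mean -cats1 big_cat big_seq1 scalerDr !mxE.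
Qed.

Lemma estimate_batches_spec s :
  has_rows A ii s -> nmem s 5 0 = c -> (forall z, cmem s 15 z = 0) ->
  rnd E [:: estimate_batches M] s (@iid _ _ (@iid _ _ (entry_law A) N) r)
    (r * (N * (r * (tau + 100) + 5 * tau + 200) + 40) + 20)
    (fun g s' => forall a x : 'I_r,
       cmem s' 15 (a * r + x)%N = batch_mean A b RR N (tnth g a) x 0).
Proof.
move=> hs hc h15.
pose Inv (h : seq (N.-tuple ('I_m * 'I_n))) (s' : state R) :=
  forall a x : 'I_r, cmem s' 15 (a * r + x)%N
    = if (a < size h)%N then batch_mean A b RR N (nth [::] (map val h) a) x 0
      else 0.
suff H : rnd E [:: estimate_batches M] s (@iid _ _ (@iid _ _ (entry_law A) N) r)
    (r * (N * (r * (tau + 100) + 5 * tau + 200) + 40) + 20) (fun g => Inv g).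
  apply: (rnd_conseq H) => // g s' _ _ hg a x.
  by rewrite hg size_tuple ltn_ord nth_mapE.
have hw p : 0 <= entry_law A p by apply: entry_law_ge0.
have hw1 := entry_law_sum1 hA.
apply: (@rnd_for _ _ _ _ _ _ _ (N * (r * (tau + 100) + 5 * tau + 200) + 20) _ r Inv).
- by move=> g; apply: iid_ge0.
- exact: iid_sum1.
- by [].
- by move=> s' hf; rewrite /= hf.1 //; case: hs.
- by move=> a x; rewrite /= h15.
- move=> h s' hh hf h8 hi.
  have hs' : has_rows A ii s' by apply: has_rows_frame hf hs.
  have hc' : nmem s' 5 0 = c by rewrite hf.1.
  pose a := Ordinal hh.
  pose Inv2 (h2 : seq ('I_m * 'I_n)) (s2 : state R) :=
    (forall x : 'I_r, cmem s2 15 (a * r + x)%N = batch_mean A b RR N h2 x 0) /\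
    (forall z, (forall x : 'I_r, z != (a * r + x)%N) ->
       cmem s2 15 z = cmem s' 15 z).
  suff H : rnd E [:: For 10 (NMul (NLit M) (nv 5)) (one_sample M)] s'
      (@iid _ _ (entry_law A) N) (N * (r * (tau + 100) + 5 * tau + 200) + 20)
      (fun g => Inv2 g).
    apply: (rnd_conseq H) => // g s2 _ hf2 [j1 j2] a' x.
    rewrite size_rcons map_rcons nth_rcons size_map; rd.
    case: (ltngtP a' (size h)) => haa.
    + rewrite ltnS (ltnW haa) j2; last first.
        by move=> x'; rewrite cell_inj // negb_and neq_ltn haa.
      by rewrite hi haa.
    + rewrite ltnNge -ltnS ltnS haa /= j2; last first.
        by move=> x'; rewrite cell_inj // negb_and neq_ltn haa orbT.
      by rewrite hi ltnNge (ltnW haa).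
    + by rewrite haa ltnSn -(j1 x).
  apply: (@rnd_for _ _ _ _ _ _ _ (r * (tau + 100) + 5 * tau + 150) _ N Inv2) => //.
  + by move=> s2 hf2; rewrite /= hf2.1 // hc'.
  (* Row a of the table is still 0, the mean of the empty batch. *)
  + by split=> // x; rewrite [LHS](hi a x) ltnn /batch_mean big_nil scaler0 mxE.
  + move=> h2 s2 hh2 hf2 h10 [j1 j2].
    have hs2 : has_rows A ii s2 by apply: has_rows_frame hf2 hs'.
    have h8' : nmem s2 8 0 = a by rewrite hf2.1.
    have hc2 : nmem s2 5 0 = c by rewrite hf2.1.
    apply: (rnd_conseq (one_sample_spec hs2 hc2 h8')) => //.
    move=> p s3 _ _ [k1 k2]; split=> [x|z hz]; rd.
      by rewrite k1 j1 batch_mean_rcons.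
    by rewrite k2 // j2.
  + by rewrite /=; nia.
- by rewrite /=; lia.
Qed.

End Estimates.

Definition cell_s (a s : nat) : nexp := NAdd (NMul (nv a) (nv 1)) (nv s).

Definition distance_step : cmd :=
  CSet 16 (cell_s 8 10)
    (CAdd (CGet 16 (cell_s 8 10))
       (cabs2 (CAdd (CGet 15 (cell_s 8 13)) (COpp (CGet 15 (cell_s 10 13)))))).

(** Tabulated beforehand: recomputed for every candidate radius, the distances would make the
    selection cost r^4. *)
Definition distances : cmd :=
  For 8 (nv 1) (For 10 (nv 1)
    (Seq (CSet 16 (cell_s 8 10) (clit 0)) (For 13 (nv 1) distance_step))).

Definition count_closer : cmd :=
  For 13 (nv 1)
    (If (BCLt (CGet 16 (cell_s 8 10)) (CGet 16 (cell_s 8 13))) Skip (incr 15)).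

(** Tests offer only negation and conjunction, so the alternative between having no candidate yet
    and a smaller radius is written by De Morgan's law. *)
Definition is_better : bexp :=
  BAnd (BNLt (nv 1) (NMul (NLit 2) (nv 15)))
    (BNot (BAnd (BNot (BNLt (nv 14) (NLit 1)))
                (BNot (BCLt (CGet 16 (cell_s 8 10)) (cv 17))))).

(* Cell 0 of array 14 holds one plus the selected index, and 0 before any
   candidate has been found. *)
Definition select_batch : cmd :=
  For 8 (nv 1) (For 10 (nv 1)
    (Seq (NSet 15 (NLit 0) (NLit 0))
    (Seq count_closer
    (If is_better
       (Seq (NSet 14 (NLit 0) (NAdd (nv 8) (NLit 1)))
            (CSet 17 (NLit 0) (CGet 16 (cell_s 8 10))))
       Skip)))).

(** * Search for the smallest ball holding a majority *)

Section Selection.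
Variables (R : realType) (E : env R) (r : nat).
Local Notation C := R[i].
Variable Y : nat -> 'cV[C]_r.
Let D a b : R := fnorm (Y a - Y b) ^+ 2.

Lemma distances_spec s :
  nmem s 1 0 = r ->
  (forall a x : 'I_r, cmem s 15 (a * r + x)%N = Y a x 0) ->
  det E [:: distances] s (r * (r * (r * 110 + 60) + 60) + 20)
    (fun s' => forall a b : 'I_r, cmem s' 16 (a * r + b)%N = (D a b)%:C).
Proof.
move=> hr hY.
pose Inv1 a (s' : state R) := forall x y : 'I_r, (x < a)%N ->
  cmem s' 16 (x * r + y)%N = (D x y)%:C.
apply: (@rnd_conseq _ _ _ _ _ _ (r * (r * (r * 110 + 60) + 60) + 20) _ (fun _ => Inv1 r));
  last 2 first.
- exact: leqnn.
- by move=> _ s' _ _ h a b; apply: h.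
apply: (@det_for _ _ _ _ _ (r * (r * 110 + 60) + 20)) => //.
- by move=> s' hf; rewrite /= hf.1.
- move=> a s1 hf1 h8 hi1.
  have hr1 : nmem s1 1 0 = r by rewrite hf1.1.
  pose Inv2 b (s' : state R) :=
    (forall y : 'I_r, (y < b)%N -> cmem s' 16 (a * r + y)%N = (D a y)%:C) /\
    (forall z, (forall y : 'I_r, z != (a * r + y)%N) -> cmem s' 16 z = cmem s1 16 z).
  apply: (@rnd_conseq _ _ _ _ _ _ (r * (r * 110 + 60) + 20) _ (fun _ => Inv2 r));
    last 2 first.
  + exact: leqnn.
  + move=> _ s' _ _ [j1 j2] x y; rd; rewrite ltnS leq_eqVlt.
    case/orP => [/eqP/val_inj ->|hx]; first exact: j1.
    rewrite j2; first exact: hi1.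
    by move=> y'; rewrite cell_inj // negb_and neq_ltn hx.
  apply: (@det_for _ _ _ _ _ (r * 110 + 40)) => //.
  + by move=> s' hf; rewrite /= hf.1.
  + move=> b s2 hf2 h10 [j1 j2].
    have hr2 : nmem s2 1 0 = r by rewrite hf2.1.
    have h8' : nmem s2 8 0 = a by rewrite hf2.1.
    apply: (seq_cset (tb2 := r * 110 + 20)); last by rewrite /=; lia.
    rewrite [neval _ _]/= h8' h10 hr2.
    set s3 := cset s2 _ _ _.
    pose Inv3 x (s' : state R) :=
      cmem s' 16 (a * r + b)%N
        = (\sum_(y < r | (y < x)%N) normc ((Y a - Y b) y 0) ^+ 2)%:C /\
      (forall z, z != (a * r + b)%N -> cmem s' 16 z = cmem s2 16 z).
    apply: (@rnd_conseq _ _ _ _ _ _ (r * 110 + 20) _ (fun _ => Inv3 r)); last 2 first.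
    * exact: leqnn.
    * move=> _ s' _ _ [k1 k2]; split=> [y|z hz]; rd.
        rewrite ltnS leq_eqVlt => /orP[/eqP/val_inj ->|hy].
          rewrite k1 sum_ltn_all /D fnorm_sqE; congr (_%:C).
          by apply: eq_bigr => y' _; rewrite big_ord1.
        by rewrite k2 ?j1 // cell_inj // negb_and [X in _ || X]neq_ltn hy orbT.
      by rewrite k2 ?j2.
    apply: (@det_for _ _ _ _ _ 90) => //.
    * by move=> s' hf; rewrite /= hf.1.
    * split; first by rewrite sum_ltn0 /s3; rd; rewrite eqxx.
      by move=> z hz; rewrite /s3; rd; rewrite (negbTE hz).
    * move=> x s' hf h13 [k1 k2].
      have hr' : nmem s' 1 0 = r by rewrite hf.1.
      have h8s : nmem s' 8 0 = a by rewrite hf.1.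
      have h10s : nmem s' 10 0 = b by rewrite hf.1.
      have hYs (a' x' : 'I_r) : cmem s' 15 (a' * r + x')%N = Y a' x' 0.
        by rewrite hf.2 // /s3; rd; rewrite hf2.2 // hf1.2.
      apply: det_cset => //.
      have -> : neval s' (cell_s 8 10) = (a * r + b)%N by rewrite /= h8s h10s hr'.
      split; rd; last by move=> z hz; rewrite (negbTE hz) k2.
      rewrite eqxx sum_ltnS rmorphD /= h8s h10s hr' k1; congr (_ + _).
      rewrite h13 !hYs -[RHS]conj_mul_normc !mxE //.
    * by rewrite /=; lia.
  + by rewrite /=; lia.
- by rewrite /=; lia.
Qed.

Let ok a b := (r < 2 * count (fun b' => D a b' <= D a b)%R (iota 0 r))%N.

(** [Pr] describes the pairs examined so far; the loops let it grow in lexicographic order. *)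
Definition selection_state (Pr : nat -> nat -> Prop) (s : state R) : Prop :=
  (nmem s 14 0 = 0%N /\
     forall x y, (x < r)%N -> (y < r)%N -> Pr x y -> ~~ ok x y) \/
  (exists p y, [/\ nmem s 14 0 = p.+1, (p < r)%N, (y < r)%N, ok p y &
     cmem s 17 0 = (D p y)%:C /\
     forall x z, (x < r)%N -> (z < r)%N -> Pr x z -> ok x z -> D p y <= D x z]).

Lemma selection_state_ext (Pr Pr' : nat -> nat -> Prop) s s' :
  (forall x y, (x < r)%N -> (y < r)%N -> Pr' x y -> Pr x y) ->
  nmem s' 14 0 = nmem s 14 0 -> cmem s' 17 0 = cmem s 17 0 ->
  selection_state Pr s -> selection_state Pr' s'.
Proof.
move=> h h1 h2 [[k1 k2]|[p [y [k1 k2 k3 k4 [k5 k6]]]]]; [left|right].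
  by rewrite h1; split=> // *; apply: k2 => //; apply: h.
exists p, y; rewrite h1 h2; split=> //; split=> // *; apply: k6 => //.
exact: h.
Qed.

(** The ball around point 0 through the point farthest from it contains all points, so the search
    cannot end without a candidate. *)
Lemma exists_ok : (0 < r)%N -> exists a b, [/\ (a < r)%N, (b < r)%N & ok a b].
Proof.
move=> r0; pose i0 := Ordinal r0.
case: (arg_maxP (fun b : 'I_r => D 0 b) (isT : xpredT i0)) => b _ hb.
exists 0%N, b; split=> //; rewrite /ok (_ : count _ _ = r); last first.
  rewrite -[RHS](size_iota 0); apply/eqP; rewrite -all_count; apply/allP => z.
  rewrite mem_iota add0n => /= hz; exact: (hb (Ordinal hz)).
lia.
Qed.

Lemma select_batch_spec s :
  (0 < r)%N -> nmem s 1 0 = r -> nmem s 14 0 = 0%N ->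
  (forall a b : 'I_r, cmem s 16 (a * r + b)%N = (D a b)%:C) ->
  det E [:: select_batch] s (r * (r * (r * 70 + 200) + 60) + 20)
    (fun s' => exists p, nmem s' 14 0 = p.+1 /\ selected Y r p).
Proof.
move=> r0 hr h14 hD.
apply: (@rnd_conseq _ _ _ _ _ _ (r * (r * (r * 70 + 200) + 60) + 20) _
  (fun _ => selection_state (fun x _ => x < r)%N)); last 2 first.
- exact: leqnn.
- move=> _ s' _ _ [[_ k]|[p [y [k1 k2 k3 k4 [k5 k6]]]]].
    have [a [b [ha hb hab]]] := exists_ok r0.
    by have := k a b ha hb ha; rewrite hab.
  exists p; split=> //; split=> //; exists (D p y); split=> // a b ha hb hab.
  exact: k6.
apply: (@det_for _ _ _ _ _ (r * (r * 70 + 200) + 20) _ _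
  (fun a => selection_state (fun x _ => x < a)%N)) => //.
- by move=> s' hf; rewrite /= hf.1.
- by left.
- move=> a s1 hf1 h8 hi1.
  have hr1 : nmem s1 1 0 = r by rewrite hf1.1.
  apply: (@rnd_conseq _ _ _ _ _ _ (r * (r * 70 + 200) + 20) _
     (fun _ => selection_state (fun x y => (x < a) || (x == a) && (y < r))%N));
    last 2 first.
  + exact: leqnn.
  + move=> _ s' _ _; apply: selection_state_ext => // x y hx hy.
    by rewrite ltnS leq_eqVlt hy andbT orbC.
  apply: (@det_for _ _ _ _ _ (r * 70 + 170) _ _
     (fun b => selection_state (fun x y => (x < a) || (x == a) && (y < b))%N)) => //.
  + by move=> s' hf; rewrite /= hf.1.
  + apply: selection_state_ext hi1 => // x y _ _; by rewrite ltn0 andbF orbF.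
  + move=> b s2 hf2 h10 hi2.
    have hr2 : nmem s2 1 0 = r by rewrite hf2.1.
    have h8' : nmem s2 8 0 = a by rewrite hf2.1.
    apply: (seq_nset (tb2 := r * 70 + 150)); last by rewrite /=; lia.
    set s3 := nset s2 _ _ _.
    have hDs3 (x y : 'I_r) : cmem s3 16 (x * r + y)%N = (D x y)%:C.
      by rewrite /s3; rd; rewrite hf2.2 // hf1.2.
    pose Inv3 k (s' : state R) :=
      nmem s' 15 0 = count (fun b' => D a b' <= D a b)%R (iota 0 k).
    apply: (@rnd_seq_det _ _ _ _ _ _ _ (r * 70 + 20) 110 _ (Inv3 r)).
    * apply: (@det_for _ _ _ _ _ 40) => //.
      - by move=> s' hf; rewrite /= hf.1.
      - move=> x s' hf h13 k1.
        have hr' : nmem s' 1 0 = r by rewrite hf.1.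
        have h8s : nmem s' 8 0 = a by rewrite hf.1.
        have h10s : nmem s' 10 0 = b by rewrite hf.1.
        have hlt : beval s' (BCLt (CGet 16 (cell_s 8 10)) (CGet 16 (cell_s 8 13)))
            = (D a b < D a x).
          by rewrite /= h8s h10s h13 hr' !hf.2 // !hDs3.
        have hcount : count (fun b' => D a b' <= D a b)%R (iota 0 x.+1)
            = (nmem s' 15 0 + ~~ (D a b < D a x)%R)%N.
          by rewrite -addn1 iotaD count_cat k1 /= add0n addn0 -leNgt.
        apply: (@det_if _ _ _ _ _ _ 10); first by [].
        + rewrite hlt => hh; apply: det_skip => //.
          by rewrite /Inv3 hcount hh addn0.
        + rewrite hlt => hh; apply: det_nset => //.
          by rewrite /Inv3 hcount hh.
      - by rewrite /=; lia.
    * move=> s4 hf4 k1.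
      have hr4 : nmem s4 1 0 = r by rewrite hf4.1.
      have h8s : nmem s4 8 0 = a by rewrite hf4.1.
      have h10s : nmem s4 10 0 = b by rewrite hf4.1.
      have h14s : nmem s4 14 0 = nmem s2 14 0 by rewrite hf4.1.
      have h17s : cmem s4 17 0 = cmem s2 17 0 by rewrite hf4.2.
      have hDab : cmem s4 16 (neval s4 (cell_s 8 10)) = (D a b)%:C.
        by rewrite /= h8s h10s hr4 hf4.2 // hDs3.
      have hsel := selection_state_ext (fun x y _ _ h => h) h14s h17s hi2.
      have hb : beval s4 is_better = ok a b && ((nmem s4 14 0 < 1)%N ||
          (D a b < complex.Re (cmem s4 17 0))).
        rewrite /is_better /ok -k1; cbn [beval neval ceval nv cv].
        by rewrite hr4 hDab negb_and !negbK.
      apply: (@det_if _ _ _ _ _ _ 60); first by [].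
      - rewrite hb => /andP[hab hbest].
        apply: (seq_nset (tb2 := 15)); last by [].
        apply: det_cset; first by [].
        right; exists a, b; rd; split=> //.
          by rewrite h8s addn1.
        split.
          by move: hDab; rewrite /= => ->.
        move=> x z hx hz; rewrite ltnS.
        case/orP => [hxa|/andP[/eqP -> ]].
          case: hsel => [[k2 k3]|[p [y [k2 k3 k4 k5 [k6 k7]]]]] hxz.
            by have := k3 x z hx hz; rewrite hxa hxz => /(_ isT).
          move: hbest; rewrite k2 /= k6 /= => hlt.
          by apply: (le_trans (ltW hlt)); apply: k7 => //; rewrite hxa.
        rewrite leq_eqVlt => /orP[/eqP -> //|hzb] hxz.
        case: hsel => [[k2 k3]|[p [y [k2 k3 k4 k5 [k6 k7]]]]].
          by have := k3 a z (ltn_ord a) hz; rewrite eqxx hzb orbT hxz => /(_ isT).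
        move: hbest; rewrite k2 /= k6 /= => hlt.
        by apply: (le_trans (ltW hlt)); apply: k7; rewrite ?eqxx ?hzb ?orbT.
      - rewrite hb => hnb; apply: det_skip => //.
        case: hsel => [[k2 k3]|[p [y [k2 k3 k4 k5 [k6 k7]]]]]; [left|right].
          split; first by rd.
          move=> x z hx hz /orP[hxa|/andP[/eqP -> ]].
            by apply: k3; rewrite // hxa.
          rewrite ltnS leq_eqVlt => /orP[/eqP ->|hzb].
            by move: hnb; rewrite k2 /= andbT.
          by apply: k3; rewrite // eqxx hzb orbT.
        exists p, y; rd; split=> //; split=> // x z hx hz.
        case/orP => [hxa|/andP[/eqP -> ]].
          by apply: k7; rewrite // hxa.
        rewrite ltnS leq_eqVlt => /orP[/eqP ->|hzb] hxz.
          by move: hnb; rewrite hxz k2 k6 /= -leNgt.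
        by apply: k7; rewrite // eqxx hzb orbT.
    * by lia.
  + by rewrite /=; lia.
- by rewrite /=; lia.
Qed.

End Selection.

Definition u_cell : cexp := CGet 10 (NAdd (NMul (nv 10) (nv 6)) (nv 8)).
Definition y_cell : cexp := CGet 15 (NAdd (NMul (NSub (nv 14) (NLit 1)) (nv 1)) (nv 10)).

Definition solution_term : cmd :=
  Seq (CSet 18 (NLit 0) (clit 0))
  (Seq (For 10 (nv 1)
          (CSet 18 (NLit 0) (CAdd (cv 18) (CMul (CConj u_cell) y_cell))))
  (Seq (CSet 18 (NLit 0) (cdiv (cv 18) (cpow (CGet 11 (nv 8)) 4)))
       (For 10 (nv 1)
          (CSet 1 (nv 10) (CAdd (CGet 1 (nv 10)) (CMul (cv 18) u_cell)))))).

(** With truncated subtraction x - (x - y) is the minimum of x and y: array 6 receives the minimum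
    of r and c, array 7 that of k, r and c. *)
Definition compute_solution : cmd :=
  Seq (NSet 6 (NLit 0) (NSub (nv 1) (NSub (nv 1) (nv 5))))
  (Seq (NSet 7 (NLit 0) (NSub (NGet 0 (NLit 2)) (NSub (NGet 0 (NLit 2)) (nv 6))))
       (For 8 (nv 7) solution_term)).

Section Solution.
Variables (R : realType) (E : env R) (r c k : nat).
Local Notation C := R[i].
Local Notation l := (minn r c).
Variables (U : 'M[C]_(r, l)) (sg : 'rV[R]_l) (yh : 'cV[C]_r).

Lemma compute_solution_spec s p :
  nmem s 1 0 = r -> nmem s 5 0 = c -> nmem s 0 2 = k -> nmem s 14 0 = p.+1 ->
  (forall (x : 'I_r) (y : 'I_l), cmem s 10 (x * l + y)%N = U x y) ->
  (forall y : 'I_l, cmem s 11 y = (sg 0 y)%:C) ->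
  (forall x : 'I_r, cmem s 15 (p * r + x)%N = yh x 0) ->
  (forall x, cmem s 1 x = 0) ->
  det E [:: compute_solution] s (r * (r * 150 + 150) + 60)
    (fun s' => forall x : 'I_r,
       cmem s' 1 x = regression_vector U sg k yh x 0).
Proof.
move=> hr hc hk h14 hU hsg hy h1.
apply: (seq_nset (tb2 := r * (r * 150 + 150) + 45)); last by rewrite /=; lia.
apply: (seq_nset (tb2 := r * (r * 150 + 150) + 25)); last by rewrite /=; lia.
set s1 := nset _ 7 _ _.
have h6 : nmem s1 6 0 = l by rewrite /s1; rd; rewrite hr hc minnE.
have h7 : nmem s1 7 0 = minn k l by rewrite /s1; rd; rewrite hk hr hc -!minnE.
have hr1 : nmem s1 1 0 = r by [].
have h14' : nmem s1 14 0 = p.+1 by [].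
have hU1 (x : 'I_r) (y : 'I_l) : cmem s1 10 (x * l + y)%N = U x y by apply: hU.
have hsg1 (y : 'I_l) : cmem s1 11 y = (sg 0 y)%:C by apply: hsg.
have hy1 (x : 'I_r) : cmem s1 15 (p * r + x)%N = yh x 0 by apply: hy.
have h11 x : cmem s1 1 x = 0 by apply: h1.
move: s1 h6 h7 hr1 h14' hU1 hsg1 hy1 h11 => s1 h6 h7 hr1 h14' hU1 hsg1 hy1 h11.
clear s hr hc hk h14 hU hsg hy h1.
pose term (i : 'I_l) (x : 'I_r) : C :=
  (U ^t* *m yh) i 0 / (sg 0 i ^+ 4)%:C * U x i.
pose Inv a (s' : state R) := forall x : 'I_r,
  cmem s' 1 x = \sum_(i < l | (i < a)%N) term i x.
apply: (@rnd_conseq _ _ _ _ _ _ (minn k l * (r * 150 + 120) + 15) _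
  (fun _ => Inv (minn k l))); last 2 first.
- have hl : (minn k l <= r)%N by rewrite (leq_trans (geq_minr _ _)) // geq_minl.
  nia.
- move=> _ s' _ _ hi x; rewrite hi /regression_vector summxE.
  apply: eq_big => [i|i _]; last by rewrite [RHS]mxE [col _ _ _ _]mxE.
  by rewrite leq_min ltn_ord andbT.
apply: (@det_for _ _ _ _ _ (r * 150 + 100)) => //.
- by move=> s' hf; rewrite /= hf.1.
- by move=> x; rewrite sum_ltn0; apply: h11.
- move=> i' s2 hf2 h8' hi.
  pose i := widen_ord (geq_minr k l) i'.
  have h8 : nmem s2 8 0 = i by [].
  have hi' : forall x : 'I_r, cmem s2 1 x = \sum_(j < l | (j < i)%N) term j x.
    exact: hi.
  suff H : det E [:: solution_term] s2 (r * 150 + 100)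
     (fun s' => forall x : 'I_r, cmem s' 1 x = cmem s2 1 x + term i x).
    apply: (rnd_conseq H) => // _ s' _ _ hs x.
    by rewrite [LHS]hs hi' (@sum_ltnS _ _ _ i).
  have h62 : nmem s2 6 0 = l by rewrite hf2.1.
  have hr2 : nmem s2 1 0 = r by rewrite hf2.1.
  apply: (seq_cset (tb2 := r * 150 + 80)); last by rewrite /=; lia.
  set s3 := cset s2 _ _ _.
  pose Inv3 a (s' : state R) :=
    cmem s' 18 0 = \sum_(x < r | (x < a)%N) Num.conj (U x i) * yh x 0.
  have hu (x : 'I_r) s' : nmem s' 10 0 = x -> nmem s' 6 0 = l -> nmem s' 8 0 = i ->
      (forall z, cmem s' 10 z = cmem s1 10 z) -> ceval s' u_cell = U x i.
    by move=> q1 q2 q3 q4; rewrite /= q1 q2 q3 q4 hU1.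
  apply: (@rnd_seq_det _ _ _ _ _ _ _ (r * 60 + 15) (r * 60 + 60) _ (Inv3 r)).
  + apply: (@det_for _ _ _ _ _ 45) => //.
    * by move=> s' hf; rewrite /= hf.1.
    * by rewrite /Inv3 sum_ltn0.
    * move=> x s' hf h10 k1; apply: det_cset => //.
      have hux : ceval s' u_cell = U x i.
        apply: hu => //; rewrite ?hf.1 // => z.
        by rewrite hf.2 // /s3; rd; rewrite hf2.2.
      have hyx : ceval s' y_cell = yh x 0.
        rewrite /= h10 !hf.1 // [nmem s3 14 0]/= [nmem s3 1 0]/= hf2.1 // h14' subn1.
        by rewrite hf.2 // hr2 /s3; rd; rewrite hf2.2.
      rewrite /Inv3 sum_ltnS -k1 -hux -hyx; rd.
      by rewrite conjCE.
    * by rewrite /=; lia.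
  + move=> s4 hf4; rewrite /Inv3 sum_ltn_all => k1.
    have h84 : nmem s4 8 0 = i by rewrite hf4.1.
    have hsg4 : cmem s4 11 i = (sg 0 i)%:C.
      by rewrite hf4.2 // /s3; rd; rewrite hf2.2.
    apply: (seq_cset (tb2 := r * 60 + 15)); last by rewrite /=; lia.
    set s5 := cset s4 _ _ _.
    have h185 : cmem s5 18 0 = (U ^t* *m yh) i 0 / (sg 0 i ^+ 4)%:C.
      rewrite /s5; rd; rewrite ceval_cpow; rd; rewrite h84 hsg4 k1 mxE rmorphXn /=.
      by congr (_ / _); apply: eq_bigr => x _; rewrite !mxE.
    pose Inv5 a (s' : state R) := forall x : 'I_r, cmem s' 1 x
       = cmem s2 1 x + (if (x < a)%N then term i x else 0).
    apply: (@rnd_conseq _ _ _ _ _ _ (r * 60 + 15) _ (fun _ => Inv5 r)) => //;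
      last by move=> _ s' _ _ hs x; rewrite hs ltn_ord.
    apply: (@det_for _ _ _ _ _ 40) => //.
    * by move=> s' hf; rewrite /= hf.1 // /s5; rd; rewrite hf4.1.
    * move=> x; rewrite ltn0 addr0 /s5; rd; rewrite hf4.2 // /s3; by rd.
    * move=> x s' hf h10 hi5; apply: det_cset => //.
      have hux : ceval s' u_cell = U x i.
        apply: hu => //.
        - by rewrite hf.1 // /s5; rd; rewrite hf4.1.
        - by rewrite hf.1 // /s5; rd; rewrite hf4.1.
        - by move=> z; rewrite hf.2 // /s5; rd; rewrite hf4.2 // /s3; rd; rewrite hf2.2.
      move=> z; rewrite ltnS.
      have -> : ceval s' (CAdd (CGet 1 (nv 10)) (CMul (cv 18) u_cell))
          = cmem s2 1 x + term i x.
        cbn [ceval neval nv cv]; rewrite hux h10 hi5 ltnn addr0; congr (_ + _).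
        by rewrite hf.2 // h185.
      rd; rewrite h10.
      by case: (ltngtP z x) (hi5 z) => [h|h|/val_inj ->].
    * by rewrite /=; lia.
  + by lia.
- by rewrite /=; nia.
Qed.

End Solution.

(* Each of the r batches consists of [M * c] samples. *)
Definition regression_program (M : nat) : cmd :=
  Seq compute_sizes
  (Seq sample_rows
  (Seq sample_cols
  (Seq build_sketch
  (Seq (estimate_batches M)
  (Seq distances
  (Seq select_batch compute_solution)))))).

Lemma iid_neq0 (R : realType) (W : finType) (w : W -> R) n (g : n.-tuple W) :
  iid w g != 0 -> forall x, w (tnth g x) != 0.
Proof.
rewrite /iid big_tuple => h x; apply: contra h => /eqP h.
by rewrite (bigD1 x) //= h mul0r.
Qed.

Section Program.
Variable R : realType.
Local Notation C := R[i].
Variables (m n k : nat) (A : 'M[C]_(m, n)) (b : 'cV[C]_m) (kappa eps eta : R)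
  (svd : svd_routine R) (tau M : nat).
Local Notation E := (Env A b svd tau).
Local Notation F := (fnorm A).
Hypothesis hA : A != 0.
Local Notation r := (nrows n k F kappa eps eta).
Local Notation c := (ncols r k F kappa eps eta).
Local Notation N := (M * c)%N.
Hypotheses (hr : 0 < rows_real k A kappa eps eta)
  (hc : 0 < cols_real k A kappa eps eta r) (hM : (0 < M)%N).

Lemma natceil_gt0 (x : R) : 0 < x -> (0 < natceil x)%N.
Proof. by move=> h; rewrite -natceilP ?(ltW h). Qed.

Lemma r_gt0 : (0 < r)%N. Proof. exact: natceil_gt0. Qed.
Lemma c_gt0 : (0 < c)%N. Proof. exact: natceil_gt0. Qed.

Definition rows_of q (g : q.-tuple 'I_m) : {ffun 'I_q -> 'I_m} :=
  [ffun x => tnth g x].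
Definition cols_of q p (g : q.-tuple ('I_p * 'I_n)) : {ffun 'I_q -> 'I_n} :=
  [ffun x => (tnth g x).2].

Definition batches q (RR : 'M[C]_(q, n)) r' N' (g : r'.-tuple (N'.-tuple ('I_m * 'I_n)))
    (a : nat) : 'cV[C]_q :=
  batch_mean A b RR N' (nth [::] (map val g) a).

Local Notation outcome :=
  (r.-tuple 'I_m * (c.-tuple ('I_r * 'I_n) * r.-tuple (N.-tuple ('I_m * 'I_n))))%type.

Definition outcome_law (o : outcome) : R :=
  iid (row_law A) o.1 *
  (iid (col_law A (rows_of o.1)) o.2.1 * iid (@iid _ _ (entry_law A) N) o.2.2).

Definition final_state (o : outcome) (s : state R) : Prop :=
  let ii := rows_of o.1 in let jj := cols_of o.2.1 in
  let RR := row_sketch A ii in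
  let CC := col_sketch F RR jj in
  stores_indices s ii jj /\
  exists p, selected (batches RR o.2.2) r p /\
    stores_vector s (regression_vector (svd CC).1 (svd CC).2 k
                       (batches RR o.2.2 p)).

(** r^2 c covers both the decomposition and the r batches of M c samples at r queries each; r^3
    covers the distances and the selection. This is a worst case, not a mean. *)
Definition running_time : nat :=
  (5000 * (tau + 1) * M * (r * r * c + r * r * r))%N.

Lemma rows_neq0 q (g : q.-tuple 'I_m) : iid (row_law A) g != 0 ->
  forall x, row (rows_of g x) A != 0.
Proof.
by move=> h x; rewrite ffunE; apply: row_law_neq0; apply: iid_neq0 h x.
Qed.

Lemma time_le (r' c' l : nat) : (0 < r')%N -> (0 < c')%N -> (l <= r')%N ->
  (2000 + tau + 15 * (r' + c') + ((r' * (2 * tau + 40) + 10) +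
    ((c' * (tau + 40) + 10) + ((c' * (r' * (tau + 300) + 100) + r' * c' * l + 40) +
    ((r' * (M * c' * (r' * (tau + 100) + 5 * tau + 200) + 40) + 20) +
    ((r' * (r' * (r' * 110 + 60) + 60) + 20) +
    ((r' * (r' * (r' * 70 + 200) + 60) + 20) +
     (r' * (r' * 150 + 150) + 60))))))) + 20
   <= 5000 * (tau + 1) * M * (r' * r' * c' + r' * r' * r'))%N.
Proof.
move=> r0 c0 hl.
(* Every monomial is padded with positive factors up to M r^2 c or M r^3, possibly times tau; what
   remains is linear in these products. *)
have up x y : (0 < y)%N -> (x <= x * y)%N by move=> h; apply: leq_pmulr.
have M0 := hM.
have Mr : (0 < M * r')%N by rewrite muln_gt0 hM.
have Mrr : (0 < M * r' * r')%N by rewrite muln_gt0 Mr.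
have Mrc : (0 < M * r' * c')%N by rewrite muln_gt0 Mr.
have Mrrc : (0 < M * r' * r' * c')%N by rewrite muln_gt0 Mrr.
have e1 := up 1%N _ Mrrc.
have e2 := up tau _ Mrrc.
have e3 := up r' _ Mrc.
have e4 := up (r' * tau)%N _ Mrc.
have e5 := up c' _ Mrr.
have e6 := up (c' * tau)%N _ Mrr.
have e7 := up (r' * c')%N _ Mr.
have e8 := up (r' * c' * tau)%N _ Mr.
have e9 := leq_mul (leqnn (r' * c')%N) hl.
have e10 := up (r' * r' * c')%N _ M0.
have e11 := up (r' * (M * c'))%N _ r0.
have e12 := up (r' * (M * c') * tau)%N _ r0.
have e13 := up (r' * r')%N _ Mr.
have e14 := up (r' * r' * r')%N _ M0.
move: e1 e2 e3 e4 e5 e6 e7 e8 e9 e10 e11 e12 e13 e14; clear; lia.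
Qed.

(** The remaining memory must start at 0: the counters for r and c, the batch means, the selected
    index and w are all accumulated from there. *)
Lemma program_spec s :
  has_inputs m n k kappa eps eta s ->
  (forall a, a != 0%N -> (forall x, nmem s a x = 0%N) /\ (forall x, cmem s a x = 0)) ->
  rnd E [:: regression_program M] s outcome_law running_time final_state.
Proof.
move=> hin h0.
have r0 := r_gt0; have c0 := c_gt0.
have hmin : (minn r c <= r)%N by rewrite geq_minl.
have htime := time_le r0 c0 hmin.
(* Each [T] is the time from its stage to the end, with one unit for every sequencing. *)
pose T8 := (r * (r * 150 + 150) + 60)%N.
pose T7 := (r * (r * (r * 70 + 200) + 60) + 20 + T8).+1.
pose T6 := (r * (r * (r * 110 + 60) + 60) + 20 + T7).+1.
pose T5 := (r * (N * (r * (tau + 100) + 5 * tau + 200) + 40) + 20 + T6).+1.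
pose T4 := (c * (r * (tau + 300) + 100) + r * c * minn r c + 40 + T5).+1.
pose T3 := (c * (tau + 40) + 10 + T4).+1.
pose T2 := (r * (2 * tau + 40) + 10 + T3).+1.
pose T1 := (2000 + tau + 15 * (r + c) + T2).+1.
have hT1 : (T1 <= running_time)%N.
  apply: leq_trans htime; rewrite /T1 /T2 /T3 /T4 /T5 /T6 /T7 /T8.
  move: (2000 + tau + 15 * (r + c))%N (r * (2 * tau + 40) + 10)%N
    (c * (tau + 40) + 10)%N (c * (r * (tau + 300) + 100) + r * c * minn r c + 40)%N
    (r * (N * (r * (tau + 100) + 5 * tau + 200) + 40) + 20)%N
    (r * (r * (r * 110 + 60) + 60) + 20)%N (r * (r * (r * 70 + 200) + 60) + 20)%N
    (r * (r * 150 + 150) + 60)%N.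
  clear; lia.
have hw2 (g1 : r.-tuple 'I_m)
      (o : c.-tuple ('I_r * 'I_n) * r.-tuple (N.-tuple ('I_m * 'I_n))) :
    0 <= iid (col_law A (rows_of g1)) o.1 * iid (@iid _ _ (entry_law A) N) o.2.
  apply: mulr_ge0; apply: iid_ge0 => x; first exact: col_law_ge0.
  by apply: iid_ge0 => y; apply: entry_law_ge0.
have hb1 : \sum_(g : N.-tuple ('I_m * 'I_n)) iid (entry_law A) g = 1.
  by apply: iid_sum1; apply: entry_law_sum1.
have hs1 (g1 : r.-tuple 'I_m) : iid (row_law A) g1 != 0 ->
    \sum_(o : c.-tuple ('I_r * 'I_n) * r.-tuple (N.-tuple ('I_m * 'I_n)))
       (iid (col_law A (rows_of g1)) o.1 * iid (@iid _ _ (entry_law A) N) o.2) = 1.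
  move=> hg1.
  rewrite -(pair_bigA _ (fun g2 g3 => iid (col_law A (rows_of g1)) g2 *
     iid (@iid _ _ (entry_law A) N) g3)) /=.
  under eq_bigr do rewrite -mulr_sumr iid_sum1 // mulr1.
  by apply: iid_sum1; apply: col_law_sum1 => //; apply: rows_neq0.
apply: (@rnd_conseq _ _ _ _ _ _ T1 _ final_state) => //.
apply: (@rnd_seq_det _ _ _ _ _ _ _ (2000 + tau + 15 * (r + c)) T2 _
   (fun s' => [/\ nmem s' 1 0 = r, nmem s' 5 0 = c & cmem s' 3 0 = F%:C])).
- apply: compute_sizes_spec => //; first by have [] := h0 1%N isT.
  + by have [] := h0 5 isT.
  + exact: ltW.
  + exact: ltW.
- move=> s1 hf1 [q1 q2 q3].
  suff H : rnd E [:: Seq sample_rows (Seq sample_cols (Seq build_sketch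
      (Seq (estimate_batches M) (Seq distances
        (Seq select_batch compute_solution)))))] s1 outcome_law T2
     (fun p => final_state (p.1, p.2)).
    by apply: (rnd_conseq H) => // -[o1 o2].
  apply: (@rnd_seq _ E _ _ s1 _ _ (@iid _ _ (row_law A) r)
    (fun g1 o => iid (col_law A (rows_of g1)) o.1 *
       iid (@iid _ _ (entry_law A) N) o.2)
    (r * (2 * tau + 40) + 10) T3 _ _ (fun g1 o => final_state (g1, o)));
    last 3 first.
  + exact: hw2.
  + exact: hs1.
  + exact: ltnSn.
  + exact: sample_rows_spec.
  move=> g1 s2 hg1 hf2 hrows.
  have hne := rows_neq0 hg1.
  have hrows2 : has_rows A (rows_of g1) s2.
    split.
    * by rewrite hf2.1.
    * by move=> x; rewrite ffunE; case: (hrows x).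
    * by rewrite hf2.2.
    * by move=> x; rewrite ffunE; case: (hrows x).
  have hc2 : nmem s2 5 0 = c by rewrite hf2.1.
  have hr2 : nmem s2 1 0 = r by rewrite hf2.1.
  suff H : rnd E [:: Seq sample_cols (Seq build_sketch
      (Seq (estimate_batches M) (Seq distances
        (Seq select_batch compute_solution))))] s2
     (fun p => iid (col_law A (rows_of g1)) p.1 *
       iid (@iid _ _ (entry_law A) N) p.2) T3
     (fun p => final_state (g1, (p.1, p.2))).
    by apply: (rnd_conseq H) => // -[o1 o2].
  apply: (@rnd_seq _ E _ _ s2 _ _ (@iid _ _ (col_law A (rows_of g1)) c)
    (fun _ g3 => iid (@iid _ _ (entry_law A) N) g3)
    (c * (tau + 40) + 10) T4 _ _ (fun g2 g3 => final_state (g1, (g2, g3))));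
    last 3 first.
  + by move=> _ g3; apply: iid_ge0 => x; apply: iid_ge0 => y; apply: entry_law_ge0.
  + by move=> g2 _; apply: iid_sum1.
  + exact: ltnSn.
  + apply: sample_cols_spec => //; last by case: hrows2.
  move=> g2 s3 hg2 hf3 hcols.
  have hrows3 : has_rows A (rows_of g1) s3 by apply: has_rows_frame hf3 hrows2.
  have hc3 : nmem s3 5 0 = c by rewrite hf3.1.
  have hcols3 (y : 'I_c) : nmem s3 3 y = cols_of g2 y by rewrite ffunE.
  have hB := build_sketch_spec b svd tau hrows3 hc3 hcols3.
  cbv zeta in hB; apply: (rnd_seq_det (tb2 := T5) hB); last first.
    exact: ltnSn.
  move=> s4 hf4 [hU hsg].
  have hrows4 : has_rows A (rows_of g1) s4 by apply: has_rows_frame hf4 hrows3.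
  have hc4 : nmem s4 5 0 = c by rewrite hf4.1.
  have h15 z : cmem s4 15 z = 0.
    by rewrite hf4.2 // hf3.2 // hf2.2 // hf1.2 //; have [_ ->] := h0 15 isT.
  apply: (det_seq_rnd (tb2 := T6)
     (estimate_batches_spec b svd tau hA M hrows4 hc4 h15)); last first.
    exact: ltnSn.
  move=> g3 s5 _ hf5 hY.
  set RR := row_sketch A (rows_of g1) in hY *.
  have hr5 : nmem s5 1 0 = r by rewrite hf5.1 // hf4.1 // hf3.1.
  have hY5 (a x : 'I_r) : cmem s5 15 (a * r + x)%N = batches RR g3 a x 0.
    by rewrite hY /batches nth_mapE.
  apply: (rnd_seq_det (tb2 := T7) (distances_spec E hr5 hY5)); last first.
    exact: ltnSn.
  move=> s6 hf6 hD.
  have hr6 : nmem s6 1 0 = r by rewrite hf6.1.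
  have h146 : nmem s6 14 0 = 0%N.
    rewrite hf6.1 // hf5.1 // hf4.1 // hf3.1 // hf2.1 // hf1.1 //.
    by have [->] := h0 14 isT.
  apply: (rnd_seq_det (tb2 := T8) (select_batch_spec E r0 hr6 h146 hD)); last first.
    exact: ltnSn.
  move=> s7 hf7 [p [h14 hsel]].
  have hpr : (p < r)%N by case: hsel.
  have hr7 : nmem s7 1 0 = r by rewrite hf7.1.
  have hc7 : nmem s7 5 0 = c by rewrite hf7.1 // hf6.1 // hf5.1.
  have hk7 : nmem s7 0 2 = k.
    rewrite hf7.1 // hf6.1 // hf5.1 // hf4.1 // hf3.1 // hf2.1 // hf1.1 //.
    by case: hin.
  have hU7 (x : 'I_r) (y : 'I_(minn r c)) : cmem s7 10 (x * minn r c + y)%N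
      = (svd (col_sketch F RR (cols_of g2))).1 x y.
    by rewrite hf7.2 // hf6.2 // hf5.2 // hU.
  have hsg7 (y : 'I_(minn r c)) : cmem s7 11 y
      = ((svd (col_sketch F RR (cols_of g2))).2 0 y)%:C.
    by rewrite hf7.2 // hf6.2 // hf5.2 // hsg.
  have hy7 (x : 'I_r) : cmem s7 15 (p * r + x)%N = batches RR g3 p x 0.
    by rewrite hf7.2 // hf6.2 // (hY5 (Ordinal hpr)).
  have h17 x : cmem s7 1 x = 0.
    rewrite hf7.2 // hf6.2 // hf5.2 // hf4.2 // hf3.2 // hf2.2 // hf1.2 //.
    by have [_ ->] := h0 1%N isT.
  apply: (rnd_conseq (compute_solution_spec E hr7 hc7 hk7 h14 hU7 hsg7 hy7 h17)).
    exact: ltnSn.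
  move=> _ s8 _ hf8 hw; split; last by exists p.
  split=> /=.
  + by rewrite hf8.1.
  + move=> x; rewrite hf8.1 // hf7.1 // hf6.1 // hf5.1 // hf4.1 // hf3.1 //.
    by case: hrows2.
  + by move=> y; rewrite hf8.1 // hf7.1 // hf6.1 // hf5.1 // hf4.1.
- exact: ltnSn.
Qed.

End Program.

(** * Queries and sampling *)

Definition load_norms : cmd :=
  Seq (QueryNorm 3 (NLit 0))
      (For 8 (nv 1) (QueryRowNorm 6 (nv 8) (NGet 2 (nv 8)))).

Definition add_column (a x : nat) : cmd :=
  For 13 (nv 1)
    (Seq (QueryA 8 (NLit 0) (NGet 2 (nv 13)) (NGet a (NLit x)))
    (Seq (CSet 2 (NLit 0)
           (CAdd (cv 2) (CMul (CConj (sketch_entry 13)) (CGet 1 (nv 13)))))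
    (Seq (CSet 7 (NLit 0) (CAdd (cv 7) (cabs2 (sketch_entry 13))))
         (CSet 14 (NLit 0) (CAdd (cv 14) (cabs2 (CGet 1 (nv 13)))))))).

(* Leaves entry j of the solution in cell 2, and |R_.j|^2 and |w|^2 in cells
   7 and 14, where j is cell [x] of array [a]. *)
Definition solution_column (a x : nat) : cmd :=
  Seq (CSet 2 (NLit 0) (clit 0))
  (Seq (CSet 7 (NLit 0) (clit 0))
  (Seq (CSet 14 (NLit 0) (clit 0)) (add_column a x))).

Definition query_program : cmd := Seq load_norms (solution_column 0 3).

Section Queries.
Variable R : realType.
Local Notation C := R[i].
Variables (m n : nat) (A : 'M[C]_(m, n)) (b : 'cV[C]_m)
  (svd : svd_routine R) (tau : nat).
Local Notation E := (Env A b svd tau).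
Local Notation F := (fnorm A).
Variables (r : nat) (ii : {ffun 'I_r -> 'I_m}) (w : 'cV[C]_r).
Local Notation RR := (row_sketch A ii).
Local Notation x := (approx_solution A ii w).

Lemma load_norms_spec s :
  nmem s 1 0 = r -> (forall y : 'I_r, nmem s 2 y = ii y) ->
  det E [:: load_norms] s (r * (tau + 30) + tau + 20) (has_rows A ii).
Proof.
move=> h1 h2.
apply: (@seq_queryNorm _ E _ _ _ _ _ _ _ (r * (tau + 25) + 10)); last first.
  by rewrite /=; lia.
pose Inv a (s' : state R) :=
  forall y : 'I_r, (y < a)%N -> cmem s' 6 y = (fnorm (row (ii y) A))%:C.
set s1 := cset _ _ _ _.
suff H : det E [:: For 8 (nv 1) (QueryRowNorm 6 (nv 8) (NGet 2 (nv 8)))] s1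
    (r * (tau + 25) + 10) (Inv r).
  apply: (rnd_conseq H) => // _ s' _ hf hi; split.
  - by rewrite hf.1.
  - by move=> y; rewrite hf.1 //; apply: h2.
  - by rewrite hf.2.
  - by move=> y; apply: hi.
apply: (@det_for _ _ _ _ _ (tau + 8)).
- by [].
- by move=> s' hf; rewrite /= hf.1.
- by [].
- move=> y s' hf h8 hi; apply: (@det_queryRowNorm _ E _ _ _ (ii y)); rd.
  + by rewrite h8 hf.1 //; apply: h2.
  + by rewrite /=; lia.
  + move=> z hz; rd; rewrite h8; case: (ltngtP z y) hz => [h _|h|h _].
    * exact: hi.
    * by rewrite ltnS leqNgt h.
    * by rewrite (val_inj h).
- by rewrite /=; lia.
Qed.

Definition column_state (j : 'I_n) (s : state R) : Prop :=
  [/\ cmem s 2 0 = x j 0, cmem s 7 0 = (fnorm (col j RR) ^+ 2)%:C &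
      cmem s 14 0 = (fnorm w ^+ 2)%:C].

Lemma solution_column_spec s a z (j : 'I_n) :
  has_rows A ii s -> stores_vector s w -> a != 13 -> nmem s a z = j ->
  det E [:: solution_column a z] s (r * (tau + 200) + 60) (column_state j).
Proof.
move=> hs hw ha hj.
apply: (seq_cset (tb2 := r * (tau + 200) + 50)); last by rewrite /=; lia.
apply: (seq_cset (tb2 := r * (tau + 200) + 40)); last by rewrite /=; lia.
apply: (seq_cset (tb2 := r * (tau + 200) + 30)); last by rewrite /=; lia.
set s1 := cset _ _ _ _.
have hs1 : has_rows A ii s1 by case: hs.
have hw1 : stores_vector s1 w by [].
pose Inv a (s' : state R) :=
  [/\ cmem s' 2 0 = \sum_(y < r | (y < a)%N) (RR y j)^* * w y 0,
      cmem s' 7 0 = (\sum_(y < r | (y < a)%N) normc (RR y j) ^+ 2)%:C &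
      cmem s' 14 0 = (\sum_(y < r | (y < a)%N) normc (w y 0) ^+ 2)%:C].
suff H : det E [:: add_column a z] s1
     (r * (tau + 200) + 30) (Inv r).
  apply: (rnd_conseq H) => // _ s' _ _ [i1 i2 i3]; split.
  - rewrite i1 sum_ltn_all /approx_solution [RHS]mxE.
    by apply: eq_bigr => y _; rewrite [_^t* _ _]mxE [_^T _ _]mxE.
  - rewrite i2 sum_ltn_all fnorm_sqE; congr (_%:C); apply: eq_bigr => y _.
    by rewrite big_ord1 [col _ _ _ _]mxE.
  - rewrite i3 sum_ltn_all fnorm_sqE; congr (_%:C); apply: eq_bigr => y _.
    by rewrite big_ord1.
apply: (@det_for _ _ _ _ _ (tau + 180)).
- by [].
- by move=> s' hf; rewrite /= hf.1 //; case: hs1.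
- by split; rewrite ?sum_ltn0.
- move=> y s' hf h13 [i1 i2 i3].
  have hs' : has_rows A ii s' by apply: has_rows_frame hf hs1.
  have hw' : cmem s' 1 y = w y 0 by rewrite hf.2 // hw1.
  apply: (@seq_queryA _ E _ _ _ _ _ _ _ (ii y) j _ _ 160); last 1 first.
    by rewrite /=; lia.
  + by rewrite /= h13; case: hs'.
  + rewrite [LHS]/= hf.1 ?hj //.
    by rewrite /= !inE (negbTE ha).
  set s2 := cset s' _ _ _.
  have hs2 : has_rows A ii s2 by case: hs'.
  apply: (seq_cset (tb2 := 100)); last by [].
  set v2 := ceval s2 _.
  have hv2 : v2 = \sum_(z < r | (z < y.+1)%N) (RR z j)^* * w z 0.
    rewrite sum_ltnS -i1 -hw' -(@ceval_sketch_entry _ _ _ A _ ii s2 13 y j) //.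
    by rewrite /v2 /= h13.
  set s3 := cset s2 _ _ _.
  have hs3 : has_rows A ii s3 by case: hs2.
  apply: (seq_cset (tb2 := 40)); last by [].
  set v3 := ceval s3 _.
  have hv3 : v3 = (\sum_(z < r | (z < y.+1)%N) normc (RR z j) ^+ 2)%:C.
    rewrite sum_ltnS rmorphD /= -i2 -(@ceval_sketch_entry _ _ _ A _ ii s3 13 y j) //.
    by rewrite -cabs2E.
  set s4 := cset s3 _ _ _.
  apply: det_cset => //.
  set v4 := ceval s4 _.
  have hv4 : v4 = (\sum_(z < r | (z < y.+1)%N) normc (w z 0) ^+ 2)%:C.
    rewrite sum_ltnS rmorphD /= -i3 -hw'.
    by rewrite -conj_mul_normc /v4 /= h13.
  by split; rewrite /s4 /s3 /s2; rd.
- by rewrite /=; lia.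
Qed.

Lemma query_program_spec s (j : 'I_n) :
  nmem s 1 0 = r -> (forall y : 'I_r, nmem s 2 y = ii y) ->
  stores_vector s w -> nmem s 0 3 = j ->
  det E [:: query_program] s (r * (2 * tau + 300) + tau + 100)
    (fun s' => cmem s' 2 0 = x j 0).
Proof.
move=> h1 h2 hw hj.
apply: (rnd_seq_det (tb2 := r * (tau + 200) + 60) (load_norms_spec h1 h2)).
  move=> s1 hf hs1.
  apply: (rnd_conseq (@solution_column_spec s1 0%N 3 j hs1 _ _ _)) => //.
  - by move=> y; rewrite hf.2.
  - by rewrite hf.1.
  - by move=> _ s' _ _ [].
lia.
Qed.

End Queries.

(** * Runs with an unbounded loop *)

Section Masses.
Variables (R : realType) (E : env R).

Lemma dist_mean (T : Type) (l : dist R T) (g : T -> R) :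
  all (fun o => 0 <= o.1) l -> (forall x, 0 <= g x <= 1) ->
  0 <= \sum_(o <- l) o.1 * g o.2 <= \sum_(o <- l) o.1.
Proof.
move=> + hg; elim: l => [|o l IH] /=; first by rewrite !big_nil lexx.
move=> /andP[ho /IH/andP[h1 h2]]; rewrite !big_cons.
have /andP[g0 g1] := hg o.2.
by rewrite addr_ge0 ?mulr_ge0 //= lerD // ler_piMr.
Qed.

Lemma big_enum_ord (q : nat) (f : 'I_q -> R) :
  \sum_(i <- enum 'I_q) f i = \sum_i f i.
Proof. by rewrite big_enum. Qed.

Lemma sum_quotient_le1 (I : finType) (f : I -> R) (F : R) :
  \sum_i f i = F -> \sum_i f i / F <= 1.
Proof.
move=> h; rewrite -mulr_suml h; have [->|F0] := eqVneq F 0.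
  by rewrite mul0r.
by rewrite divff.
Qed.

(** The mass may be less than 1: an undefined command has no outcome, and sampling from a zero
    vector gives only weights 0 / 0 = 0. *)
Lemma atomic_step_mass s c :
  all (fun o => 0 <= o.1) (atomic_step E s c) /\
  \sum_(o <- atomic_step E s c) o.1 <= 1.
Proof.
have hd s' : all (fun o => 0 <= o.1) (dirac1 R s') /\
    \sum_(o <- dirac1 R s') o.1 <= 1 :> R.
  by rewrite /= ler01 big_seq1 lexx.
have ho a x v : all (fun o => 0 <= o.1) (cset_opt s a x v) /\
    \sum_(o <- cset_opt s a x v) o.1 <= 1 :> R.
  by case: v => [z|] /=; [apply: hd|rewrite big_nil ler01].
case: c => *; try exact: hd; try exact: ho; rewrite /=.
- rewrite big_cons big_seq1 /= subrKC lexx andbT; split=> //.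
  by rewrite le_max lexx /= subr_ge0 ge_max ler01 /= ge_min lexx.
- rewrite all_map; split.
    by apply/allP => i _ /=; rewrite invr_ge0 ler0n.
  rewrite big_map /= big_const_seq count_predT size_iota iter_addr_0.
  set v := neval _ _; case: v => [|v]; first by rewrite mulr0n.
  rewrite -[leLHS]mulr_natr.
  by rewrite mulVf // pnatr_eq0.
- rewrite all_map; split.
    by apply/allP => i _ /=; rewrite divr_ge0 ?sqr_ge0.
  rewrite big_map /= big_enum_ord; apply: sum_quotient_le1.
  by rewrite -fnorm_sq_rows.
- case: insub => [i|] /=; last by rewrite big_nil.
  rewrite all_map; split.
    by apply/allP => j _ /=; rewrite divr_ge0 ?sqr_ge0.
  rewrite big_map /= big_enum_ord; apply: sum_quotient_le1.
  rewrite fnorm_sqE big_ord1; apply: eq_bigr => j _; by rewrite mxE.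
Qed.

Lemma expect_bounds N L t s f : (forall K t s, 0 <= f K t s <= 1) ->
  0 <= expect E N L t s f <= 1.
Proof.
move=> hf; elim: N L t s => [|N IH] [|c L] t s //=.
have [h h1] := atomic_step_mass s c.
have /andP[h2 h3] := @dist_mean _ _
  (fun s' => expect E N (unfold_cmd s c ++ L) (t + cost E s c) s' f) h
  (fun s' => IH _ _ s').
by rewrite h2 (le_trans h3).
Qed.

Lemma expect_sum (J : finType) N L t s (f : J -> seq cmd -> nat -> state R -> R) :
  \sum_j expect E N L t s (f j)
  = expect E N L t s (fun K t s => \sum_j f j K t s).
Proof.
elim: N L t s => [|N IH] [|c L] t s //=.
by rewrite exchange_big; apply: eq_bigr => o _; rewrite -mulr_sumr IH.
Qed.

End Masses.

Section Sampler.
Variables (R : realType) (E : env R) (n : nat) (p : R) (q : 'I_n -> R).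
Hypotheses (hp : 0 < p <= 1) (hq : forall j, 0 <= q j) (hq1 : \sum_j q j = 1).

Definition hits (j : 'I_n) (K : seq cmd) (_ : nat) (s : state R) : R :=
  (nilp K && (nmem s 4 0 == j))%:R.

(* The lower bounds suffice: they add up to a quantity that tends to 1, while
   the probabilities of the different outcomes add up to at most 1. *)
Definition sampler (L : seq cmd) (s : state R) (G : R) : Prop :=
  (forall N t, expect E N L t s (@elapsed R) <= t%:R + G) /\
  (forall i, exists n1, forall N t j, (n1 <= N)%N ->
     (1 - (1 - p) ^+ i) * q j <= expect E N L t s (hits j)).

Lemma sampler_seq c1 c2 s tb Q1 G G' :
  det E [:: c1] s tb Q1 ->
  (forall s1, frame [:: c1] s s1 -> Q1 s1 -> sampler [:: c2] s1 G) ->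
  0 <= G -> tb.+1%:R + G <= G' -> sampler [:: Seq c1 c2] s G'.
Proof.
move=> [n0 [st [te [ss [_ h2 h3 h4 h5]]]]] hc G0 hG.
have [k1 k2 k3] := h3 tt (oner_neq0 _).
have [e1 e2] := hc _ k2 k3.
split=> [[|N] t|i].
- by rewrite /= /elapsed lerDl (le_trans _ hG) // addr_ge0 ?ler0n.
- rewrite /= big_seq1 mul1r -[[:: c1; c2]]/([:: c1] ++ [:: c2]).
  apply: le_trans (h5 _ _ _) _; rewrite sum_unit mul1r.
  apply: le_trans (e1 _ _) _; rewrite -addn1 2!natrD -!addrA lerD2l.
  apply: le_trans hG; rewrite addrA lerD2r -natrD ler_nat; lia.
- have [n1 hn1] := e2 i; exists (n0 + n1).+2 => N t j.
  case: N => // N hN; rewrite /= big_seq1 mul1r.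
  rewrite -[[:: c1; c2]]/([:: c1] ++ [:: c2]) h4; last by lia.
  by rewrite sum_unit mul1r; apply: hn1; have := h2 tt; lia.
Qed.

(** Each round accepts j with probability p q_j and otherwise restores the invariant. The bound G on
    the mean time solves G = d + (1 - p) G, where d is the time of a round, charged with two tests
    to include the one that ends the loop. For the outcomes, 1 - (1 - p)^(i+1) = p + (1 - p)(1 - (1
    - p)^i) drives an induction on the number of rounds. *)
Lemma sampler_while e c (W : finType) (w : W -> R) (acc : W -> option 'I_n)
    tb (I : state R -> Prop) :
  (forall j, \sum_(o | acc o == Some j) w o = p * q j) ->
  (forall s, I s -> beval s e /\
     rnd E [:: c] s w tb (fun o s' =>
       if acc o is Some j then ~~ beval s' e /\ nmem s' 4 0 = j else I s')) ->
  forall s, I s -> sampler [:: While e c] s ((tb + 2 * (bcost e).+1)%:R / p).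
Proof.
move=> hw hI; set G := _ / p.
have [p0 p1] := andP hp.
have hG : p * G = (tb + 2 * (bcost e).+1)%:R by rewrite mulrC divfK ?gt_eqF.
have G0 : 0 <= G by rewrite divr_ge0 ?ler0n ?ltW.
have hrej : \sum_o w o = 1 ->
    \sum_o w o * (acc o == None)%:R = 1 - p.
  have e1 : p = \sum_j \sum_o (if acc o == Some j then w o else 0).
    under eq_bigr do rewrite -big_mkcond hw.
    by rewrite -mulr_sumr hq1 mulr1.
  move=> w1; rewrite -[in RHS]w1 [in RHS]e1.
  rewrite exchange_big -sumrB; apply: eq_bigr => o _ /=.
  case: (acc o) => [j|] /=; last by rewrite mulr1 big1 ?subr0.
  by rewrite mulr0 -big_mkcond /= (big_pred1 j) ?subrr // => j'; rewrite eq_sym.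
have step N L t s f : expect E N.+1 (While e c :: L) t s f
    = expect E N ((if beval s e then [:: c; While e c] else [::]) ++ L)
        (t + (bcost e).+1) s f.
  by rewrite /= big_seq1 mul1r.
move=> s hs; split.
(* Induction on the step budget: the mean time of interrupted runs is bounded without knowing
   beforehand that the loop ends. *)
- move=> N; elim/ltn_ind: N s hs => -[_|N IH] s hs t.
    by rewrite /= /elapsed lerDl.
  have [he [n0 [st [te [ss [[w0 w1] h2 h3 h4 h5]]]]]] := hI _ hs.
  rewrite step he cats0 -[[:: c; While e c]]/([:: c] ++ [:: While e c]).
  apply: le_trans (h5 _ _ _) _.
  apply: (@le_trans _ _ (\sum_o w o * (t%:R + (tb + 2 * (bcost e).+1)%:R
     + (acc o == None)%:R * G))).
    apply: ler_sum => o _; have [->|wo] := eqVneq (w o) 0; first by rewrite !mul0r.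
    have [k1 _ hQ] := h3 o wo; apply: ler_wpM2l => //; move: hQ.
    move: (N - st o)%N (leq_subr (st o) N) => N' hN'.
    case: (acc o) => [j [he' _]|hs'].
      rewrite mul0r addr0 -natrD; case: N' {hN'} => [|N'].
        by rewrite /= ler_nat; lia.
      rewrite step (negbTE he'); case: N' => [|N'] /=; rewrite ler_nat; lia.
    rewrite mul1r; apply: le_trans (IH _ _ _ hs' _) _; first by [].
    by rewrite lerD2r -natrD ler_nat; lia.
  under eq_bigr do rewrite mulrDr mulrA.
  rewrite big_split /= -!mulr_suml w1 hrej // mul1r -addrA lerD2l.
  by rewrite -hG mulrBl mul1r subrKC.
- move=> i; elim: i s hs => [|i IH] s hs.
    exists 0%N => N t j _; rewrite expr0 subrr mul0r.
    suff /andP[//] : 0 <= expect E N [:: While e c] t s (hits j) <= 1.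
    by apply: expect_bounds => *; rewrite /hits ler0n lern1 leq_b1.
  have [he [n0 [st [te [ss [[w0 w1] h2 h3 h4 _]]]]]] := hI _ hs.
  (* The step bounds of the rejected outcomes are chosen one by one; as there are finitely many,
     their sum serves for all. *)
  have [n1 hn1] : {n1 : W -> nat & forall o, w o != 0 -> acc o = None ->
      forall N t j, (n1 o <= N)%N -> (1 - (1 - p) ^+ i) * q j
        <= expect E N [:: While e c] t (ss o) (hits j)}.
    apply: (@choice _ _ (fun o n1 => w o != 0 -> acc o = None ->
      forall N t j, (n1 <= N)%N -> (1 - (1 - p) ^+ i) * q j
        <= expect E N [:: While e c] t (ss o) (hits j))) => o.
    have [w00|wo] := eqVneq (w o) 0; first by exists 0%N.
    have [_ _] := h3 o wo; case: (acc o) => [j _|/IH[n1 hn1]]; first by exists 0%N.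
    by exists n1 => _ _.
  exists (n0 + \sum_o n1 o).+2 => -[//|N] t j hN.
  rewrite step he cats0 -[[:: c; While e c]]/([:: c] ++ [:: While e c]) h4; last by lia.
  apply: (@le_trans _ _ (\sum_o (w o * (acc o == Some j)%:R
     + w o * (acc o == None)%:R * ((1 - (1 - p) ^+ i) * q j)))).
    rewrite big_split /= -mulr_suml hrej //.
    have -> : \sum_o w o * (acc o == Some j)%:R = p * q j.
      by rewrite -hw [RHS]big_mkcond; apply: eq_bigr => o _; case: eqP; rewrite ?mulr1 ?mulr0.
    by rewrite exprS le_eqVlt; apply/orP; left; apply/eqP; ring.
  apply: ler_sum => o _; have [->|wo] := eqVneq (w o) 0; first by rewrite !mul0r addr0.
  rewrite -mulrA -mulrDr; apply: ler_wpM2l => //.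
  have ho := h2 o; have hsum : (n1 o <= \sum_o n1 o)%N.
    by rewrite (bigD1 o) //= leq_addr.
  have [_ _] := h3 o wo; have := hn1 o wo.
  case: (acc o) => [j'|] hno.
    move=> [he' hj']; rewrite mul0r addr0.
    rewrite -[(N - st o)%N](@prednK _); last by lia.
    rewrite step (negbTE he'); set N' := (_ - _)%N.-1.
    have -> : expect E N' [::] (t + (bcost e).+1 + te o + (bcost e).+1) (ss o) (hits j)
        = (nmem (ss o) 4 0 == j)%:R by case: N'.
    by rewrite hj' ler_nat; case: eqP => [[->]|//]; rewrite eqxx.
  by move=> _; rewrite add0r mul1r; apply: hno => //; lia.
Qed.

Lemma sum_hits_le1 N L t s : \sum_j expect E N L t s (hits j) <= 1.
Proof.
rewrite expect_sum.
set f := fun _ _ _ => _.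
suff /andP[] : 0 <= expect E N L t s f <= 1 by [].
apply: expect_bounds => K t' s'; rewrite /f /hits.
case: (nilp K) => /=; last by rewrite big1 ?lexx ?ler01.
have [[j hj]|h] := pselect (exists j : 'I_n, nmem s' 4 0 = j).
  rewrite (bigD1 j) //= hj eqxx big1 ?addr0 ?lexx ?ler01 // => j' hj'.
  by case: eqP => // /val_inj e; rewrite e eqxx in hj'.
by rewrite big1 ?lexx ?ler01 // => j _; case: eqP => // hj; case: h; exists j.
Qed.

Lemma sampler_prob c s G (j : 'I_n) : sampler [:: c] s G ->
  prob E c s (fun _ s' => nmem s' 4 0 = j) = q j.
Proof.
move=> [_ hl]; have [p0 p1] := andP hp.
have x0 : 0 <= 1 - p by rewrite subr_ge0.
have hpow : (fun i => (1 - p) ^+ i) @ \oo --> (0 : R).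
  by apply: cvg_expr; rewrite ger0_norm // ltrBlDr ltrDl.
have -> : prob E c s (fun _ s' => nmem s' 4 0 = j)
    = limn (fun N => expect E N [:: c] 0 s (hits j)).
  congr (limn _); apply/funext => N; congr (expect _ _ _ _ _ _).
  do 3! apply/funext => ?; rewrite /hits; congr ((_ && _)%:R).
  by apply/asboolP/eqP.
apply/cvg_lim => //; apply/cvgrPdist_le => eps eps0.
have /cvgrPdist_le/(_ _ eps0)[i _ hi] := hpow.
have {hi} := hi i (leqnn _); rewrite /= sub0r normrN ger0_norm ?exprn_ge0 //.
set x := (1 - p) ^+ i => hx; have x_ge0 : 0 <= x by apply: exprn_ge0.
have x_le1 : x <= 1 by apply: exprn_ile1 => //; rewrite lerBlDr lerDl ltW.
have [n1 hn1] := hl i; exists n1 => // N /= hN.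
have hlow := hn1 N 0%N _ hN.
(* The other outcomes already take (1 - x)(1 - q_j), which bounds the probability of j from
   above. *)
have hrest : (1 - x) * (1 - q j) <= \sum_(j' | j' != j) expect E N [:: c] 0 s (hits j').
  have -> : 1 - q j = \sum_(j' | j' != j) q j'.
    by rewrite -hq1 (bigD1 j) //= addrC addrK.
  by rewrite mulr_sumr; apply: ler_sum.
have := sum_hits_le1 N [:: c] 0 s; rewrite (bigD1 j) //= => hsum.
have hqj : q j <= 1 by rewrite -hq1 (bigD1 j) //= lerDl sumr_ge0.
have h1 := hlow j; have h2 := hq j.
have h3 : x * q j <= x by rewrite ler_piMr.
have h4 : 0 <= x * q j by rewrite mulr_ge0.
move: hrest hsum h1 h3 h4 hx; rewrite !mulrBl !mulrBr !mul1r !mulr1.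
set u := expect _ _ _ _ _ _; set v := \sum_(j' | _) _; set y := x * q j.
by rewrite ler_norml => *; apply/andP; split; lra.
Qed.

End Sampler.

Definition draw_column : cmd :=
  Seq (Unif 10 (NLit 0) (nv 1)) (SampleCol 4 (NLit 0) (NGet 2 (nv 10))).

Definition acceptance : cexp := cdiv (cabs2 (cv 2)) (CMul (cv 14) (cv 7)).

Definition sampling_program : cmd :=
  Seq load_norms
    (While (BNLt (nv 9) (NLit 1))
       (Seq draw_column
       (Seq (solution_column 4 0) (Flip 9 (NLit 0) acceptance)))).

Section RowSketch.
Variables (R : realType) (m n r : nat) (A : 'M[R[i]]_(m, n))
  (ii : {ffun 'I_r -> 'I_m}).
Hypotheses (hA : A != 0) (hii : forall y, row (ii y) A != 0) (hr : (0 < r)%N).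
Local Notation F := (fnorm A).
Local Notation RR := (row_sketch A ii).

(** The scaling F / (sqrt r |A_i.|) of the rows is the one for which a uniform row followed by a
    length-square entry draws the columns of R by length square; [col_concentration] then applies to
    R. *)
Lemma col_law_col j : \sum_y col_law A ii (y, j) = fnorm (col j RR) ^+ 2 / F ^+ 2.
Proof.
have F0 : F != 0 by rewrite fnorm_eq0.
rewrite fnorm_sqE mulr_suml; apply: eq_bigr => y _.
have y0 : fnorm (row (ii y) A) != 0 by rewrite fnorm_eq0.
have r0 : Num.sqrt r%:R != 0 :> R by rewrite sqrtr_eq0 -ltNge ltr0n.
rewrite big_ord1 [col _ _ _ _]mxE [RR _ _]mxE ComplexField.Normc.normcM normc_real exprMn.
rewrite -normrX ger0_norm ?sqr_ge0 // /col_law /=.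
rewrite -[X in X^-1 * _](@sqr_sqrtr _ r%:R) ?ler0n //.
by field; rewrite F0 y0 r0.
Qed.

(** The squared column norms of R are F^2 times the marginal of [col_law], whose total mass is 1. *)
Lemma fnorm_row_sketch : fnorm RR = F.
Proof.
have F0 : F != 0 by rewrite fnorm_eq0.
apply/eqP; rewrite -(eqrXn2 (n := 2)) ?fnorm_ge0 // fnorm_sq_cols.
apply/eqP; apply: (mulIf (invr_neq0 (expf_neq0 2 F0))).
rewrite mulr_suml; under eq_bigr do rewrite -col_law_col.
rewrite exchange_big (pair_bigA _ (fun y j => col_law A ii (y, j))) /=.
rewrite mulfV ?expf_neq0 //.
have h := col_law_sum1 hii hr; rewrite -[RHS]h.
by apply: eq_bigr => -[].
Qed.

End RowSketch.

Section SolutionSampling.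
Variable R : realType.
Local Notation C := R[i].
Variables (m n : nat) (A : 'M[C]_(m, n)) (b : 'cV[C]_m)
  (svd : svd_routine R) (tau : nat).
Local Notation E := (Env A b svd tau).
Local Notation F := (fnorm A).
Variables (r : nat) (ii : {ffun 'I_r -> 'I_m}) (w : 'cV[C]_r).
Local Notation RR := (row_sketch A ii).
Local Notation x := (approx_solution A ii w).
Hypotheses (hA : A != 0) (hii : forall y, row (ii y) A != 0) (hr : (0 < r)%N)
  (hx : x != 0).

Definition accept (j : 'I_n) : R :=
  normc (x j 0) ^+ 2 / (fnorm w ^+ 2 * fnorm (col j RR) ^+ 2).

(** Cauchy-Schwarz for x_j = <R_.j, w>; it makes [accept] a probability. *)
Lemma solution_entry_le j :
  normc (x j 0) ^+ 2 <= fnorm w ^+ 2 * fnorm (col j RR) ^+ 2.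
Proof.
have -> : x j 0 = ((col j RR)^t* *m w) 0 0.
  by rewrite !mxE; apply: eq_bigr => y _; rewrite !mxE.
rewrite -exprMn lerXn2r ?nnegrE ?normc_ge0 ?mulr_ge0 ?fnorm_ge0 //.
apply: le_trans (fnorm_entry _ _ _) _; apply: le_trans (fnormM _ _) _.
by rewrite fnorm_adj mulrC.
Qed.

Lemma accept_bounds j : 0 <= accept j <= 1.
Proof.
have h0 : 0 <= fnorm w ^+ 2 * fnorm (col j RR) ^+ 2.
  by apply: mulr_ge0; apply: sqr_ge0.
rewrite divr_ge0 ?sqr_ge0 //=; have h := solution_entry_le j.
have [e|e] := eqVneq (fnorm w ^+ 2 * fnorm (col j RR) ^+ 2) 0.
  by rewrite /accept e invr0 mulr0 ler01.
by rewrite ler_pdivrMr ?mul1r // lt_neqAle eq_sym e.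
Qed.

Lemma w_gt0 : 0 < fnorm w.
Proof.
rewrite fnorm_gt0; apply: contra hx => /eqP ->.
by rewrite /approx_solution mulmx0.
Qed.

Definition step_law (o : ('I_r * 'I_n) * bool) : R :=
  col_law A ii o.1 * (if o.2 then accept o.1.2 else 1 - accept o.1.2).

Definition step_output (o : ('I_r * 'I_n) * bool) : option 'I_n :=
  if o.2 then Some o.1.2 else None.

Definition success : R := fnorm x ^+ 2 / (F ^+ 2 * fnorm w ^+ 2).

Definition output_law (j : 'I_n) : R := normc (x j 0) ^+ 2 / fnorm x ^+ 2.

Lemma success_bounds : 0 < success <= 1.
Proof.
have F0 : 0 < F by rewrite fnorm_gt0.
have w0 := w_gt0; have x0 : 0 < fnorm x by rewrite fnorm_gt0.
have d0 : 0 < F ^+ 2 * fnorm w ^+ 2 by rewrite mulr_gt0 // exprn_gt0.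
apply/andP; split; first by rewrite divr_gt0 // exprn_gt0.
rewrite /success ler_pdivrMr // mul1r -exprMn.
rewrite lerXn2r ?nnegrE ?mulr_ge0 ?fnorm_ge0 //.
apply: le_trans (fnormM _ _) _.
by rewrite fnorm_adj fnorm_row_sketch.
Qed.

(** The column norm in the proposal law cancels the one in [accept], which leaves |x_j|^2 / (F^2
    |w|^2). If the column is 0, so is x_j. *)
Lemma step_law_output j :
  \sum_(o | step_output o == Some j) step_law o = success * output_law j.
Proof.
have F0 : F != 0 by rewrite fnorm_eq0.
have w0 : fnorm w != 0 by rewrite gt_eqF ?w_gt0.
have x0 : fnorm x != 0 by rewrite fnorm_eq0.
transitivity ((\sum_y col_law A ii (y, j)) * accept j).
  rewrite big_mkcond.
  rewrite -(pair_bigA _ (fun p a => if step_output (p, a) == Some j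
    then step_law (p, a) else 0)) /=.
  under eq_bigr do rewrite big_bool /= addr0.
  rewrite -(pair_bigA _ (fun y j' => if Some j' == Some j
    then step_law (y, j', true) else 0)) /= mulr_suml.
  apply: eq_bigr => y _; rewrite -big_mkcond /= (big_pred1 j) //.
rewrite col_law_col // /accept /success /output_law.
have [e|e] := eqVneq (fnorm (col j RR)) 0.
  have := solution_entry_le j; rewrite e expr0n /= mulr0 => h.
  have -> : normc (x j 0) ^+ 2 = 0 by apply/eqP; rewrite eq_le h sqr_ge0.
  by rewrite !mul0r !mulr0.
by field; rewrite F0 w0 e x0.
Qed.

Lemma output_law_sum1 : \sum_j output_law j = 1.
Proof.
rewrite -mulr_suml.
have -> : \sum_j normc (x j 0) ^+ 2 = fnorm x ^+ 2.
  by rewrite [RHS]fnorm_sqE; apply: eq_bigr => j _; rewrite big_ord1.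
by rewrite divff // expf_neq0 // fnorm_eq0.
Qed.

Lemma sampling_step s : has_rows A ii s -> stores_vector s w ->
  rnd E [:: Seq draw_column (Seq (solution_column 4 0)
              (Flip 9 (NLit 0) acceptance))] s
    step_law (r * (tau + 200) + tau + 150)
    (fun o s' => nmem s' 9 0 = o.2 /\ nmem s' 4 0 = o.1.2).
Proof.
move=> hs hw.
apply: (@rnd_seq _ E _ _ s _ _ (col_law A ii)
   (fun p (a : bool) => if a then accept p.2 else 1 - accept p.2)
   (tau + 20) (r * (tau + 200) + 100) _
   (fun p s1 => nmem s1 4 0 = p.2)
   (fun p a s' => nmem s' 9 0 = a /\ nmem s' 4 0 = p.2)).
- pose Q (y : 'I_r) (j : 'I_n) (s1 : state R) := nmem s1 4 0 = j.
  suff H : rnd E [:: draw_column] s (col_law A ii) (tau + 20)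
      (fun p => Q p.1 p.2) by apply: (rnd_conseq H).
  apply: (@rnd_seq _ E _ _ s 'I_r 'I_n (fun=> r%:R^-1)
     (fun y j => normc (A (ii y) j) ^+ 2 / fnorm (row (ii y) A) ^+ 2) 6 (tau + 10) _
    (fun (y : 'I_r) s2 => s2 = nset s 10 0 y) Q).
  + by apply: rnd_unif => //; case: hs.
  + move=> y s2 _ _ ->; apply: (@rnd_sampleCol _ E _ _ _ (ii y)) => //.
    * by rd; case: hs.
    * exact: row_entries_sum1.
    * by rewrite /=; lia.
  + by move=> y j; rewrite divr_ge0 ?sqr_ge0.
  + by move=> y _; apply: row_entries_sum1.
  + by lia.
- move=> [y j] s1 _ hf hj.
  have hs1 : has_rows A ii s1 by apply: has_rows_frame hf hs.
  have hw1 : stores_vector s1 w by move=> z; rewrite hf.2.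
  apply: (rnd_seq_det (tb2 := 30)
    (@solution_column_spec _ _ _ _ _ _ _ _ ii w s1 4 0 j hs1 hw1 _ hj)).
  + by [].
  + move=> s2 hf2 [k1 k2 k3]; apply: rnd_flip => //.
    * have -> : ceval s2 acceptance = (accept j)%:C.
        have -> : ceval s2 acceptance = ceval s2 (cabs2 (cv 2))
            * (cmem s2 14 0 * cmem s2 7 0)^-1 by [].
        by rewrite cabs2E [ceval s2 _]/= k1 k2 k3 !(rmorphM, fmorphV).
      exact: Re_real.
    * exact: accept_bounds.
    * by move=> a; rd; split=> //; rewrite hf2.1.
  + lia.
- move=> p a; have /andP[a0 a1] := accept_bounds p.2.
  by case: a; rewrite // subr_ge0.
- by move=> p _; rewrite big_bool /= subrKC.
- lia.
Qed.

Lemma sampling_program_spec s B :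
  nmem s 1 0 = r -> (forall y : 'I_r, nmem s 2 y = ii y) -> stores_vector s w ->
  nmem s 9 0 = 0%N ->
  (r * (tau + 30) + tau + 21)%:R
    + (r * (tau + 200) + tau + 170)%:R / success <= B ->
  samples_from E sampling_program s x B.
Proof.
move=> h1 h2 hw h9 hB.
have [p0 p1] := andP success_bounds.
have q0 j : 0 <= output_law j by rewrite divr_ge0 ?sqr_ge0.
have H : sampler E success output_law [:: sampling_program] s B.
  apply: (sampler_seq success_bounds (load_norms_spec A b svd tau h1 h2)
    (G := (r * (tau + 200) + tau + 170)%:R / success)).
  - move=> s1 hf hs1.
    pose I (s : state R) := [/\ has_rows A ii s, stores_vector s w & nmem s 9 0 = 0%N].
    have H : sampler E success output_law [:: While (BNLt (nv 9) (NLit 1))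
       (Seq draw_column (Seq (solution_column 4 0) (Flip 9 (NLit 0) acceptance)))] s1
       ((r * (tau + 200) + tau + 150 + 2 * 5)%:R / success).
      apply: (sampler_while success_bounds output_law_sum1 (w := step_law)
        (acc := step_output) (I := I)).
      + exact: step_law_output.
      + move=> s2 [k1 k2 k3]; split; first by rewrite /= k3.
        apply: (rnd_conseq (sampling_step k1 k2)) => // -[p a] s3 _ hf3 [/= e1 e2].
        case: a e1 => e1; first by rewrite e1.
        split=> //; first by apply: has_rows_frame hf3 k1.
        by move=> y; rewrite hf3.2.
      + by split=> //; [move=> y; rewrite hf.2|rewrite hf.1].
    case: H => H1 H2; split=> // N t; apply: le_trans (H1 N t) _.
    by rewrite lerD2l ler_pM2r ?invr_gt0 // ler_nat; lia.
  - by rewrite divr_ge0 ?ler0n // ltW.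
  - by apply: le_trans hB; rewrite lerD2r ler_nat; lia.
split=> //; first by move=> N; have [h _] := H; have := h N 0%N; rewrite add0r.
by move=> j; apply: (sampler_prob success_bounds q0 output_law_sum1 j H).
Qed.

End SolutionSampling.

(** * Correctness and running time *)

Section Laws.
Variable R : realType.

(** The product of sums is expanded over all functions, reindexed as tuples. It yields the joint law
    of the sampled indices. *)
Lemma iid_independent (W : finType) (w : W -> R) q (P : 'I_q -> pred W) :
  \sum_(g : q.-tuple W) iid w g * [forall t, P t (tnth g t)]%:R
  = \prod_t \sum_(x | P t x) w x.
Proof.
under [RHS]eq_bigr do rewrite big_mkcond /=.
rewrite bigA_distr_bigA /=.
rewrite (reindex (fun f : {ffun 'I_q -> W} => [tuple of mktuple f])) /=; last first.
  exists (fun g => [ffun t => tnth g t]) => [f|g] _.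
    by apply/ffunP => t; rewrite ffunE tnth_mktuple.
  by apply: eq_from_tnth => t; rewrite tnth_mktuple ffunE.
apply: eq_bigr => f _; rewrite /iid big_tuple.
have [/forallP h|] := boolP [forall t, P t (tnth [tuple of mktuple f] t)].
  rewrite mulr1; apply: eq_bigr => t _; rewrite tnth_mktuple.
  by have := h t; rewrite tnth_mktuple => ->.
rewrite negb_forall => /existsP[t]; rewrite tnth_mktuple => ht.
by rewrite mulr0 [RHS](bigD1 t) //= (negbTE ht) mul0r.
Qed.

(** Meant for rows x, columns y and batches z: the law of the columns depends on the rows, that of
    the batches does not, but whether the batches fail does, through R. Estimates are conditional on
    rows of positive weight. *)
Lemma union_bound (W1 W2 W3 : finType) (a : W1 -> R) (b : W1 -> W2 -> R)
    (c : W3 -> R) (B1 : pred W1) (B2 : W1 -> pred W2) (B3 : W1 -> pred W3) (e : R) :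
  (forall x, 0 <= a x) -> (forall x y, 0 <= b x y) -> (forall z, 0 <= c z) ->
  \sum_x a x = 1 -> (forall x, a x != 0 -> \sum_y b x y = 1) -> \sum_z c z = 1 ->
  \sum_x a x * (B1 x)%:R <= e ->
  (forall x, a x != 0 -> \sum_y b x y * (B2 x y)%:R <= e) ->
  (forall x, a x != 0 -> \sum_z c z * (B3 x z)%:R <= e) ->
  1 - 3 * e <= \sum_(o : W1 * (W2 * W3)) a o.1 * (b o.1 o.2.1 * c o.2.2) *
    [&& ~~ B1 o.1, ~~ B2 o.1 o.2.1 & ~~ B3 o.1 o.2.2]%:R.
Proof.
move=> a0 b0 c0 a1 b1 c1 h1 h2 h3.
rewrite -(pair_bigA _ (fun x p => a x * (b x p.1 * c p.2) *
  [&& ~~ B1 x, ~~ B2 x p.1 & ~~ B3 x p.2]%:R)) /=.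
apply: (@le_trans _ _ (\sum_x a x * (1 - (B1 x)%:R - 2 * e))).
  have -> : \sum_x a x * (1 - (B1 x)%:R - 2 * e)
      = \sum_x a x - \sum_x a x * (B1 x)%:R - (\sum_x a x) * (2 * e).
    by rewrite mulr_suml -!sumrB; apply: eq_bigr => x _; rewrite !mulrBr mulr1.
  by rewrite a1; lra.
apply: ler_sum => x _; have [->|ax] := eqVneq (a x) 0.
  by rewrite mul0r big1 // => *; rewrite !mul0r.
under [leRHS]eq_bigr do rewrite -mulrA.
rewrite -mulr_sumr; apply: ler_wpM2l => //.
rewrite -(pair_bigA _ (fun y z => b x y * c z *
  [&& ~~ B1 x, ~~ B2 x y & ~~ B3 x z]%:R)) /=.
apply: (@le_trans _ _ (\sum_y \sum_z b x y * c z *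
   (1 - (B1 x)%:R - (B2 x y)%:R - (B3 x z)%:R))); last first.
  apply: ler_sum => y _; apply: ler_sum => z _; apply: ler_wpM2l.
    exact: mulr_ge0.
  by case: (B1 x) (B2 x y) (B3 x z) => [] [] [] /=; lra.
have -> : \sum_y \sum_z b x y * c z * (1 - (B1 x)%:R - (B2 x y)%:R - (B3 x z)%:R)
   = (\sum_y b x y) * (\sum_z c z) * (1 - (B1 x)%:R)
     - (\sum_y b x y * (B2 x y)%:R) * (\sum_z c z)
     - (\sum_y b x y) * (\sum_z c z * (B3 x z)%:R).
  rewrite -mulrA !mulr_suml -!sumrB; apply: eq_bigr => y _.
  rewrite !mulr_sumr -!sumrB; apply: eq_bigr => z _.
  ring.
rewrite b1 // c1 !mul1r mulr1.
have := h2 x ax; have := h3 x ax; lra.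
Qed.

End Laws.

Section Sketches.
Variables (R : realType) (m n : nat) (A : 'M[R[i]]_(m, n)).
Local Notation C := R[i].
Local Notation F := (fnorm A).

Lemma row_sketch_factor r (ii : {ffun 'I_r -> 'I_m}) :
  exists D, row_sketch A ii = D *m A.
Proof.
exists (\matrix_(s, i) ((F / Num.sqrt r%:R / fnorm (row (ii s) A))%:C * (i == ii s)%:R)).
apply/matrixP => s j; rewrite mxE [RHS]mxE (bigD1 (ii s)) //= big1 ?addr0 => [|i hi].
  by rewrite [(\matrix_(_, _) _) _ _]mxE eqxx mulr1.
by rewrite [(\matrix_(_, _) _) _ _]mxE (negbTE hi) mulr0 mul0r.
Qed.

Lemma col_sketch_factor r c (G : R) (RR : 'M[C]_(r, n)) (jj : {ffun 'I_c -> 'I_n}) :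
  exists D, col_sketch G RR jj = RR *m D.
Proof.
exists (\matrix_(j, t) ((G / Num.sqrt c%:R / fnorm (col (jj t) RR))%:C * (j == jj t)%:R)).
apply/matrixP => s t; rewrite mxE [RHS]mxE (bigD1 (jj t)) //= big1 ?addr0 => [|j hj].
  by rewrite [(\matrix_(_, _) _) _ _]mxE eqxx mulr1 mulrC.
by rewrite [(\matrix_(_, _) _) _ _]mxE (negbTE hj) !mulr0.
Qed.

(** The estimate is a combination of columns of R by construction, which is what allows [w_neq0] to
    be applied to it. *)
Lemma batch_mean_factor r (b : 'cV[C]_m) (RR : 'M[C]_(r, n)) N h :
  exists v, batch_mean A b RR N h = RR *m v.
Proof.
exists ((N%:R^-1)%:C *: \sum_(x <- h)
  ((F ^+ 2)%:C * b x.1 0 / A x.1 x.2) *: delta_mx x.2 0).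
rewrite -scalemxAr mulmx_sumr; congr (_ *: _); apply: eq_bigr => x _.
by rewrite /estimate -scalemxAr colE.
Qed.

(** Row sampling of A is column sampling of A^*, so one concentration bound covers both sketches. *)
Lemma adj_row_sketch r (ii : {ffun 'I_r -> 'I_m}) :
  (row_sketch A ii)^t* = col_sketch F (A^t*) ii.
Proof.
apply/matrixP => j s; rewrite [LHS]mxE [_^T _ _]mxE [row_sketch _ _ _ _]mxE [RHS]mxE.
rewrite [LHS]rmorphM [X in _ = _ * X]mxE [_^T _ _]mxE; congr (_ * _).
rewrite [LHS]conj_real; congr (_ / _)%:C; rewrite -[LHS]fnorm_adj.
by congr fnorm; apply/matrixP => x y; rewrite !mxE.
Qed.

Lemma row_concentration r (delta : R) : A != 0 ->
  (0 < r)%N -> 0 < delta -> delta <= 5 * F ^+ 2 ->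
  \sum_(g : r.-tuple 'I_m) iid (row_law A) g *
    (delta <= fnorm (A^t* *m A -
       (row_sketch A (rows_of g))^t* *m row_sketch A (rows_of g)))%R%:R
  <= expR (1 - r%:R * delta ^+ 2 / (40 * F ^+ 4)).
Proof.
move=> hA r0 d0 d1.
have hA' : A^t* != 0 by rewrite -fnorm_eq0 fnorm_adj fnorm_eq0.
have hcc i : \sum_(x | x == i) row_law A x
    = fnorm (col i (A^t*)) ^+ 2 / fnorm (A^t*) ^+ 2.
  rewrite big_pred1_eq /row_law fnorm_adj; congr (_ ^+ 2 / _).
  by rewrite -[LHS]fnorm_adj; congr fnorm; apply/matrixP => x y; rewrite !mxE.
have := @col_concentration _ _ _ (A^t*) _ (row_law A) id hA'
  (@row_law_ge0 _ _ _ A) (row_law_sum1 hA) hcc r delta r0 d0.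
rewrite !fnorm_adj => /(_ d1); apply: le_trans.
rewrite le_eqVlt; apply/orP; left; apply/eqP; apply: eq_bigr => g _.
by rewrite -[X in gram X]adj_row_sketch /gram !adjK.
Qed.

Lemma col_sketch_concentration r c (ii : {ffun 'I_r -> 'I_m}) (delta : R) : A != 0 ->
  (forall y, row (ii y) A != 0) -> (0 < r)%N ->
  (0 < c)%N -> 0 < delta -> delta <= 5 * F ^+ 2 ->
  \sum_(g : c.-tuple ('I_r * 'I_n)) iid (col_law A ii) g *
    (delta <= fnorm (gram (row_sketch A ii) -
       gram (col_sketch F (row_sketch A ii) (cols_of g))))%R%:R
  <= expR (1 - c%:R * delta ^+ 2 / (40 * F ^+ 4)).
Proof.
move=> hA hii r0 c0 d0 d1; set RR := row_sketch A ii.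
have hF : fnorm RR = F by apply: fnorm_row_sketch.
have hR : RR != 0 by rewrite -fnorm_eq0 hF fnorm_eq0.
have hcc j : \sum_(x | x.2 == j) col_law A ii x = fnorm (col j RR) ^+ 2 / fnorm RR ^+ 2.
  rewrite hF -col_law_col // big_mkcond -(pair_bigA _ (fun y j' =>
    if j' == j then col_law A ii (y, j') else 0)) /=.
  by apply: eq_bigr => y _; rewrite -big_mkcond big_pred1_eq.
have := @col_concentration _ _ _ RR _ (col_law A ii) snd hR
  (@col_law_ge0 _ _ _ A _ ii) (col_law_sum1 hii r0) hcc c delta c0 d0.
by rewrite hF => /(_ d1).
Qed.

End Sketches.

Section Accuracy.
Variables (R : realType) (c0 K : R).
Hypotheses (hc0 : 0 < c0) (hK : 0 < K).
Local Notation C := R[i].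
(* [K / 8] makes the coefficients accurate enough, and [c0 / 2] keeps the
   estimate of R A^* b away from 0 when b is not 0. *)
Definition accuracy : R := Num.min (K / 8) (c0 / 2).

Lemma accuracy_gt0 : 0 < accuracy.
Proof. by rewrite lt_min !divr_gt0. Qed.

Variables (m n k : nat) (A : 'M[C]_(m, n)) (Ap : 'M[C]_(n, m)) (b : 'cV[C]_m)
  (kappa eps : R) (svd : svd_routine R).
Local Notation F := (fnorm A).
Hypotheses (heps : 0 < eps < 1) (hk1 : (1 <= k)%N) (hkappa : 0 < kappa)
  (hA : A != 0) (hk : (\rank A <= k)%N) (hA1 : opnorm A <= 1)
  (hAp : is_pseudoinverse A Ap) (hAp1 : opnorm Ap <= kappa)
  (hb : c0 * fnorm b <= fnorm (colspace_proj A b)) (hsvd : svd_correct svd).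

(** The 3 compensates the loss in [selected_close], and kappa^3 the loss in [coefficient_accuracy],
    whose 8 is part of [accuracy]. *)
Definition tolerance : R :=
  accuracy * (eps * fnorm b / Num.sqrt k%:R) / (3 * kappa ^+ 3).

Lemma tolerance_ge0 : 0 <= tolerance.
Proof.
have [e0 _] := andP heps.
by rewrite /tolerance !mulr_ge0 ?invr_ge0 ?mulr_ge0 ?sqrtr_ge0 ?fnorm_ge0
  ?exprn_ge0 // ltW ?accuracy_gt0.
Qed.

(** M absorbs the constants c0 and K through [accuracy], and c the dependence on A and eps; 144 is
    16 times the square of the 3 in [tolerance]. *)
Lemma batch_failure r (RR : 'M[C]_(r, n)) M c : fnorm RR = F ->
  1 <= M%:R * accuracy ^+ 2 -> (0 < c)%N ->
  144 * (k%:R * kappa ^+ 6 * F ^+ 4) <= c%:R * eps ^+ 2 ->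
  \sum_(h : (M * c).-tuple ('I_m * 'I_n)) iid (entry_law A) h *
    (tolerance < fnorm (batch_mean A b RR (M * c) h - RR *m (A ^t* *m b)))%R%:R <= 1 / 16.
Proof.
move=> hRR hM c_gt0 hc.
have M0 : (0 < M)%N.
  by case: M hM => // ; rewrite mul0r lt_geF ?ltr01.
apply: batch_error => //; first by rewrite muln_gt0 M0.
  exact: tolerance_ge0.
have k0 : 0 < k%:R :> R by rewrite ltr0n.
have kp : 0 < kappa ^+ 6 by rewrite exprn_gt0.
have -> : (M * c)%N%:R * tolerance ^+ 2
   = (M%:R * accuracy ^+ 2) * (c%:R * eps ^+ 2 * fnorm b ^+ 2) / (9 * (k%:R * kappa ^+ 6)).
  rewrite natrM /tolerance -[k%:R in RHS](@sqr_sqrtr _ k%:R) ?ltW //.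
  have s0 : Num.sqrt k%:R != 0 :> R by rewrite sqrtr_eq0 -ltNge.
  by field; rewrite s0 gt_eqF.
rewrite ler_pdivlMr ?mulr_gt0 //.
apply: (@le_trans _ _ (c%:R * eps ^+ 2 * fnorm b ^+ 2)); last first.
  rewrite ler_peMl //; apply: mulr_ge0; last exact: sqr_ge0.
  by apply: mulr_ge0; [exact: ler0n|exact: sqr_ge0].
apply: le_trans (ler_wpM2r (sqr_ge0 (fnorm b)) hc).
by rewrite le_eqVlt; apply/orP; left; apply/eqP; ring.
Qed.

Variables (r c : nat) (ii : {ffun 'I_r -> 'I_m}) (jj : {ffun 'I_c -> 'I_n}).
Local Notation RR := (row_sketch A ii).
Local Notation CC := (col_sketch F RR jj).
Hypothesis hE1 : fnorm (A ^t* *m A - RR ^t* *m RR) <= (2 * kappa ^+ 2)^-1.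
Hypothesis hE2 : fnorm (RR *m RR ^t* - CC *m CC ^t*) <= (4 * kappa ^+ 2)^-1.
Variable yh : 'cV[C]_r.
Hypothesis hyh : exists v, yh = RR *m v.
Hypothesis hclose : fnorm (yh - RR *m (A ^t* *m b)) <= 3 * tolerance.
Local Notation w := (regression_vector (svd CC).1 (svd CC).2 k yh).
Local Notation x := (approx_solution A ii w).

Let hRR : exists D, RR = D *m A := row_sketch_factor A ii.
Let hCC : exists D, CC = RR *m D := col_sketch_factor F RR jj.

Lemma regression_valid : valid_output A b k eps K ii jj w.
Proof.
have [e0 e1] := andP heps.
exists (svd CC).1, (svd CC).2,
  (fun l => ((svd CC).2 0 l)^-1%:C * (((svd CC).1)^t* *m yh) l 0); split.
- exact: hsvd.
- move=> l hl.
  apply: (coefficient_accuracy hAp hkappa hAp1 hRR hE1 hCC hE2 (hsvd CC)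
    (ltW e0) (ltW hK)).
  apply: le_trans hclose _; rewrite /tolerance.
  have h : accuracy <= K / 8 by rewrite ge_min lexx.
  have e : 0 <= eps * fnorm b / Num.sqrt k%:R.
    by rewrite !mulr_ge0 ?fnorm_ge0 ?invr_ge0 ?sqrtr_ge0 // ltW.
  set z := eps * fnorm b / _ in e *.
  have -> : 3 * (accuracy * z / (3 * kappa ^+ 3)) = accuracy * z / kappa ^+ 3.
    by field; rewrite gt_eqF.
  have -> : K * z / (8 * kappa ^+ 3) = K / 8 * z / kappa ^+ 3.
    by field; rewrite gt_eqF.
  rewrite ler_wpM2r ?invr_ge0 ?exprn_ge0 ?(ltW hkappa) // ler_wpM2r //.
- apply: eq_bigr => l _; congr (_ *: _).
  set s := (svd CC).2 0 l; rewrite (mulrC s^-1%:C) -mulrA; congr (_ * _).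
  by rewrite fmorphV -invfM -rmorphM /= -exprS.
Qed.

(** If the estimate were 0, then y = R A^* b would satisfy |y| <= 3 [tolerance], hence kappa^2 |y|
    <= (c0 / 2) |b|. But c0 |b| <= kappa |A^* b| and |A^* b| <= sqrt 2 kappa |y|, so that c0 |b| <=
    sqrt 2 (c0 / 2) |b|, impossible for b nonzero. *)
Lemma solution_neq0 : b != 0 -> x != 0 /\ fnorm w ^+ 2 <= 2 * kappa ^+ 2 * fnorm x ^+ 2.
Proof.
move=> b0; have [e0 e1] := andP heps.
have hw2 := fnorm_w_le hAp hkappa hAp1 hRR hE1 hCC (hsvd CC) k yh.
split=> //.
have hw : w != 0.
  apply: (w_neq0 hAp hkappa hAp1 hRR hE1 hCC hE2 (hsvd CC) hk hyh).
  apply/eqP => y0; move: hclose; rewrite y0 sub0r fnormN => hy.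
  have hb0 : 0 < fnorm b by rewrite fnorm_gt0.
  have hz : c0 * fnorm b <= kappa * fnorm (A^t* *m b).
    exact: le_trans hb (colspace_proj_le hAp hkappa hAp1 b).
  have hs : fnorm (A^t* *m b) ^+ 2 <= 2 * kappa ^+ 2 * fnorm (RR *m (A^t* *m b)) ^+ 2.
    by apply: (sketch_lb hkappa hAp1 hE1); rewrite mulmxA (pinv_adj hAp).
  have k1 : 1 <= kappa by apply: kappa_ge1 hAp hkappa hAp1 hA hA1.
  have s1 : 1 <= Num.sqrt k%:R :> R.
    by rewrite -[leLHS]sqrtr1 ler_wsqrtr // ler1n.
  have s0 : 0 < Num.sqrt k%:R :> R by apply: lt_le_trans s1.
  have q1 : 3 * tolerance * kappa ^+ 2 <= c0 / 2 * fnorm b.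
    have -> : 3 * tolerance * kappa ^+ 2
        = accuracy * fnorm b * (eps / (Num.sqrt k%:R * kappa)).
      by rewrite /tolerance; field; rewrite !gt_eqF.
    have h1 : eps / (Num.sqrt k%:R * kappa) <= 1.
      rewrite ler_pdivrMr ?mulr_gt0 // mul1r (le_trans (ltW e1)) //.
      by rewrite -[leLHS]mulr1 ler_pM.
    apply: (@le_trans _ _ (accuracy * fnorm b)).
      by rewrite ler_piMr // mulr_ge0 ?fnorm_ge0 // ltW ?accuracy_gt0.
    by rewrite ler_wpM2r ?fnorm_ge0 // ge_min lexx orbT.
  set y := fnorm (RR *m _) in hy hs; set z := fnorm (A^t* *m b) in hz hs.
  have q2 : (y * kappa ^+ 2) ^+ 2 <= (c0 / 2 * fnorm b) ^+ 2.
    rewrite lerXn2r ?nnegrE ?mulr_ge0 ?fnorm_ge0 ?exprn_ge0 ?invr_ge0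
      ?(ltW hc0) ?(ltW hkappa) //.
    by apply: le_trans q1; rewrite ler_wpM2r ?exprn_ge0 ?(ltW hkappa).
  have q3 : (c0 * fnorm b) ^+ 2 <= (kappa * z) ^+ 2.
    by rewrite lerXn2r ?nnegrE ?mulr_ge0 ?fnorm_ge0 ?(ltW hc0) ?(ltW hkappa).
  have q4 : (kappa * z) ^+ 2 <= 2 * (y * kappa ^+ 2) ^+ 2.
    have -> : 2 * (y * kappa ^+ 2) ^+ 2 = kappa ^+ 2 * (2 * kappa ^+ 2 * y ^+ 2).
      by ring.
    by rewrite exprMn ler_wpM2l // exprn_ge0 // ltW.
  have q5 : 0 < (c0 * fnorm b) ^+ 2 by rewrite exprn_gt0 // mulr_gt0.
  have q6 : (c0 / 2 * fnorm b) ^+ 2 = (c0 * fnorm b) ^+ 2 / 4 by field.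
  by move: q2 q3 q4 q5; rewrite q6; lra.
rewrite -fnorm_gt0 lt_neqAle fnorm_ge0 andbT eq_sym.
apply: contra hw => /eqP h; move: hw2; rewrite h expr0n mulr0.
by rewrite real_exprn_even_le0 ?num_real //= fnorm_eq0.
Qed.

End Accuracy.

(** * How large r and c are *)

Section Sizes.
Variables (R : realType) (k : nat) (kappa F eps : R).
Hypotheses (k1 : 1 <= k%:R :> R) (kap1 : 1 <= kappa) (kF1 : 1 <= kappa * F) (F0 : 0 < F)
  (Fk : F ^+ 2 <= k%:R) (heps : 0 < eps < 1).

Let kap0 : 0 < kappa. Proof. exact: lt_le_trans kap1. Qed.
Let k0 : 0 < k%:R :> R. Proof. exact: lt_le_trans k1. Qed.
Let e0 : 0 < eps ^+ 2. Proof. by case/andP: heps => h _; rewrite exprn_gt0. Qed.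
Let e1 : eps ^+ 2 <= 1.
Proof. by case/andP: heps => h1 h2; rewrite exprn_ile1 // ltW. Qed.
Let F2 : 0 < F ^+ 2. Proof. by rewrite exprn_gt0. Qed.
Let kp n : 0 < kappa ^+ n. Proof. by rewrite exprn_gt0. Qed.
Let kp1 n : 1 <= kappa ^+ n. Proof. by rewrite exprn_ege1. Qed.
Let kk : k%:R <= k%:R ^+ 2 :> R. Proof. by rewrite expr2 ler_peMr // ltW. Qed.
Let kF2 : 1 <= kappa ^+ 2 * F ^+ 2. Proof. by rewrite -exprMn exprn_ege1. Qed.

Local Notation base p := (kappa ^+ p * k%:R ^+ 2 * F ^+ 2 / eps ^+ 2).

Lemma base_ge p (z : R) : z * eps ^+ 2 <= kappa ^+ p * k%:R ^+ 2 * F ^+ 2 -> z <= base p.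
Proof. by rewrite ler_pdivlMr. Qed.

(** Concentration in the Frobenius norm asks for F^4 where the prescribed sizes have k^2 F^2; the
    exchange rests on F^2 <= k <= k^2. *)
Lemma base_fnorm p : kappa ^+ p * F ^+ 4 <= base p.
Proof.
apply: base_ge; have h : F ^+ 2 <= k%:R ^+ 2 by apply: le_trans kk.
apply: (@le_trans _ _ (kappa ^+ p * F ^+ 4)).
  by rewrite ler_piMr // mulr_ge0 ?exprn_ge0 // ltW.
rewrite -mulrA ler_wpM2l ?(ltW (kp p)) // -[4%N]/(2 + 2)%N exprD.
by rewrite ler_wpM2r // ltW.
Qed.

(** F^2 may be small; two powers of kappa make up for it since kappa F >= 1. *)
Lemma base_kappa p : kappa ^+ p <= base p.+2.
Proof.
apply: base_ge; apply: (@le_trans _ _ (kappa ^+ p)).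
  by rewrite ler_piMr // ltW.
have -> : kappa ^+ p.+2 * k%:R ^+ 2 * F ^+ 2
    = kappa ^+ p * (k%:R ^+ 2 * (kappa ^+ 2 * F ^+ 2)) by rewrite -addn2 exprD; ring.
rewrite ler_peMr ?(ltW (kp p)) //; apply: mulr_ege1 => //.
exact: le_trans k1 kk.
Qed.

Lemma base_ge1 p : 1 <= base p.+2.
Proof. exact: le_trans (kp1 p) (base_kappa p). Qed.

Lemma base_fnorm_kappa p : kappa ^+ p * F ^+ 2 <= base p.
Proof.
apply: base_ge; apply: (@le_trans _ _ (kappa ^+ p * F ^+ 2)).
  by rewrite ler_piMr // mulr_ge0 ?exprn_ge0 // ltW.
have -> : kappa ^+ p * k%:R ^+ 2 * F ^+ 2
    = kappa ^+ p * F ^+ 2 * k%:R ^+ 2 by ring.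
by rewrite ler_peMr ?(ltW (mulr_gt0 (kp p) F2)) // (le_trans k1 kk).
Qed.

Lemma base_mid p : k%:R * kappa ^+ p * F ^+ 4 <= base p * eps ^+ 2.
Proof.
rewrite divfK ?gt_eqF //.
have -> : k%:R * kappa ^+ p * F ^+ 4 = (k%:R * kappa ^+ p * F ^+ 2) * F ^+ 2 by ring.
have -> : kappa ^+ p * k%:R ^+ 2 * F ^+ 2 = (k%:R * kappa ^+ p * F ^+ 2) * k%:R by ring.
apply: ler_wpM2l Fk; exact (ltW (mulr_gt0 (mulr_gt0 k0 (kp p)) F2)).
Qed.

Lemma row_tail (x L : R) : 7 / 8 <= L -> 1024 * L * base 4 <= x ->
  expR (1 - x * (2 * kappa ^+ 2)^-1 ^+ 2 / (40 * F ^+ 4)) <= expR (- L).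
Proof.
move=> hL hx; rewrite ler_expR.
have hf := base_fnorm 4; have F4 : 0 < F ^+ 4 by rewrite exprn_gt0.
have h : 1024 * L * (kappa ^+ 4 * F ^+ 4) <= x.
  by apply: le_trans hx; rewrite ler_wpM2l //; lra.
have -> : x * (2 * kappa ^+ 2)^-1 ^+ 2 / (40 * F ^+ 4)
    = x / (160 * (kappa ^+ 4 * F ^+ 4)) by field; rewrite !gt_eqF.
(* As L >= 7/8, the summand 1 is at most 2 L; and 3 times 160 is below 1024. *)
suff : 2 * L + L <= x / (160 * (kappa ^+ 4 * F ^+ 4)) by lra.
rewrite ler_pdivlMr ?mulr_gt0 //; apply: le_trans h.
have := mulr_gt0 (kp 4) F4; set y := kappa ^+ 4 * _ => y0.
have : 0 <= L * y by apply: mulr_ge0; lra.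
by lra.
Qed.

Lemma col_tail (x L : R) : 7 / 8 <= L -> 5184 * L * base 8 <= x ->
  expR (1 - x * (4 * kappa ^+ 2)^-1 ^+ 2 / (40 * F ^+ 4)) <= expR (- L).
Proof.
move=> hL hx; rewrite ler_expR.
have hf := base_fnorm 8; have F4 : 0 < F ^+ 4 by rewrite exprn_gt0.
have h : 5184 * L * (kappa ^+ 4 * F ^+ 4) <= x.
  apply: le_trans hx; rewrite ler_wpM2l //; first lra.
  by apply: le_trans hf; rewrite ler_wpM2r ?(ltW F4) // ler_weXn2l.
have -> : x * (4 * kappa ^+ 2)^-1 ^+ 2 / (40 * F ^+ 4)
    = x / (640 * (kappa ^+ 4 * F ^+ 4)) by field; rewrite !gt_eqF.
suff : 2 * L + L <= x / (640 * (kappa ^+ 4 * F ^+ 4)) by lra.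
rewrite ler_pdivlMr ?mulr_gt0 //; apply: le_trans h.
have := mulr_gt0 (kp 4) F4; set y := kappa ^+ 4 * _ => y0.
have : 0 <= L * y by apply: mulr_ge0; lra.
by lra.
Qed.

Lemma deviation_le (a : R) : 1 <= a -> (a * kappa ^+ 2)^-1 <= 5 * F ^+ 2.
Proof.
move=> ha; have a0 : 0 < a by lra.
rewrite -[leLHS]mul1r ler_pdivrMr ?mulr_gt0 //.
have -> : 5 * F ^+ 2 * (a * kappa ^+ 2) = 5 * a * (kappa ^+ 2 * F ^+ 2) by ring.
by apply: mulr_ege1 => //; lra.
Qed.

Lemma batch_size (x L : R) : 7 / 8 <= L -> 5184 * L * base 8 <= x ->
  144 * (k%:R * kappa ^+ 6 * F ^+ 4) <= x * eps ^+ 2.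
Proof.
move=> hL hx; have F4 : 0 < F ^+ 4 by rewrite exprn_gt0.
apply: (@le_trans _ _ (5184 * L * base 8 * eps ^+ 2)); last first.
  by rewrite ler_wpM2r // ltW.
rewrite -[leRHS]mulrA; apply: ler_pM;
  [by []|exact: (ltW (mulr_gt0 (mulr_gt0 k0 (kp 6)) F4))|lra|].
apply: le_trans (base_mid 8); rewrite ler_wpM2r ?exprn_ge0 ?(ltW F0) //.
by rewrite ler_wpM2l ?(ltW k0) // ler_weXn2l.
Qed.

(** One half is at most exp (-1/2), and x >= 2 L. *)
Lemma majority_size (x : nat) (L : R) : 7 / 8 <= L -> 1024 * L * base 4 <= x%:R ->
  2^-1 ^+ x <= expR (- L).
Proof.
move=> hL hx; have h := base_ge1 2.
have hx2 : 2 * L <= x%:R.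
  apply: le_trans hx; apply: (@le_trans _ _ (1024 * L * 1)); first lra.
  by rewrite ler_wpM2l //; lra.
have h2 : 2^-1 <= expR (- 2^-1) :> R.
  by apply: le_trans (expR_ge1Dx _); lra.
apply: (@le_trans _ _ (expR (- 2^-1) ^+ x)).
  by rewrite lerXn2r ?nnegrE ?expR_ge0 ?invr_ge0.
by rewrite -expRM_natl ler_expR; lra.
Qed.

End Sizes.

(** * From the sizes to the soft time bound *)

Section Time.
Variable R : realType.

Lemma le_natceil (x : R) : 0 <= x -> x <= (natceil x)%:R.
Proof. by move=> x0; rewrite leNgt natceilP // ltnn. Qed.

Lemma natceil_le (x : R) : 0 <= x -> (natceil x)%:R <= x + 1.
Proof.
move=> x0; have := natceilP (natceil x).-1 x0.
case: (natceil x) => [|v] /=; first by move=> _; rewrite ler_wpDr.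
by rewrite ltnSn => /ltW h; rewrite -natr1 lerD2r.
Qed.

(** ln y = - ln (1 / y) >= 1 - 1 / y. The value 7/8 is enough for the logarithms to outweigh the
    summand 1 in the exponent of [hoeffding]. *)
Lemma ln_ge8 (y : R) : 8 <= y -> 7 / 8 <= ln y.
Proof.
move=> y8; have y0 : 0 < y by apply: lt_le_trans y8.
have h : y^-1 <= 8^-1 by rewrite lef_pV2 ?posrE.
have yp : 0 < y^-1 by rewrite invr_gt0.
have : ln (1 + (y^-1 - 1)) <= y^-1 - 1 by apply: le_ln1Dx; lra.
by rewrite subrKC lnV ?posrE //; lra.
Qed.

Lemma ln_le_pred (y : R) : 0 < y -> ln y <= y - 1.
Proof.
move=> y0; have : ln (1 + (y - 1)) <= y - 1 by apply: le_ln1Dx; lra.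
by rewrite subrKC.
Qed.

Variables (m n : nat) (eta T : R).
Hypotheses (hm : (0 < m)%N) (hn : (0 < n)%N) (heta : 0 < eta < 1) (hT : 1 <= T).
Local Notation L := (log_factor m n eta T).

Let eta0 : 0 < eta. Proof. by case/andP: heta. Qed.
Let ln_nat q : (0 < q)%N -> 0 <= ln q%:R :> R.
Proof. by move=> q0; rewrite ln_ge0 // ler1n. Qed.
Let ln_eta : 0 <= ln eta^-1.
Proof. by rewrite ln_ge0 // invf_ge1 //; case/andP: heta => _ /ltW. Qed.
Let lnT : 0 <= ln (1 + T).
Proof. by rewrite ln_ge0 // lerDl; apply: le_trans hT. Qed.

Lemma log_factor_ge1 : 1 <= L.
Proof.
rewrite /log_factor; have := ln_nat hm; have := ln_nat hn; move: ln_eta lnT; lra.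
Qed.

Lemma log_factor_ge (S : R) : 0 < S -> S <= T -> log_factor m n eta S <= L.
Proof.
move=> S0 ST; rewrite /log_factor !lerD2r lerD2l ler_ln ?posrE ?lerD2l //; lra.
Qed.

Lemma ln_ratio (q : nat) : (0 < q)%N ->
  ln (8 * q%:R / eta) = ln 8 + ln q%:R + ln eta^-1.
Proof.
move=> q0; have q1 : 0 < q%:R :> R by rewrite ltr0n.
by rewrite !lnM ?posrE ?mulr_gt0 ?invr_gt0.
Qed.

Lemma ln_ratio_ge (q : nat) : (0 < q)%N -> 7 / 8 <= ln (8 * q%:R / eta).
Proof.
move=> q0; apply: ln_ge8; have [_ e1] := andP heta.
rewrite ler_pdivlMr //; apply: ler_pM => //; first exact: ltW.
by apply: le_trans (ltW e1) _; rewrite ler1n.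
Qed.

Lemma expR_ln_ratio (q : nat) : (0 < q)%N -> expR (- ln (8 * q%:R / eta)) <= eta / 8.
Proof.
move=> q0; have q1 : 1 <= q%:R :> R by rewrite ler1n.
have q2 : 0 < q%:R :> R by rewrite ltr0n.
rewrite expRN lnK ?posrE ?divr_gt0 ?mulr_gt0 // invf_div ler_pM2l //.
by rewrite lef_pV2 ?posrE ?mulr_gt0 // ler_peMr.
Qed.

(** The 8 is made up of ln 8 <= 7 and of ln (1 / eta) <= L. *)
Lemma ln_ratio_le (q : nat) (a : R) : (0 < q)%N -> ln q%:R <= a * L ->
  ln (8 * q%:R / eta) <= (a + 8) * L.
Proof.
move=> q0 hq; rewrite ln_ratio //.
have h8 : ln 8 <= 7 :> R by apply: le_trans (ln_le_pred _) _ => //; lra.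
have := log_factor_ge1; have : ln eta^-1 <= L.
  by rewrite /log_factor; have := ln_nat hm; have := ln_nat hn; move: lnT; lra.
by rewrite mulrDl; lra.
Qed.

Lemma ln_n_le : ln n%:R <= L.
Proof.
by rewrite /log_factor; have := ln_nat hm; move: lnT ln_eta; lra.
Qed.

Variables (X Y : R) (r c : nat).
Hypotheses (hX : 1 <= X) (hY : 1 <= Y) (hXT : X ^+ 2 * Y <= T) (hXY : X <= Y).
Hypotheses (hr : r = natceil (1024 * ln (8 * n%:R / eta) * X))
  (hc : c = natceil (5184 * ln (8 * r%:R / eta) * Y)).

Let X0 : 0 < X. Proof. exact: lt_le_trans hX. Qed.
Let Y0 : 0 < Y. Proof. exact: lt_le_trans hY. Qed.

Lemma ln_ratio_gt0 q : (0 < q)%N -> 0 < ln (8 * q%:R / eta).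
Proof. by move=> /ln_ratio_ge; apply: lt_le_trans; rewrite divr_gt0. Qed.

Lemma sizes_gt0 : (0 < r)%N /\ (0 < c)%N.
Proof.
have r0 : (0 < r)%N by rewrite hr natceil_gt0 // !mulr_gt0 // ln_ratio_gt0.
by split=> //; rewrite hc natceil_gt0 // !mulr_gt0 // ln_ratio_gt0.
Qed.

Let L1 := log_factor_ge1.
Let LX : 1 <= L * X. Proof. by apply: mulr_ege1. Qed.
Let LY : 1 <= L * Y. Proof. by apply: mulr_ege1. Qed.

(** In r the logarithm is at most (1 + 8) L. In c it contains r itself, and ln r <= ([rows_constant]
    + 1) L by [ln_le_log]. The final 1 pays for rounding up. *)
Definition rows_constant : R := 1024 * (1 + 8) + 1.
Definition cols_constant : R := 5184 * (rows_constant + 1 + 8) + 1.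
Definition size_constant : R :=
  rows_constant ^+ 2 * cols_constant + rows_constant ^+ 3.

Lemma rows_constant_ge1 : 1 <= rows_constant.
Proof. by rewrite /rows_constant; lra. Qed.

Lemma cols_constant_ge1 : 1 <= cols_constant.
Proof.
rewrite /cols_constant lerDr mulr_ge0 //; have := rows_constant_ge1; lra.
Qed.

Lemma natceil_scale (a d l Z : R) : 0 <= a -> 0 <= l -> 1 <= L * Z -> l <= d * L ->
  0 <= Z -> (natceil (a * l * Z))%:R <= (a * d + 1) * (L * Z).
Proof.
move=> a0 l0 hLZ hl hZ; apply: le_trans (natceil_le _) _.
  by rewrite !mulr_ge0.
rewrite mulrDl mul1r lerD // -!mulrA; apply: ler_wpM2l => //.
by rewrite !mulrA ler_wpM2r.
Qed.

Lemma rows_le : r%:R <= rows_constant * (L * X).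
Proof.
rewrite hr; apply: natceil_scale => //; try exact: ltW.
  by rewrite ltW // ln_ratio_gt0.
by apply: ln_ratio_le; rewrite // mul1r ln_n_le.
Qed.

Lemma X_le_T : X <= T.
Proof.
apply: le_trans hXT; rewrite expr2 -mulrA ler_peMr ?(ltW X0) //.
exact: mulr_ege1.
Qed.

(** ln a <= a - 1, ln L <= L - 1 and ln X <= L, the last because X <= T and L contains ln (1 +
    T). *)
Lemma ln_le_log (a z : R) : 1 <= a -> 0 < z -> z <= a * (L * X) ->
  ln z <= (a + 1) * L.
Proof.
move=> a1 z0 hz; have a0 : 0 < a by apply: lt_le_trans a1.
have Lp : 0 < L by apply: lt_le_trans L1.
apply: (@le_trans _ _ (ln (a * (L * X)))).
  by rewrite ler_ln ?posrE // !mulr_gt0.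
rewrite !lnM ?posrE ?mulr_gt0 //.
have h1 := ln_le_pred a0; have h2 := ln_le_pred Lp.
have h3 : ln X <= L.
  apply: (@le_trans _ _ (ln (1 + T))).
    have h : X <= 1 + T by apply: le_trans X_le_T _; rewrite lerDr.
    by rewrite ler_ln ?posrE // (lt_le_trans X0).
  by rewrite /log_factor; have := ln_nat hm; have := ln_nat hn;
    move: ln_eta lnT; lra.
have h4 : a - 1 <= (a - 1) * L by rewrite ler_peMr // subr_ge0.
move: L1 h4; rewrite mulrBl mulrDl !mul1r; lra.
Qed.

Lemma cols_le : c%:R <= cols_constant * (L * Y).
Proof.
have [r0 _] := sizes_gt0.
rewrite hc; apply: natceil_scale => //; try exact: ltW.
  by rewrite ltW // ln_ratio_gt0.
apply: ln_ratio_le => //; apply: ln_le_log rows_le; last by rewrite ltr0n.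
exact: rows_constant_ge1.
Qed.

(** X and Y are the sizes freed of logarithms: r^2 c is of order L^3 X^2 Y and r^3 of order L^3 X^3,
    and X^3 <= X^2 Y <= T. *)
Lemma cells_le : (r * r * c + r * r * r)%:R <= size_constant * (L ^+ 3 * T).
Proof.
rewrite natrD !natrM /size_constant.
have h1 := rows_le; have h2 := cols_le; have a1 := rows_constant_ge1.
have b1 := cols_constant_ge1.
move: rows_constant cols_constant a1 b1 h1 h2 => a b' a1 b1 h1 h2.
have a0 : 0 <= a by apply: le_trans a1.
have b0 : 0 <= b' by apply: le_trans b1.
have r0 : 0 <= r%:R :> R by []. have c0 : 0 <= c%:R :> R by [].
have hrr : r%:R * r%:R <= a * (L * X) * (a * (L * X)) by apply: ler_pM.
have rr0 : 0 <= r%:R * r%:R :> R by apply: mulr_ge0.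
have hL : 0 <= L ^+ 3 by apply: exprn_ge0; apply: le_trans L1.
have hX3 : X ^+ 3 <= T.
  by apply: le_trans hXT; rewrite exprSr ler_wpM2l // sqr_ge0.
rewrite mulrDl; apply: lerD.
- apply: le_trans (ler_pM rr0 c0 hrr h2) _.
  have -> : a * (L * X) * (a * (L * X)) * (b' * (L * Y))
    = a ^+ 2 * b' * (L ^+ 3 * (X ^+ 2 * Y)) by ring.
  apply: ler_wpM2l; first by apply: mulr_ge0 => //; apply: exprn_ge0.
  by apply: ler_wpM2l.
- apply: le_trans (ler_pM rr0 r0 hrr h1) _.
  have -> : a * (L * X) * (a * (L * X)) * (a * (L * X))
    = a ^+ 3 * (L ^+ 3 * X ^+ 3) by ring.
  by apply: ler_wpM2l; [apply: exprn_ge0|apply: ler_wpM2l].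
Qed.

Lemma total_time_le (C1 : R) (p1 tau M : nat) : 0 < C1 ->
  tau%:R <= soft_bound C1 p1 m n eta 1 ->
  (5000 * (tau + 1) * M * (r * r * c + r * r * r))%:R
  <= soft_bound (5000 * M%:R * (C1 + 1) * size_constant) (p1 + 3) m n eta T.
Proof.
move=> C10 htau; rewrite /soft_bound.
have hL1 : 0 <= log_factor m n eta 1.
  rewrite /log_factor; have := ln_nat hm; have := ln_nat hn; move: ln_eta.
  have : 0 <= ln (1 + 1) :> R by rewrite ln_ge0 // lerDl.
  lra.
have ht : (tau + 1)%:R <= (C1 + 1) * L ^+ p1.
  rewrite natrD mulrDl mul1r lerD //; last exact: exprn_ege1.
  apply: le_trans htau _; rewrite /soft_bound mulr1 ler_wpM2l ?(ltW C10) //.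
  rewrite lerXn2r ?nnegrE //; first exact: le_trans L1.
  exact: log_factor_ge.
rewrite !natrM.
have -> : 5000 * M%:R * (C1 + 1) * size_constant * T * L ^+ (p1 + 3)
  = 5000 * ((C1 + 1) * L ^+ p1) * M%:R * (size_constant * (L ^+ 3 * T)).
  by rewrite exprD; ring.
apply: ler_pM cells_le; rewrite ?mulr_ge0 //.
by apply: ler_wpM2r => //; apply: ler_wpM2l.
Qed.

End Time.

Lemma scaled_le q p a : (0 < q)%N -> (p <= a)%N ->
  (q * p <= a * (q * q))%N /\ (p <= a * (q * q))%N.
Proof.
move=> q0 h; have h2 : (q <= q * q)%N by rewrite leq_pmulr.
split; first by rewrite mulnC leq_mul.
by apply: leq_trans h _; rewrite leq_pmulr // muln_gt0 q0.
Qed.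

Lemma query_cost_le q t : (0 < q)%N ->
  (q * (2 * t + 300) + t + 100 <= 5000 * (t + 1) * (q * q))%N.
Proof.
move=> h1; have u1 : (2 * t + 300 <= 300 * (t + 1))%N by lia.
have u2 : (t + 100 <= 100 * (t + 1))%N by lia.
have [e1 _] := scaled_le h1 u1; have [_ e2] := scaled_le h1 u2.
by move: e1 e2; clear; lia.
Qed.

Lemma sampling_cost_le q t : (0 < q)%N ->
  (q * (t + 30) + t + 21 + (q * (t + 200) + t + 170) * (2 * q)
    <= 5000 * (t + 1) * (q * q))%N.
Proof.
move=> h1; have u1 : (t + 30 <= 30 * (t + 1))%N by lia.
have u2 : (t + 21 <= 21 * (t + 1))%N by lia.
have [e1 _] := scaled_le h1 u1; have [_ e2] := scaled_le h1 u2.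
have u3 : (t + 200 <= 200 * (t + 1))%N by lia.
have u4 : (t + 170 <= 200 * (t + 1))%N by lia.
have e3 := leq_mul (leqnn q) u3.
have e4 : (t + 170 <= q * (200 * (t + 1)))%N.
  by apply: leq_trans u4 _; rewrite leq_pmull.
have e5 := leq_mul (leq_add e3 e4) (leqnn (2 * q)).
by move: e1 e2 e5; clear; lia.
Qed.

(** * The law of the output and the good event *)

Section Final.
Variables (R : realType) (c0 K : R) (hc0 : 0 < c0) (hK : 0 < K).
Local Notation C := R[i].
Variables (m n k : nat) (A : 'M[C]_(m, n)) (Ap : 'M[C]_(n, m)) (b : 'cV[C]_m)
  (kappa eps eta : R) (svd : svd_routine R) (tau M : nat) (B : R).
Local Notation F := (fnorm A).
Hypotheses (heps : 0 < eps < 1) (heta : 0 < eta < 1) (hk1 : (1 <= k)%N)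
  (hkappa : 0 < kappa) (hA : A != 0) (hk : (\rank A <= k)%N)
  (hA1 : opnorm A <= 1) (hAp : is_pseudoinverse A Ap) (hAp1 : opnorm Ap <= kappa)
  (hb : c0 * fnorm b <= fnorm (colspace_proj A b)) (hsvd : svd_correct svd)
  (hM : 1 <= M%:R * accuracy c0 K ^+ 2).
Local Notation E := (Env A b svd tau).
Local Notation r := (nrows n k F kappa eps eta).
Local Notation c := (ncols r k F kappa eps eta).
Local Notation N := (M * c)%N.
Local Notation init := (input_state m n k kappa eps eta).
Local Notation base p := (kappa ^+ p * k%:R ^+ 2 * F ^+ 2 / eps ^+ 2).
Hypothesis hB : (running_time k A kappa eps eta tau M)%:R <= B.

Lemma dims_gt0 : (0 < m)%N /\ (0 < n)%N.
Proof.
have /matrix0Pn[i [j _]] := hA.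
by split; [apply: leq_ltn_trans (ltn_ord i)|apply: leq_ltn_trans (ltn_ord j)].
Qed.

Let n0 : (0 < n)%N. Proof. by case: dims_gt0. Qed.
Let k1 : 1 <= k%:R :> R. Proof. by rewrite ler1n. Qed.
Let kap1 : 1 <= kappa. Proof. exact: (kappa_ge1 hAp hkappa hAp1 hA hA1). Qed.
Let kF1 : 1 <= kappa * F. Proof. exact: (kappa_fnorm_ge1 hAp hkappa hAp1 hA). Qed.
Let F0 : 0 < F. Proof. by rewrite fnorm_gt0. Qed.
Let Fk : F ^+ 2 <= k%:R. Proof. exact: (fnorm_sq_le_rank hsvd hk hA1). Qed.

Lemma nrowsE : r = natceil (1024 * ln (8 * n%:R / eta) * base 4).
Proof. by congr natceil; ring. Qed.

Lemma ncolsE : c = natceil (5184 * ln (8 * r%:R / eta) * base 8).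
Proof. by congr natceil; ring. Qed.

Let X1 : 1 <= base 4. Proof. exact: (base_ge1 k1 kap1 kF1 heps 2). Qed.
Let Y1 : 1 <= base 8. Proof. exact: (base_ge1 k1 kap1 kF1 heps 6). Qed.
Let r0 : (0 < r)%N. Proof. by case: (sizes_gt0 n0 heta X1 Y1 nrowsE ncolsE). Qed.
Let c_gt0 : (0 < c)%N. Proof. by case: (sizes_gt0 n0 heta X1 Y1 nrowsE ncolsE). Qed.
Let M0 : (0 < M)%N.
Proof. by case: M hM => // ; rewrite mul0r lt_geF ?ltr01. Qed.

Lemma rows_ge : 1024 * ln (8 * n%:R / eta) * base 4 <= r%:R.
Proof.
rewrite nrowsE; apply: le_natceil.
apply: mulr_ge0; last exact: le_trans ler01 X1.
by rewrite mulr_ge0 // ltW // ln_ratio_gt0.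
Qed.

Lemma cols_ge : 5184 * ln (8 * r%:R / eta) * base 8 <= c%:R.
Proof.
rewrite ncolsE; apply: le_natceil.
apply: mulr_ge0; last exact: le_trans ler01 Y1.
by rewrite mulr_ge0 // ltW // ln_ratio_gt0.
Qed.

Lemma regression_program_spec : rnd E [:: regression_program M] init
  (@outcome_law _ m n k A kappa eps eta M)
  (running_time k A kappa eps eta tau M) (@final_state _ m n k A b kappa eps eta svd M).
Proof.
apply: program_spec => //.
- have -> : rows_real k A kappa eps eta = 1024 * ln (8 * n%:R / eta) * base 4.
    by rewrite /rows_real; ring.
  apply: mulr_gt0; last exact: lt_le_trans ltr01 X1.
  by rewrite mulr_gt0 // ln_ratio_gt0.
- have -> : cols_real k A kappa eps eta r = 5184 * ln (8 * r%:R / eta) * base 8.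
    by rewrite /cols_real; ring.
  apply: mulr_gt0; last exact: lt_le_trans ltr01 Y1.
  by rewrite mulr_gt0 // ln_ratio_gt0.
- by move=> a /negbTE ha; split=> x /=; rewrite ha.
Qed.

Lemma stores_indices_inj (s : state R) r' c' (ii ii' : {ffun 'I_r' -> 'I_m})
    (jj jj' : {ffun 'I_c' -> 'I_n}) :
  stores_indices s ii jj -> stores_indices s ii' jj' -> ii = ii' /\ jj = jj'.
Proof.
move=> [_ h1 h2] [_ h3 h4]; split; apply/ffunP => x; apply: val_inj => /=.
  by rewrite -h1 h3.
by rewrite -h2 h4.
Qed.

(** The time bound holds on every run of positive weight, so the event t <= B removes nothing and
    the joint law of the indices is a marginal of [outcome_law]. *)
Lemma exact_law (ii : {ffun 'I_r -> 'I_m}) (jj : {ffun 'I_c -> 'I_n}) :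
  prob E (regression_program M) init (fun t s => t%:R <= B /\ stores_indices s ii jj)
  = sampling_law A ii jj.
Proof.
have [te [ss [h1 h2]]] := prob_rnd regression_program_spec; rewrite h2.
transitivity (\sum_(o : r.-tuple 'I_m * (c.-tuple ('I_r * 'I_n)
     * r.-tuple (N.-tuple ('I_m * 'I_n)))) outcome_law o *
   ((rows_of o.1 == ii) && (cols_of o.2.1 == jj))%:R).
  apply: eq_bigr => o _; have [->|wo] := eqVneq (outcome_law o) 0.
    by rewrite !mul0r.
  have [ht [hs _]] := h1 o wo; congr (_ * (nat_of_bool _)%:R).
  apply/idP/idP => [/asboolP[_ hs']|/andP[/eqP <- /eqP <-]].
    by have [-> ->] := stores_indices_inj hs hs'; rewrite !eqxx.
  by apply/asboolP; split=> //; apply: le_trans hB; rewrite ler_nat.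
rewrite -(pair_bigA _ (fun g p => outcome_law (g, p) *
  ((rows_of g == ii) && (cols_of p.1 == jj))%:R)) /=.
transitivity (\sum_(g : r.-tuple 'I_m) iid (row_law A) g *
    [forall t, tnth g t == ii t]%:R *
    \sum_(g2 : c.-tuple ('I_r * 'I_n)) iid (col_law A ii) g2 *
    [forall t, (tnth g2 t).2 == jj t]%:R).
  apply: eq_bigr => g _.
  have -> : [forall t, tnth g t == ii t] = (rows_of g == ii).
    apply/forallP/eqP => [h|<- t]; last by rewrite ffunE.
    by apply/ffunP => t; rewrite ffunE; apply/eqP.
  have [<-|_] := eqVneq (rows_of g) ii; last first.
    by rewrite mulr0 mul0r big1 // => p _; rewrite mulr0.
  rewrite mulr1 mulr_sumr.
  rewrite -(pair_bigA _ (fun g2 g3 => outcome_law (g, (g2, g3)) *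
    (true && (cols_of g2 == jj))%:R)) /=.
  apply: eq_bigr => g2 _.
  have -> : [forall t, (tnth g2 t).2 == jj t] = (cols_of g2 == jj).
    apply/forallP/eqP => [h|<- t]; last by rewrite ffunE.
    by apply/ffunP => t; rewrite ffunE; apply/eqP.
  rewrite -mulr_suml mulrA; congr (_ * _); rewrite /outcome_law /=.
  rewrite -mulr_sumr -mulr_sumr iid_sum1 ?mulr1 //.
  by apply: iid_sum1; apply: entry_law_sum1.
rewrite -mulr_suml.
rewrite (iid_independent (row_law A) (fun t x => x == ii t)).
rewrite (iid_independent (col_law A ii) (fun t x => x.2 == jj t)).
congr (_ * _); apply: eq_bigr => t _; first by rewrite big_pred1_eq.
rewrite big_mkcond -(pair_bigA _ (fun y j =>
    if j == jj t then col_law A ii (y, j) else 0)) /=.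
by apply: eq_bigr => y _; rewrite -big_mkcond big_pred1_eq.
Qed.

Section Outcome.
Variables (ii : {ffun 'I_r -> 'I_m}) (w : 'cV[C]_r).
Hypothesis hii : forall y, row (ii y) A != 0.
Local Notation start := (description_state n k kappa eps eta ii w).
Local Notation x := (approx_solution A ii w).

Lemma start_rows q : [/\ nmem (start q) 1 0 = r,
  forall y : 'I_r, nmem (start q) 2 y = ii y & stores_vector (start q) w].
Proof. by split=> // y /=; rewrite valK. Qed.

Lemma running_time_ge q : (q <= 5000 * (tau + 1) * (r * r))%N ->
  (q <= running_time k A kappa eps eta tau M)%N.
Proof.
move=> hq; apply: leq_trans hq _; rewrite /running_time.
move: (r) (c) r0 M0 => r' c' h1 h2.
apply: (@leq_trans (5000 * (tau + 1) * (r' * r' * c' + r' * r' * r'))).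
  by rewrite leq_mul // (leq_trans _ (leq_addl _ _)) // leq_pmulr.
by rewrite leq_mul // leq_pmulr.
Qed.

Lemma query_time_le : (r * (2 * tau + 300) + tau + 100 <=
  running_time k A kappa eps eta tau M)%N.
Proof.
apply: running_time_ge; exact: query_cost_le.
Qed.

Lemma queries_answered : answers_queries E query_program start x B.
Proof.
move=> j; have [q1 q2 q3] := start_rows j.
have [te [ss [h1 ->]]] :=
  prob_rnd (query_program_spec A b svd tau q1 q2 q3 (j := j) erefl).
have [ht hs] := h1 tt (oner_neq0 _).
rewrite sum_unit mul1r (_ : `[< _ >] = true) //; apply/asboolP; split=> //.
by apply: le_trans hB; rewrite ler_nat; apply: leq_trans ht query_time_le.
Qed.

Lemma sampling_time_le :
  (r * (tau + 30) + tau + 21 + (r * (tau + 200) + tau + 170) * (2 * r) <=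
   running_time k A kappa eps eta tau M)%N.
Proof.
apply: running_time_ge; exact: sampling_cost_le.
Qed.

(** The mean number of trials, F^2 |w|^2 / |x|^2, is at most 2 kappa^2 F^2 and hence at most 2 r,
    while a trial makes O(r) queries. *)
Lemma solution_sampled : x != 0 -> fnorm w ^+ 2 <= 2 * kappa ^+ 2 * fnorm x ^+ 2 ->
  samples_from E sampling_program (start 0%N) x B.
Proof.
move=> hx hw; have [q1 q2 q3] := start_rows 0.
apply: sampling_program_spec => //.
apply: le_trans hB.
apply: (@le_trans _ _ (r * (tau + 30) + tau + 21 +
  (r * (tau + 200) + tau + 170) * (2 * r))%N%:R); last first.
  by rewrite ler_nat sampling_time_le.
rewrite [leRHS]natrD lerD2l [leRHS]natrM; apply: ler_wpM2l => //.
have x2 : 0 < fnorm x ^+ 2 by rewrite exprn_gt0 // fnorm_gt0.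
rewrite /success invf_div ler_pdivrMr // natrM.
have h3 : kappa ^+ 2 * F ^+ 2 <= r%:R.
  apply: le_trans rows_ge.
  apply: (@le_trans _ _ (base 4)).
    apply: le_trans (base_fnorm_kappa k1 kap1 F0 heps 4).
    by rewrite ler_wpM2r ?sqr_ge0 // ler_weXn2l.
  rewrite ler_peMl ?(le_trans ler01 X1) //.
  by have := ln_ratio_ge heta n0; lra.
apply: (@le_trans _ _ (F ^+ 2 * (2 * kappa ^+ 2 * fnorm x ^+ 2))).
  by rewrite ler_wpM2l ?sqr_ge0.
have -> : F ^+ 2 * (2 * kappa ^+ 2 * fnorm x ^+ 2)
  = 2 * (kappa ^+ 2 * F ^+ 2) * fnorm x ^+ 2 by ring.
by rewrite ler_wpM2r ?(ltW x2) // ler_wpM2l.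
Qed.

End Outcome.

Local Notation target g := (row_sketch A (rows_of g) *m (A ^t* *m b)).
Local Notation tol := (tolerance c0 K k b kappa eps).

Definition bad_rows (g : r.-tuple 'I_m) : bool :=
  (2 * kappa ^+ 2)^-1 <= fnorm (A ^t* *m A -
    (row_sketch A (rows_of g))^t* *m row_sketch A (rows_of g)).

Definition bad_cols (g : r.-tuple 'I_m) (g2 : c.-tuple ('I_r * 'I_n)) : bool :=
  (4 * kappa ^+ 2)^-1 <= fnorm (gram (row_sketch A (rows_of g)) -
    gram (col_sketch F (row_sketch A (rows_of g)) (cols_of g2))).

Definition bad_batch (g : r.-tuple 'I_m) (h : N.-tuple ('I_m * 'I_n)) : bool :=
  tol < fnorm (batch_mean A b (row_sketch A (rows_of g)) N h - target g).

Definition bad_batches (g : r.-tuple 'I_m)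
    (g3 : r.-tuple (N.-tuple ('I_m * 'I_n))) : bool :=
  (r <= 2 * count (bad_batch g) g3)%N.

Lemma good_probability : 1 - eta <= \sum_(o : r.-tuple 'I_m * (c.-tuple ('I_r * 'I_n)
     * r.-tuple (N.-tuple ('I_m * 'I_n)))) outcome_law o *
   [&& ~~ bad_rows o.1, ~~ bad_cols o.1 o.2.1 & ~~ bad_batches o.1 o.2.2]%:R.
Proof.
have [eta0 eta1] := andP heta.
have d2 : 0 < (2 * kappa ^+ 2)^-1 by rewrite invr_gt0 mulr_gt0 ?exprn_gt0.
have d4 : 0 < (4 * kappa ^+ 2)^-1 by rewrite invr_gt0 mulr_gt0 ?exprn_gt0.
have dev := deviation_le kap1 kF1.
have L1 := ln_ratio_ge heta n0; have L2 := ln_ratio_ge heta r0.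
have e1 := expR_ln_ratio heta n0; have e2 := expR_ln_ratio heta r0.
(* The logarithms in r and c bring each of the three failures down to eta / 8. *)
apply: (@le_trans _ _ (1 - 3 * (eta / 8))); first by lra.
rewrite /outcome_law; apply: (union_bound (a := @iid _ _ (row_law A) r)
   (b := fun g => @iid _ _ (col_law A (rows_of g)) c)
   (c := @iid _ _ (@iid _ _ (entry_law A) N) r)
   (B1 := bad_rows) (B2 := bad_cols) (B3 := bad_batches)) => [g|g g2|g3||g hg||||].
- by apply: iid_ge0; apply: row_law_ge0.
- by apply: iid_ge0; apply: col_law_ge0.
- by apply: iid_ge0 => h; apply: iid_ge0; apply: entry_law_ge0.
- by apply: iid_sum1; apply: row_law_sum1.
- by apply: iid_sum1; apply: col_law_sum1 => //; apply: rows_neq0.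
- by do 2! apply: iid_sum1; apply: entry_law_sum1.
- apply: le_trans e1; apply: le_trans (row_tail k1 kap1 F0 Fk heps L1 rows_ge).
  by apply: row_concentration => //; apply: dev; rewrite ler1n.
- move=> g hg; apply: le_trans e2.
  apply: le_trans (col_tail k1 kap1 F0 Fk heps L2 cols_ge).
  by apply: col_sketch_concentration => //; [apply: rows_neq0|apply: dev; rewrite ler1n].
- move=> g hg; apply: le_trans e1.
  apply: le_trans (majority_size k1 kap1 kF1 heps L1 rows_ge).
  apply: majority_tail; first by move=> h; apply: iid_ge0; apply: entry_law_ge0.
    by apply: iid_sum1; apply: entry_law_sum1.
  apply: (batch_failure hc0 hK b heps hk1 hkappa hA) => //.
    by apply: fnorm_row_sketch => //; apply: rows_neq0.
  exact: (batch_size k1 kap1 F0 Fk heps L2 cols_ge).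
Qed.

Lemma good_event : 1 - eta <= prob E (regression_program M) init
  (fun t s => t%:R <= B /\
     exists (ii : {ffun 'I_r -> 'I_m}) (jj : {ffun 'I_c -> 'I_n}) (w : 'cV[C]_r),
       let x := approx_solution A ii w in
       let start := description_state n k kappa eps eta ii w in
       [/\ stores_indices s ii jj, stores_vector s w,
           valid_output A b k eps K ii jj w,
           answers_queries E query_program start x B &
           b != 0 -> samples_from E sampling_program (start 0%N) x B]).
Proof.
have [te [ss [h1 ->]]] := prob_rnd regression_program_spec.
apply: le_trans good_probability _; apply: ler_sum => -[g [g2 g3]] _.
have [->|wo] := eqVneq (outcome_law (g, (g2, g3))) 0; first by rewrite !mul0r.
apply: ler_wpM2l.
  rewrite /outcome_law !mulr_ge0 ?iid_ge0 // => *;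
    by rewrite ?row_law_ge0 ?col_law_ge0 ?iid_ge0 // => *; apply: entry_law_ge0.
rewrite ler_nat; case: and3P => //= -[b1 b2 b3].
rewrite lt0b; apply/asboolP.
have [ht [hs [p [hsel hw]]]] := h1 _ wo.
have hg : iid (row_law A) g != 0.
  by apply: contra wo => /eqP h; rewrite /outcome_law /= h mul0r.
have hii := rows_neq0 hg.
split; first by apply: le_trans hB; rewrite ler_nat.
set ii := rows_of g in hs hw hsel hii *; set jj := cols_of g2 in hs hw *.
have hE1 : fnorm (A ^t* *m A - (row_sketch A ii)^t* *m row_sketch A ii)
    <= (2 * kappa ^+ 2)^-1 by move: b1; rewrite -ltNge => /ltW.
have hE2 := b2; rewrite /bad_cols -ltNge in hE2; move/ltW: hE2 => hE2.
set yh := batches A b (row_sketch A ii) g3 p in hw.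
have hyh : exists v, yh = row_sketch A ii *m v by apply: batch_mean_factor.
have hclose : fnorm (yh - row_sketch A ii *m (A ^t* *m b)) <= 3 * tol.
  apply: (selected_close (tolerance_ge0 hc0 hK k b heps hkappa) hsel).
  move: b3; rewrite /bad_batches -ltnNge => b3.
  (* [selected] refers to batch indices, whereas [bad_batches] counts elements of the tuple. *)
  have -> : count (fun a => fnorm (batches A b (row_sketch A ii) g3 a
        - row_sketch A ii *m (A ^t* *m b)) <= tol)%R (iota 0 r)
      = count (predC (bad_batch g)) g3.
    pose P h := (fnorm (batch_mean A b (row_sketch A ii) N h
        - row_sketch A ii *m (A ^t* *m b)) <= tol)%R.
    transitivity (count P (map val g3)).
      by rewrite -[in RHS](mkseq_nth [::] (map val g3)) size_map size_tuple count_map.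
    by rewrite count_map; apply: eq_count => h; rewrite /= /bad_batch -leNgt.
  move: b3; have := count_predC (bad_batch g) g3; rewrite size_tuple.
  move: (count (bad_batch g) _) (count (predC _) _) => u v.
  by move: (r) => r'; clear; lia.
exists ii, jj, (regression_vector (svd (col_sketch F (row_sketch A ii) jj)).1
                       (svd (col_sketch F (row_sketch A ii) jj)).2 k yh).
split=> //.
- exact: (regression_valid hK heps hkappa hAp hAp1 hsvd hE1 hE2 hclose).
- by apply: queries_answered.
- move=> b0.
  have [x0 hwx] := solution_neq0 hc0 hK heps hk1 hkappa hA hk hA1 hAp hAp1 hb hsvd
    hE1 hE2 hyh hclose b0.
  by apply: solution_sampled.
Qed.

End Final.

Theorem theorem2 (R : realType) (c0 K : R) (hc0 : 0 < c0) (hK : 0 < K) :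
  exists P Q S : cmd,
  forall (C1 : R) (p1 : nat), 0 < C1 ->
  exists (C2 : R) (p2 : nat),
  forall (m n k : nat) (A : 'M[R[i]]_(m, n)) (Ap : 'M[R[i]]_(n, m))
         (b : 'cV[R[i]]_m) (kappa eps eta : R)
         (svd : svd_routine R) (tau : nat),
  0 < eps < 1 -> 0 < eta < 1 -> (1 <= k)%N -> 0 < kappa ->
  A != 0 -> (\rank A <= k)%N -> opnorm A <= 1 ->
  is_pseudoinverse A Ap -> opnorm Ap <= kappa ->
  c0 * fnorm b <= fnorm (colspace_proj A b) ->
  svd_correct svd ->
  tau%:R <= soft_bound C1 p1 m n eta 1 ->
  let T := kappa ^+ 16 * k%:R ^+ 6 * fnorm A ^+ 6 / eps ^+ 6 in
  let B := soft_bound C2 p2 m n eta T in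
  let E := Env A b svd tau in
  let r := nrows n k (fnorm A) kappa eps eta in
  let c := ncols r k (fnorm A) kappa eps eta in
  (forall (ii : {ffun 'I_r -> 'I_m}) (jj : {ffun 'I_c -> 'I_n}),
     prob E P (input_state m n k kappa eps eta)
       (fun t s => t%:R <= B /\ stores_indices s ii jj)
     = sampling_law A ii jj) /\
  1 - eta <=
    prob E P (input_state m n k kappa eps eta)
      (fun t s => t%:R <= B /\
         exists (ii : {ffun 'I_r -> 'I_m}) (jj : {ffun 'I_c -> 'I_n})
                (w : 'cV[R[i]]_r),
           let x := approx_solution A ii w in
           let init := description_state n k kappa eps eta ii w in
           [/\ stores_indices s ii jj, stores_vector s w,
               valid_output A b k eps K ii jj w,
               answers_queries E Q init x B &
               b != 0 -> samples_from E S (init 0%N) x B]).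
Proof.
(* M depends on c0 and K only, so the three programs are fixed before the input is. *)
pose M := natceil (accuracy c0 K ^+ 2)^-1.
have acc0 : 0 < accuracy c0 K ^+ 2 by rewrite exprn_gt0 // accuracy_gt0.
have hM : 1 <= M%:R * accuracy c0 K ^+ 2.
  by rewrite -ler_pdivrMr // div1r le_natceil // invr_ge0 ltW.
exists (regression_program M), query_program, sampling_program => C1 p1 C10.
exists (5000 * M%:R * (C1 + 1) * size_constant R), (p1 + 3)%N.
move=> m n k A Ap b kappa eps eta svd tau heps heta hk1 hkappa hA hk hA1 hAp hAp1
  hb hsvd htau T B E r c.
have [m0 n0] := dims_gt0 hA.
have k1 : 1 <= k%:R :> R by rewrite ler1n.
have kap1 := kappa_ge1 hAp hkappa hAp1 hA hA1.
have kF1 := kappa_fnorm_ge1 hAp hkappa hAp1 hA.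
pose base p := kappa ^+ p * k%:R ^+ 2 * fnorm A ^+ 2 / eps ^+ 2.
have X1 : 1 <= base 4 by apply: (base_ge1 k1 kap1 kF1 heps 2).
have Y1 : 1 <= base 8 by apply: (base_ge1 k1 kap1 kF1 heps 6).
have eps0 : eps != 0 by case/andP: heps => h _; rewrite gt_eqF.
(* The exponents of T are those of r^2 c: 4 + 4 + 8 for kappa, and 2 + 2 + 2 for k, F and 1 /
   eps. *)
have XT : base 4 ^+ 2 * base 8 = T by rewrite /base /T; field.
have T1 : 1 <= T by rewrite -XT mulr_ege1 // exprn_ege1.
have XY : base 4 <= base 8.
  rewrite /base !ler_wpM2r ?invr_ge0 ?sqr_ge0 //.
  by rewrite ler_weXn2l.
have hB : (running_time k A kappa eps eta tau M)%:R <= B.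
  apply: (@total_time_le _ _ _ _ _ m0 n0 heta T1 (base 4) (base 8) r c) => //.
  - by rewrite XT.
  - exact: nrowsE.
  - exact: ncolsE.
split.
- exact: (exact_law b svd heps heta hk1 hkappa hA hA1 hAp hAp1 hM hB).
- exact: (good_event hc0 hK heps heta hk1 hkappa hA hk hA1 hAp hAp1 hb hsvd hM hB).
Qed.
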